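(* Let $(X,T)$ be a topologically transitive group extension with property (C) of a Gibbs-Markov map with the b.i.p. property (setting and notation as in the context). If $\rho<1$ and $\mu_G$ is $T$-invariant, then, for $\widehat\mu_G$-a.e. $((w_i),g)\in Y$ (where $g=g_0$ is the group coordinate at time $0$), $$\lim_{n\to\infty}\nu_{\mathbf o}\big(X_{g\,\psi_{w_{-n}}\cdots\psi_{w_{-1}}}\big)/\rho^n=0,\qquad \lim_{n\to\infty}\frac{\nu_{\mathbf o}([w_{-n}\ldots w_{-1},g])}{\mu([w_{-n}\ldots w_{-1}])}=0.$$ Moreover, if the group extension is symmetric, then for $\mu$-a.e. $x=(w_1w_2\ldots)\in\Sigma$ and all $g\in G$, $$\lim_{n\to\infty}\nu_{\mathbf o}(X_{\psi_n(x)})/\rho^n=0,\qquad \lim_{n\to\infty}\frac{\nu_{\mathbf o}([w_1\ldots w_n,\ \psi_n(x)\,g\,\psi_n(x)^{-1}])}{\mu([w_1\ldots w_n])}=0.$$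
   Context: Base. $\mathcal W$ is a countable alphabet, $(a_{ij})_{i,j\in\mathcal W}$ a $0$-$1$-matrix without zero rows or columns, $\Sigma=\{(w_k)_{k\ge1}: w_k\in\mathcal W,\ a_{w_kw_{k+1}}=1\ \forall k\}$, and $\theta:\Sigma\to\Sigma$ is the left shift. $\mathcal W^n$ is the set of admissible words of length $n$, $\mathcal W^\infty=\bigcup_n\mathcal W^n$, $[w]\subset\Sigma$ is the cylinder of $w$, and for $w\in\mathcal W^n$, $\tau_w:\theta^n([w])\to[w]$ is the inverse of $\theta^n|_{[w]}$. $(\Sigma,\theta)$ is topologically mixing: for all $a,b\in\mathcal W$ there is $N$ with $\theta^n([a])\cap[b]\neq\emptyset$ for all $n\ge N$. The b.i.p. property means: topologically mixing, and there is a finite set $\mathcal I\subset\mathcal W$ such that for each $v\in\mathcal W$ there are $\beta_1,\beta_2\in\mathcal I$ with $v\beta_1,\beta_2v\in\mathcal W^2$. For $f:\Sigma\to\mathbb R$, $V_n(f)=\sup\{|f(x)-f(y)|: x,y \text{ agree in the first } n \text{ letters}\}$; $f$ is locally Hölder continuous if for some $r\in(0,1)$ and $C>0$, $V_n(f)\le Cr^n$ for all $n\ge1$. Potential. $\varphi:\Sigma\to(0,\infty)$, $\Phi_n=\prod_{k=0}^{n-1}\varphi\circ\theta^k$, $L_\varphi f(x)=\sum_{v\in\mathcal W,\,x\in\theta([v])}\varphi(\tau_v x)f(\tau_v x)$, $\int f\,dL_\varphi^*\mu=\int L_\varphi f\,d\mu$. The Gurevič pressure is $P_G(\theta,\varphi)=\limsup_n\frac1n\log\sum_{\theta^nx=x,\,x\in[a]}\Phi_n(x)$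 ($a\in\mathcal W$). Standing assumption: $P_G(\theta,\varphi)=0$. Gibbs-Markov setting. $(\Sigma,\theta)$ has the b.i.p. property, $\log\varphi$ is locally Hölder continuous, and $\mu$ is a Borel probability measure on $\Sigma$ with $L_\varphi^*\mu=\mu$ such that $(\Sigma,\theta,\mu)$ is Gibbs-Markov: for every $w\in\mathcal W$, $\mu|_{\theta([w])}$ and $\mu\circ\tau_w$ are equivalent, $\inf_{w\in\mathcal W}\mu(\theta([w]))>0$, and there are $r\in(0,1)$, $C>0$ with $\sup_{x,y\in[w]}|\log\frac{d\mu\circ\tau_v}{d\mu}(x)-\log\frac{d\mu\circ\tau_v}{d\mu}(y)|\le Cr^n$ for all $m,n\in\mathbb N$, $v\in\mathcal W^m$, $w\in\mathcal W^n$ with $vw\in\mathcal W^{m+n}$. $\mu_G$ is the product of $\mu$ and counting measure on $G$. Group extension. $G$ is a countable discrete group with identity $\mathrm{id}$, $\psi:\Sigma\to G$ is constant on each $[a]$, $a\in\mathcal W$, with value $\psi(a)=\psi_a$; $X=\Sigma\times G$ with the product topology, $T(x,g)=(\theta x,g\psi(x))$, $X_g=\Sigma\times\{g\}$, $[w,g]=[w]\times\{g\}$, $\psi_n(x)=\psi(x)\psi(\theta x)\cdots\psi(\theta^{n-1}x)$. $(X,T)$ is topologically transitive: for all $a,b\in\mathcal W$, $g,h\in G$ there is $n\in\mathbb N$ with $T^n([a,g])\cap[b,h]\ne\emptyset$. $\varphi,\Phi_n$ are lifted to $X$ by $\varphi(x,g)=\varphi(x)$. $\mathcal L_\varphi f(x,g)=\sum_{v\in\mathcal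 W,\,x\in\theta([v])}\varphi(\tau_vx)f(\tau_vx,g\psi(v)^{-1})$. Symmetry. The group extension $(\Sigma,\theta,\psi,\varphi)$ is symmetric if there is a map $\mathcal W\to\mathcal W$, $w\mapsto w^\dagger$, with $(w^\dagger)^\dagger=w$; $vw$ admissible iff $w^\dagger v^\dagger$ admissible; $\psi(v^\dagger)=\psi(v)^{-1}$; and, with $(w_1\ldots w_n)^\dagger=(w_n^\dagger\ldots w_1^\dagger)$, $\sup_{n}\sup_{w\in\mathcal W^n}\sup_{x\in[w],y\in[w^\dagger]}\Phi_n(x)/\Phi_n(y)<\infty$. Property (C). Fix $\xi\in\Sigma$. Let $\mathcal Z^n(\xi)=\mathcal L_\varphi^n(\mathbf 1_{X_{\mathrm{id}}})(\xi,\mathrm{id})=\sum_{\theta^nx=\xi,\,\psi_n(x)=\mathrm{id}}\Phi_n(x)$ and $\rho=\limsup_n\sqrt[n]{\mathcal Z^n(\xi)}$. Consider sequences $(b_n)$, $b_n=\prod_{k=1}^n\lambda(k)$ with $\lambda(k)\ge1$ non-increasing and $\lambda(k)\to1$, such that $\sum_n b_n\mathcal Z^n(\xi)s^{-n}$ is infinite for $0<s\le\rho$ and finite for $s>\rho$. Put $\mathcal P(s)=\sum_n s^{-n}b_n\mathcal Z^n(\xi)$ and, for $s>\rho$, $m_s=\frac1{\mathcal P(s)}\sum_{n\in\mathbb N}s^{-n}b_n\sum_{T^n(z)=(\xi,\mathrm{id})}\Phi_n(z)\delta_z$. Property (C): for some such $(b_n)$ there is $s_k\searrow\rho$ such that the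 restrictions of $m_{s_k}$ to $X_{\mathrm{id}}$ converge weakly to a probability measure on $X_{\mathrm{id}}$. This $(b_n)$ is fixed. Measure $\nu_{\mathbf o}$. In this setting there is a sequence $s_k\searrow\rho$ (fixed) such that for every $z\in X$ there is a $\sigma$-finite measure $\nu_z$ on $X$ with $\int f\,d\nu_z=\lim_k\frac1{\mathcal P(s_k)}\sum_nb_ns_k^{-n}(\mathcal L_\varphi^nf)(z)$ for all non-negative continuous $f$. Fix $\xi_0\in X_{\mathrm{id}}$ and put $\nu_{\mathbf o}=\nu_{\xi_0}$. Natural extension. $Y=\{((w_i,g_i))_{i\in\mathbb Z}: w_i\in\mathcal W,\ g_i\in G,\ a_{w_iw_{i+1}}=1,\ g_{i+1}=g_i\psi(w_i)\}$; since $(w_i)$ and $g_0$ determine all $g_i$, elements are written $((w_i),g)$ with $g=g_0$. $S:Y\to Y$ is the left shift. For a $T$-invariant measure $m$ on $X$, $\widehat m$ is the $S$-invariant measure on $Y$ such that, for every $k\in\mathbb Z$, every admissible word $(w_0\ldots w_n)$ and $g_0\in G$, with $g_{j+1}=g_j\psi(w_j)$, the set of points of $Y$ whose coordinates at times $k,\ldots,k+n$ are $(w_0,g_0),\ldots,(w_n,g_n)$ has $\widehat m$-measure $m([w_0\ldots w_n,g_0])$. *)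

(* Defs.v *)
From HB Require Import structures.
From mathcomp Require Import all_boot all_order all_algebra.
From mathcomp Require Import all_classical all_reals all_analysis.
From mathcomp Require Import measurable_realfun.

Set Implicit Arguments.
Unset Strict Implicit.
Unset Printing Implicit Defensive.

Import Order.TTheory GRing.Theory Num.Theory.
Import numFieldNormedType.Exports.

Local Open Scope classical_set_scope.
Local Open Scope ring_scope.

(* The alphabet is at most countable.  It is required to be inhabited because
   measurable types are pointed; as the shift space carries a probability
   measure, this is no restriction. *)
Record transition_matrix (W : countType) := TransitionMatrix {
  admits :> rel W;
  admits_row : forall v, exists w, admits v w;
  admits_col : forall w, exists v, admits v w;
  admits_letter : exists v : W, true }.

Section DefaultLetters.
Context (W : countType) (M : transition_matrix W).

Definition next_letter v : W := xchoose (admits_row M v).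
Definition prev_letter v : W := xchoose (admits_col M v).
Definition some_letter : W := xchoose (admits_letter M).

Fact next_letterP v : M v (next_letter v).
Proof. exact: (xchooseP (admits_row M v)). Qed.

Fact prev_letterP v : M (prev_letter v) v.
Proof. exact: (xchooseP (admits_col M v)). Qed.

End DefaultLetters.

(* Positions are numbered from 0: the letter written w_k (k >= 1) for
   x = (w_1 w_2 ...) is [x k.-1]. *)
Definition shift_space (W : countType) (M : transition_matrix W) : Type :=
  {x : nat -> W | `[< forall k, M (x k) (x k.+1) >]}.

Definition letters (W : countType) (M : transition_matrix W)
  (x : shift_space M) : nat -> W := sval x.
Coercion letters : shift_space >-> Funclass.

Section ShiftSpace.
Context (W : countType) (M : transition_matrix W).

HB.instance Definition _ := SubChoice.on (shift_space M).

Fact lettersP (x : shift_space M) k : M (x k) (x k.+1).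
Proof. by have /asboolP := valP x; apply. Qed.

Fact default_pointP :
  `[< forall k, M (iter k (next_letter M) (some_letter M))
                  (iter k.+1 (next_letter M) (some_letter M)) >].
Proof. by apply/asboolP => k; exact: next_letterP. Qed.

HB.instance Definition _ := isPointed.Build (shift_space M)
  (exist _ (fun k => iter k (next_letter M) (some_letter M)) default_pointP).

(* subspace topology of the product of discrete alphabets, and its Borel sets *)
HB.instance Definition _ := Topological.copy (shift_space M)
  (initial_topology
     (@letters W M : shift_space M -> {ptws nat -> discrete_topology W})).

HB.instance Definition _ := @isMeasurable.Build
  (sigma_display (@open (shift_space M))) (shift_space M)
  <<s @open (shift_space M) >>
  (@sigma_algebra0 _ setT _) (@sigma_algebraC _ _)
  (@sigma_algebra_bigcup _ setT _).

Fact theta_subproof (x : shift_space M) :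
  `[< forall k, M (x k.+1) (x k.+2) >].
Proof. by apply/asboolP => k; exact: lettersP. Qed.

Definition theta (x : shift_space M) : shift_space M :=
  exist _ (fun k => x k.+1) (theta_subproof x).

Definition admissible (w : seq W) : bool := (w != [::]) && sorted M w.

Definition cylinder (w : seq W) : set (shift_space M) :=
  [set x | mkseq x (size w) = w].

(* theta^n([w]) for a word w of length n *)
Definition cylinder_image (w : seq W) : set (shift_space M) :=
  iter (size w) theta @` cylinder w.

(* The inverse branch tau_w prepends w.  Only its values on
   [cylinder_image w] matter: where [w x] is not admissible, the value is the
   default x of [insubd]. *)
Definition tau (w : seq W) (x : shift_space M) : shift_space M :=
  insubd x (fun k => if (k < size w)%N then nth (x 0%N) w k
                     else x (k - size w)%N).

Definition mixing := forall a b : W, exists N, forall n, (N <= n)%N ->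
  (iter n theta @` cylinder [:: a]) `&` cylinder [:: b] !=set0.

Definition bip := mixing /\ exists I : set W, finite_set I /\
  forall v, exists b1 b2, [/\ I b1, I b2, M v b1 & M b2 v].

End ShiftSpace.

Arguments admissible {W} M w.
Arguments cylinder {W} M w.
Arguments cylinder_image {W} M w.

Lemma tauP (W : countType) (M : transition_matrix W) (w : seq W)
    (x : shift_space M) : cylinder_image M w x ->
  cylinder M w (tau w x) /\ iter (size w) (@theta W M) (tau w x) = x.
Proof.
have iterE n (y : shift_space M) k : iter n (@theta W M) y k = y (n + k)%N.
  by elim: n k => //= n IHn k; rewrite /theta /letters /= -/(letters _) IHn addnS.
move=> [y yw <-].
suff -> : tau w (iter (size w) (@theta W M) y) = y by [].
have E : (fun k => if (k < size w)%N
            then nth (iter (size w) (@theta W M) y 0%N) w k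
            else iter (size w) (@theta W M) y (k - size w)%N) = y :> (nat -> W).
  apply/funext => k; case: ltnP => kw; last by rewrite iterE subnKC.
  by rewrite -{2}[w]yw nth_mkseq.
by rewrite /tau E; apply: val_inj; rewrite val_insubd ifT //; exact: (valP y).
Qed.

(* G with the discrete topology and, as the groups of interest are countable,
   the power set as Borel sigma-algebra *)
Definition discrete_group (G : groupType) : Type := G.

Section DiscreteGroup.
Context (G : groupType).

HB.instance Definition _ := Group.on (discrete_group G).
HB.instance Definition _ := isPointed.Build (discrete_group G) 1%g.
HB.instance Definition _ := hasNbhs.Build (discrete_group G) principal_filter.
HB.instance Definition _ := Discrete_ofNbhs.Build (discrete_group G) erefl.
HB.instance Definition _ := @isMeasurable.Build default_measure_display
  (discrete_group G) (@discrete_measurable G) (@discrete_measurable0 G)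
  (@discrete_measurableC G) (@discrete_measurableU G).

End DiscreteGroup.

Section Potential.
Context (R : realType) (W : countType) (M : transition_matrix W).
Local Notation Sigma := (shift_space M).
Implicit Types (phi : Sigma -> R) (mu : probability Sigma R).

Definition letter_variation (f : Sigma -> R) (n : nat) : \bar R :=
  ereal_sup [set d | exists x y : Sigma,
    (forall k, (k < n)%N -> x k = y k) /\ d = (`|f x - f y|)%:E].

Definition locally_holder (f : Sigma -> R) := exists r C : R,
  [/\ 0 < r < 1, 0 < C &
    forall n, (1 <= n)%N -> (letter_variation f n <= (C * r ^+ n)%:E)%E].

Definition birkhoff_prod phi (n : nat) (x : Sigma) : R :=
  \prod_(k < n) phi (iter k (@theta W M) x).

Definition pressure phi (a : W) : \bar R :=
  limn_esup (fun n => (n%:R^-1)%:E *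
    lne (\esum_(x in [set x | iter n (@theta W M) x = x] `&` cylinder M [:: a])
           (birkhoff_prod phi n x)%:E))%E.

Definition transfer phi (f : Sigma -> \bar R) (x : Sigma) : \bar R :=
  (\esum_(v in [set v | cylinder_image M [:: v] x])
     (phi (tau [:: v] x))%:E * f (tau [:: v] x))%E.

Definition conformal phi mu := forall f : Sigma -> \bar R,
  measurable_fun setT f -> (forall x, 0 <= f x)%E ->
  (\int[mu]_x transfer phi f x = \int[mu]_x f x)%E.

Definition mu_tau mu (w : seq W) (A : set Sigma) : \bar R :=
  mu (tau w @` (A `&` cylinder_image M w)).

Definition mu_restr mu (w : seq W) (A : set Sigma) : \bar R :=
  mu (A `&` cylinder_image M w).

(* [J v] is a version on theta^m([v]) of the Radon-Nikodym derivative of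
   mu o tau_v with respect to mu *)
Definition inverse_branch_density mu (J : seq W -> Sigma -> R) :=
  forall v, admissible M v ->
  [/\ measurable_fun (cylinder_image M v) (J v),
      forall x, cylinder_image M v x -> 0 < J v x &
      forall A : set Sigma, measurable A ->
        (mu_tau mu v A = \int[mu]_(x in A `&` cylinder_image M v) (J v x)%:E)%E].

(* The derivatives are defined up to null sets, so the bound on their
   oscillation is one on suitable versions of them. *)
Definition gibbs_markov mu :=
  [/\ forall v : W, mu_tau mu [:: v] `<< mu_restr mu [:: v] /\
                    mu_restr mu [:: v] `<< mu_tau mu [:: v],
      (0 < ereal_inf [set mu (cylinder_image M [:: v]) | v in [set: W]])%E &
      exists J, inverse_branch_density mu J /\
      exists r C : R, [/\ 0 < r < 1, 0 < C &
        forall v w, admissible M v -> admissible M w -> admissible M (v ++ w) ->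
        forall x y, cylinder M w x -> cylinder M w y ->
          `|ln (J v x) - ln (J v y)| <= C * r ^+ size w]].

End Potential.

Section GroupExtension.
Context (R : realType) (W : countType) (M : transition_matrix W).
Context (G : groupType).
Local Notation Sigma := (shift_space M).
Local Notation X := (Sigma * discrete_group G)%type.
(* psi is given by its values on letters: psi(x) = psi_(x_1) *)
Implicit Types (phi : Sigma -> R) (psi : W -> G).

Definition psi_word psi (w : seq W) : G := \big[*%g/1%g]_(v <- w) psi v.

Definition psi_n psi (n : nat) (x : Sigma) : G := psi_word psi (mkseq x n).

Definition ext_map psi (z : X) : X := (theta z.1, (z.2 * psi (z.1 0%N))%g).

Definition fiber (g : G) : set X := [set z | z.2 = g].

Definition ext_cylinder (w : seq W) (g : G) : set X := cylinder M w `*` [set g].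

Definition ext_transitive psi := forall (a b : W) (g h : G),
  exists n, (1 <= n)%N /\
    (iter n (ext_map psi) @` ext_cylinder [:: a] g)
      `&` ext_cylinder [:: b] h !=set0.

Definition ext_transfer phi psi (f : X -> \bar R) (z : X) : \bar R :=
  (\esum_(v in [set v | cylinder_image M [:: v] z.1])
     (phi (tau [:: v] z.1))%:E * f (tau [:: v] z.1, z.2 * (psi v)^-1)%g)%E.

Definition symmetric_extension phi psi := exists dag : W -> W,
  [/\ forall w, dag (dag w) = w,
      forall v w, M v w = M (dag w) (dag v),
      forall v, psi (dag v) = (psi v)^-1%g &
      exists C : R, forall w, admissible M w ->
        forall x y, cylinder M w x -> cylinder M (rev (map dag w)) y ->
          birkhoff_prod phi (size w) x / birkhoff_prod phi (size w) y <= C].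

Definition mu_G (mu : probability Sigma R) : set X -> \bar R :=
  (mu \x counting)%E.

Definition ext_invariant psi (m : set X -> \bar R) :=
  forall A : set X, measurable A -> m (ext_map psi @^-1` A) = m A.

(* Z^n(xi) and, below, rho *)
Definition Zn phi psi (xi : Sigma) (n : nat) : \bar R :=
  iter n (ext_transfer phi psi) (fun z => (\1_(fiber 1%g) z)%:E) (xi, 1%g).

Definition growth_rate phi psi xi : \bar R :=
  limn_esup (fun n => Zn phi psi xi n `^ n%:R^-1)%E.

(* b_n = lambda(1) ... lambda(n); the value lambda(0) plays no role. *)
Definition weight (lambda : nat -> R) (n : nat) : R :=
  \prod_(1 <= k < n.+1) lambda k.

Definition poincare phi psi xi lambda (s : R) : \bar R :=
  (\sum_(1 <= n <oo) (s ^- n * weight lambda n)%:E * Zn phi psi xi n)%E.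

Definition divergence_weights phi psi xi (rho : R) lambda :=
  [/\ forall k, (1 <= k)%N -> 1 <= lambda k,
      forall j k, (1 <= j)%N -> (j <= k)%N -> lambda k <= lambda j,
      lambda @ \oo --> (1 : R),
      forall s, 0 < s -> s <= rho -> poincare phi psi xi lambda s = +oo%E &
      forall s, rho < s -> (poincare phi psi xi lambda s < +oo)%E].

Definition decreases_to (s : nat -> R) (rho : R) :=
  [/\ forall k, rho < s k, forall j k, (j <= k)%N -> s k <= s j &
      s @ \oo --> rho].

Definition orbit_measure phi psi xi lambda (s : R) (A : set X) : \bar R :=
  ((poincare phi psi xi lambda s)^-1 *
   \sum_(1 <= n <oo) (s ^- n * weight lambda n)%:E *
     \esum_(z in [set z | iter n (ext_map psi) z = (xi, 1%g)])
       (birkhoff_prod phi n z.1)%:E * \d_z A)%E.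

(* Property (C) for the sequence b_n = weight lambda n.  As X_id is clopen, the
   bounded continuous functions on X_id are the restrictions of those on X. *)
Definition property_C phi psi xi (rho : R) lambda :=
  divergence_weights phi psi xi rho lambda /\
  exists s, decreases_to s rho /\
  exists m : probability X R, m (fiber 1%g) = 1%E /\
    forall f : X -> R, continuous f -> (exists B : R, forall z, `|f z| <= B) ->
      (fun k => \int[orbit_measure phi psi xi lambda (s k)]_(z in fiber 1%g)
                  (f z)%:E)%E @ \oo
        --> (\int[m]_(z in fiber 1%g) (f z)%:E)%E.

(* The measures nu_z.  The limit formula is asked for bounded functions which
   vanish outside finitely many of the sets X_g.  It already determines nu_z,
   and it cannot be asked of all non-negative continuous functions: for
   rho < 1 and an atomless nu_z, a sum of bumps of height 1 around finite parts
   of T^-n(z) that leave every X_g and have small enough supports is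
   nu_z-integrable, while its sums over n diverge for s < 1. *)
Definition patterson_family phi psi xi lambda (s : nat -> R)
    (nu : X -> {measure set X -> \bar R}) :=
  forall z, sigma_finite setT (nu z) /\
  forall f : X -> R, continuous f -> (forall y, 0 <= f y) ->
    (exists B : R, forall y, f y <= B) ->
    (exists F : set G, finite_set F /\ forall y : X, ~ F y.2 -> f y = 0) ->
    (fun k => (poincare phi psi xi lambda (s k))^-1 *
       \sum_(1 <= n <oo) (weight lambda n * s k ^- n)%:E *
          iter n (ext_transfer phi psi) (fun y => (f y)%:E) z)%E @ \oo
      --> (\int[nu z]_y (f y)%:E)%E.

End GroupExtension.

Arguments ext_cylinder {W} M {G} w g.
Arguments fiber {W} M {G} g.
Arguments mu_G {R W M} G mu.

Definition natural_space (W : countType) (M : transition_matrix W)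
    (G : groupType) (psi : W -> G) : Type :=
  {y : int -> W * G | `[< forall i, M (y i).1 (y (i + 1)).1 /\
                            (y (i + 1)).2 = ((y i).2 * psi (y i).1)%g >]}.

Definition coords (W : countType) (M : transition_matrix W) (G : groupType)
  (psi : W -> G) (y : natural_space M psi) : int -> W * G := sval y.
Coercion coords : natural_space >-> Funclass.

Section NaturalExtension.
Context (R : realType) (W : countType) (M : transition_matrix W).
Context (G : groupType) (psi : W -> G).
Local Notation X := (shift_space M * discrete_group G)%type.
Local Notation Y := (natural_space M psi).

HB.instance Definition _ := SubChoice.on Y.

Fact coordsP (y : Y) i : M (y i).1 (y (i + 1)).1 /\
  (y (i + 1)).2 = ((y i).2 * psi (y i).1)%g.
Proof. by have /asboolP := valP y; apply. Qed.

Definition default_letter (i : int) : W :=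
  match i with
  | Posz n => iter n (next_letter M) (some_letter M)
  | Negz n => iter n.+1 (prev_letter M) (some_letter M)
  end.

Definition default_group (i : int) : G :=
  match i with
  | Posz n => iteri n (fun k h => h * psi (default_letter (Posz k)))%g 1%g
  | Negz n => iteri n.+1 (fun k h => h * (psi (default_letter (Negz k)))^-1)%g 1%g
  end.

Fact default_coordsP : `[< forall i : int,
  M (default_letter i) (default_letter (i + 1)) /\
  default_group (i + 1) = (default_group i * psi (default_letter i))%g >].
Proof.
apply/asboolP => -[n|[|n]].
- by rewrite -PoszD addn1; split => //; exact: next_letterP.
- by split; [exact: prev_letterP|rewrite /= mul1g mulVg].
- have -> : Negz n.+1 + 1 = Negz n by rewrite !NegzE -[n.+2]addn1 PoszD opprD addrNK.
  by split; [exact: prev_letterP|rewrite [in RHS]/= -mulgA mulVg mulg1].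
Qed.

HB.instance Definition _ := isPointed.Build Y
  (exist _ (fun i => (default_letter i, default_group i)) default_coordsP).

HB.instance Definition _ := Topological.copy Y
  (initial_topology
     (@coords W M G psi : Y -> {ptws int -> discrete_topology (W * G)%type})).

HB.instance Definition _ := @isMeasurable.Build
  (sigma_display (@open Y)) Y <<s @open Y >>
  (@sigma_algebra0 _ setT _) (@sigma_algebraC _ _)
  (@sigma_algebra_bigcup _ setT _).

Fact natural_shift_subproof (y : Y) :
  `[< forall i : int, M (y (i + 1)).1 (y (i + 1 + 1)).1 /\
       (y (i + 1 + 1)).2 = ((y (i + 1)).2 * psi (y (i + 1)).1)%g >].
Proof. by apply/asboolP => i; exact: coordsP. Qed.

Definition natural_shift (y : Y) : Y :=
  exist _ (fun i => y (i + 1)) (natural_shift_subproof y).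

(* (w_0, g_0), ..., (w_n, g_n) with g_0 = g and g_(j+1) = g_j psi(w_j) *)
Fixpoint lift_word (g : G) (w : seq W) : seq (W * G) :=
  if w is v :: w' then (v, g) :: lift_word (g * psi v)%g w' else [::].

Definition natural_extension (m : set X -> \bar R)
    (mhat : {measure set Y -> \bar R}) :=
  (forall A : set Y, measurable A -> mhat (natural_shift @^-1` A) = mhat A) /\
  forall (k : int) (w : seq W) (g : G), admissible M w ->
    mhat [set y : Y | mkseq (fun j => y (k + j%:Z)) (size w) = lift_word g w]
      = m (ext_cylinder M w g).

(* the word w_(-n) ... w_(-1) *)
Definition past (y : Y) (n : nat) : seq W :=
  mkseq (fun j => (y (j%:Z - n%:Z)).1) n.

End NaturalExtension.

(* Main.v *)
Require Import Defs.
From mathcomp Require Import all_boot all_order all_algebra.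
From mathcomp Require Import all_classical all_reals all_analysis.
From mathcomp Require Import measurable_realfun.
From mathcomp Require Import ring lra zify.

(** The first limit compares the mass [H k] of the fiber over [k] with [rho ^ n]
    along the values [k] of random words of length [n].  Write [m w] for the
    measure of the cylinder of [w] and call [rho ^- size w * H (psi_word w)] the
    scaled value of the word [w].

    The Gibbs property of [mu] makes [m] multiplicative up to constants, and the
    transfer operator becomes a sum over words ending at a fixed point.  By the
    big images and preimages property and by transitivity, finitely many words
    with trivial group value suffice to connect any two words
    ([connecting_words]).  Inserting these between words, one compares the
    Poincare series of different fibers; in the limit, [H] becomes excessive
    ([fiber_mass_excessive]): for a suffix-free set of words, that is, at a
    stopping time of the past, the mean of the scaled values of the words, when
    translated by [k], is at most a constant times [H k].  Moreover, the measure
    of the cylinder over [w] starting at [g] is at most [m w * rho ^- size w]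
    times the mass of the fiber over [g * psi_word w], up to a constant
    ([ext_cylinder_mass]), so that the second limit follows from the first.

    The means of the scaled values are bounded, which leaves open whether these
    values tend to zero.  This is shown by insertion ([insertion_bound]).  A word
    [U] with trivial group value is inserted into words of length [n] with
    scaled value above [d].  This does not change the group value, but the length
    grows, and the scaled value exceeds [rho ^- size U * d]; by the Markov
    inequality, such words have total weight of order [rho ^ size U].  As there
    are [n + 1] places of insertion whereas [U] occurs about [n * m U] times in a
    typical word, which is compensated by the factor [m U] of the weight of the
    longer word, the original words weigh little as well, with constants
    independent of [U].  Since [rho < 1] and [U] may be arbitrarily long, the
    scaled values tend to zero in measure ([scaled_mass_small]).  Excessivity,
    used like the maximal inequality for supermartingales, turns this into a bound
    for first passages ([suffix_free_mass_small]) and hence into convergence along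
    almost every past ([past_scaled_cvg0]).

    For a symmetric extension, reversing words by the involution shows that
    [H k] and [H k^-1] are comparable and carries the paths of the shift to pasts,
    whence the second part ([path_scaled_cvg0]). *)

Set Implicit Arguments.
Unset Strict Implicit.
Unset Printing Implicit Defensive.

Import Order.TTheory GRing.Theory Num.Theory.
Import numFieldNormedType.Exports.

Local Open Scope classical_set_scope.
Local Open Scope ring_scope.

(** * Words and points of the shift *)

Section Shift.
Context (W : countType) (M : transition_matrix W).
Local Notation Sigma := (shift_space M).
Implicit Types (x y : Sigma) (u v w p q : seq W).

Lemma letters_inj x y : x =1 y -> x = y.
Proof. by move=> xy; apply: val_inj; apply/funext. Qed.

Lemma iter_thetaE n x k : iter n (@theta W M) x k = x (n + k)%N.
Proof.
by elim: n k => //= n IHn k; rewrite /theta /letters /= -/(letters _) IHn addnS.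
Qed.

(** The domain of the inverse branch [tau w], see [cylinder_imageP], in a
    decidable form which is compatible with concatenation. *)
Definition fits w x := sorted M (w ++ [:: x 0%N]).

Lemma sorted_mkseq x n : sorted M (mkseq x n).
Proof.
apply/(sortedP (x 0%N)) => i; rewrite size_mkseq => ltin.
by rewrite !nth_mkseq// ?lettersP// ltnW.
Qed.

Lemma cylinder_sorted w x : cylinder M w x -> sorted M w.
Proof. by move=> <-; exact: sorted_mkseq. Qed.

Lemma cylinder_cat u v x :
  cylinder M (u ++ v) x <->
  cylinder M u x /\ cylinder M v (iter (size u) (@theta W M) x).
Proof.
have E : mkseq x (size u + size v) =
    mkseq x (size u) ++ mkseq (iter (size u) (@theta W M) x) (size v).
  rewrite /mkseq iotaD map_cat add0n -[X in iota X (size v)]addn0.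
  rewrite iotaDl -map_comp; congr cat.
  by apply: eq_map => k /=; rewrite iter_thetaE.
rewrite /cylinder /= size_cat E; split=> [/eqP|[-> ->]//].
by rewrite eqseq_cat ?size_mkseq// => /andP[/eqP -> /eqP ->].
Qed.

Lemma cylinder1 a x : cylinder M [:: a] x <-> x 0%N = a.
Proof. by rewrite /cylinder /=; split=> [[]//|<-]. Qed.

Lemma fits_sorted w x : fits w x -> sorted M w.
Proof. by move=> /cat_sorted2[]. Qed.

Lemma fits_cat u v x : fits (u ++ v) x -> fits v x.
Proof. by rewrite /fits -catA => /cat_sorted2[]. Qed.

Lemma tauE w x k : fits w x ->
  tau w x k = if (k < size w)%N then nth (x 0%N) w k else x (k - size w)%N.
Proof.
move=> wx; rewrite /tau /letters val_insubd ifT//; apply/asboolP => i.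
have nthE j : (j <= size w)%N ->
    (if (j < size w)%N then nth (x 0%N) w j else x (j - size w)%N) =
    nth (x 0%N) (w ++ [:: x 0%N]) j.
  rewrite nth_cat leq_eqVlt => /orP[/eqP ->|->//].
  by rewrite ltnn subnn.
have [iw|iw] := ltnP i (size w).
  have /(sortedP (x 0%N))/(_ i) := wx.
  rewrite size_cat addn1 ltnS => /(_ iw).
  by rewrite -!nthE ?iw// ltnW.
by rewrite ltnNge (leqW iw)/= subSn//; exact: lettersP.
Qed.

Lemma tau_cylinder w x : fits w x -> cylinder M w (tau w x).
Proof.
move=> wx; apply: (@eq_from_nth _ (x 0%N)); rewrite size_mkseq// => k kw.
by rewrite nth_mkseq// tauE// kw.
Qed.

Lemma iter_theta_tau w x : fits w x -> iter (size w) (@theta W M) (tau w x) = x.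
Proof.
move=> wx; apply: letters_inj => k.
by rewrite iter_thetaE tauE// ltnNge leq_addr/= addKn.
Qed.

Lemma cylinder_fits w y : cylinder M w y -> fits w (iter (size w) (@theta W M) y).
Proof.
move=> wy; suff : cylinder M (w ++ [:: iter (size w) (@theta W M) y 0%N]) y.
  exact: cylinder_sorted.
by apply/cylinder_cat; split => //; exact/cylinder1.
Qed.

Lemma tau_iter_theta w y : cylinder M w y ->
  tau w (iter (size w) (@theta W M) y) = y.
Proof.
move=> wy; have wf := cylinder_fits wy.
apply: letters_inj => k; rewrite tauE//; case: ltnP => kw; last first.
  by rewrite iter_thetaE subnKC.
by rewrite -[in X in nth _ X _]wy nth_mkseq.
Qed.

Lemma cylinder_imageP w x : cylinder_image M w x <-> fits w x.
Proof.
split=> [[y wy <-]|wx]; first exact: cylinder_fits.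
by exists (tau w x); [exact: tau_cylinder|exact: iter_theta_tau].
Qed.

Lemma fits_cons (a : W) w x : fits w x -> fits (a :: w) x = M a (tau w x 0%N).
Proof.
case: w => [|b w] wx.
  by rewrite /fits/= andbT tauE.
by rewrite tauE//= /fits /=; move: wx; rewrite /fits /= => ->; rewrite andbT.
Qed.

Lemma fits_catE u v x : fits v x -> fits (u ++ v) x = fits u (tau v x).
Proof.
elim: u => [|a u IHu] vx //=; rewrite /fits//=.
case: u IHu => [|b u] IHu /=.
  by have := fits_cons a vx; rewrite /fits /= => ->; rewrite andbT.
by congr (_ && _); have := IHu vx; rewrite /fits.
Qed.

Lemma tau_cat u v x : fits (u ++ v) x -> tau u (tau v x) = tau (u ++ v) x.
Proof.
move=> uvx; have vx := fits_cat uvx.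
have := tau_cylinder uvx => /cylinder_cat[c1 c2].
have := iter_theta_tau uvx; rewrite size_cat addnC iterD => xE.
by rewrite -[in LHS]xE (tau_iter_theta c2) (tau_iter_theta c1).
Qed.

Lemma cylinder_neq0 w : sorted M w -> exists x, cylinder M w x.
Proof.
case: w => [|a w] ws; first by exists point.
have bP (b : W) : `[< forall k, M (iter k (next_letter M) b)
                                   (iter k.+1 (next_letter M) b) >].
  by apply/asboolP => k; exact: next_letterP.
pose x : Sigma := exist _ (fun k => iter k (next_letter M)
  (next_letter M (last a w))) (bP _).
have wx : fits (a :: w) x.
  rewrite /fits /= cat_path; apply/andP; split => //=; rewrite andbT.
  exact: next_letterP.
by exists (tau (a :: w) x); exact: tau_cylinder.
Qed.

Lemma birkhoff_prodD (R : realType) (phi : Sigma -> R) n m x :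
  birkhoff_prod phi (n + m) x =
  birkhoff_prod phi n x * birkhoff_prod phi m (iter n (@theta W M) x).
Proof.
rewrite /birkhoff_prod big_split_ord /=.
by congr GRing.mul; apply: eq_bigr => i _; rewrite addnC iterD.
Qed.

Lemma birkhoff_prod1 (R : realType) (phi : Sigma -> R) x :
  birkhoff_prod phi 1 x = phi x.
Proof. by rewrite /birkhoff_prod big_ord_recl big_ord0 mulr1. Qed.

Lemma birkhoff_prod_gt0 (R : realType) (phi : Sigma -> R) n x :
  (forall y, 0 < phi y) -> 0 < birkhoff_prod phi n x.
Proof. by move=> phi0; apply: prodr_gt0. Qed.

(** The sets whose topology and measurability matter below are all determined
    by finitely many letters. *)
Lemma open_letters (A : set Sigma) n :
  (forall x y, (forall k, (k < n)%N -> x k = y k) -> A x -> A y) -> open A.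
Proof.
have letter_open k (a : W) : open [set y : Sigma | y k = a].
  exists ((@^~ k : {ptws nat -> discrete_topology W} -> _) @^-1` [set a]) => //.
  apply: open_comp; last exact: discrete_open.
  move=> f _.
  exact: (@proj_continuous nat (fun=> discrete_topology W) k).
have word_open x : open [set y : Sigma | forall k, (k < n)%N -> x k = y k].
  elim: n {A} => [|n IHn].
    by rewrite (_ : mkset _ = setT) ?predeqE//; exact: openT.
  rewrite (_ : mkset _ = [set y : Sigma | forall k, (k < n)%N -> x k = y k] `&`
                         [set y : Sigma | y n = x n]); first exact: openI.
  rewrite predeqE => y; split=> [xy|[xy yn] k].
    by split=> [k kn|]; [apply: xy; exact: ltnW|exact/esym/xy].
  by rewrite ltnS leq_eqVlt => /orP[/eqP ->|/xy].
move=> An; rewrite openE => x Ax; rewrite /interior nbhsE.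
exists [set y : Sigma | forall k, (k < n)%N -> (x : Sigma) k = y k].
  by split; [exact: word_open|].
by move=> y xy; exact: An Ax.
Qed.

Lemma closed_letters (A : set Sigma) n :
  (forall x y, (forall k, (k < n)%N -> x k = y k) -> A x -> A y) -> closed A.
Proof.
move=> An; rewrite -[A]setCK closedC; apply: (@open_letters _ n) => x y xy nAx Ay.
by apply: nAx; apply: An Ay => k kn; rewrite xy.
Qed.

Lemma cylinder_letters w x y : (forall k, (k < size w)%N -> x k = y k) ->
  cylinder M w x -> cylinder M w y.
Proof.
move=> xy <-; rewrite /cylinder /= size_mkseq.
by apply/eq_in_map => k; rewrite mem_iota => /xy.
Qed.

Lemma cylinder_agree w x y k : cylinder M w x -> cylinder M w y ->
  (k < size w)%N -> x k = y k.
Proof.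
move=> wx wy kw.
by rewrite -(nth_mkseq (x 0%N) x kw) -(nth_mkseq (x 0%N) y kw) wx wy.
Qed.

Lemma measurable_letters (A : set Sigma) n :
  (forall x y, (forall k, (k < n)%N -> x k = y k) -> A x -> A y) ->
  measurable A.
Proof. by move=> /open_letters Ao; exact: sub_sigma_algebra. Qed.

Lemma measurable_cylinder w : measurable (cylinder M w).
Proof. exact: measurable_letters (@cylinder_letters w). Qed.

End Shift.

(** * Connecting words *)

Section Connectors.
Context (W : countType) (M : transition_matrix W) (G : groupType) (psi : W -> G).
Local Notation Sigma := (shift_space M).
Implicit Types (x y : Sigma) (u v w p q : seq W).

Lemma psi_word_cat u v :
  psi_word psi (u ++ v) = (psi_word psi u * psi_word psi v)%g.
Proof. by rewrite /psi_word big_cat. Qed.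

Lemma psi_word1 a : psi_word psi [:: a] = psi a.
Proof. by rewrite /psi_word big_seq1. Qed.

Lemma iter_ext_map n x (g : discrete_group G) :
  iter n (ext_map psi) (x, g) =
  (iter n (@theta W M) x, (g * psi_n psi n x)%g : discrete_group G).
Proof.
elim: n => [|n IHn]; first by rewrite /psi_n /psi_word /= big_nil mulg1.
rewrite /= IHn /ext_map /=; congr pair.
rewrite /psi_n -addn1 /mkseq iotaD map_cat psi_word_cat psi_word1 mulgA.
by rewrite iter_thetaE addn0.
Qed.

Lemma transitive_word (a b : W) (k : G) : ext_transitive M psi ->
  exists w, [/\ sorted M (a :: w), last a w = b & psi_word psi (a :: w) = k].
Proof.
move=> /(_ a b 1%g (k * (psi b)^-1)%g) [n [n0 [[y h]]]].
move=> [[[x g] [/= /cylinder1 xa ->]]].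
rewrite iter_ext_map => -[<- <-] [/= /cylinder1]; rewrite iter_thetaE addn0 => xb.
rewrite mul1g => xk.
have E : a :: mkseq (fun i => x i.+1) n = mkseq x n.+1.
  by rewrite /mkseq /= xa -[1%N]addn0 iotaDl -map_comp.
exists (mkseq (fun i => x i.+1) n); split; first by have := sorted_mkseq x n.+1; rewrite -E.
  by rewrite -(nth_last a) size_mkseq nth_mkseq ?prednK.
rewrite E -addn1 /mkseq iotaD map_cat psi_word_cat psi_word1 -/(mkseq x n).
by rewrite -/(psi_n psi n x) add0n xb xk mulgVK.
Qed.

(** Length is gained by appending loops at [b] with trivial group value. *)
Lemma long_transitive_word n (a b : W) (k : G) : ext_transitive M psi ->
  exists w, [/\ sorted M (a :: w), last a w = b,
    psi_word psi (a :: w) = k & (n <= size (a :: w))%N].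
Proof.
move=> tr; elim: n => [|n [w [ws wb wk wn]]].
  by have [w [ws wb wk]] := transitive_word a b k tr; exists w.
have [v [vs vb v1]] := transitive_word (next_letter M b) b 1%g tr.
exists (w ++ next_letter M b :: v); split.
- rewrite /= cat_path; apply/andP; split=> //=; rewrite wb; apply/andP.
  by split=> //; exact: next_letterP.
- by rewrite last_cat.
- by rewrite -cat_cons psi_word_cat wk v1 mulg1.
- by rewrite /= size_cat /= addnS ltnS; apply: leq_trans wn _; rewrite /= leq_addr.
Qed.

(** By the big images and preimages property, it suffices to start and to end
    in one of finitely many letters in order to connect all pairs of words;
    transitivity of the extension provides words between these letters which
    do not change the group coordinate. *)
Lemma connecting_words : bip M -> ext_transitive M psi ->
  exists D, forall n, exists UU : seq (seq W),
  [/\ (size UU <= D)%N,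
      forall U, U \in UU ->
        [/\ sorted M U, psi_word psi U = 1%g & (n <= size U)%N] &
      forall p q, sorted M p -> sorted M q ->
        exists2 U, U \in UU & sorted M (p ++ U ++ q)].
Proof.
move=> [_ [I [/finite_seqP [s ->] Ib]]] tr; exists (size s * size s)%N => n.
have /choice [f fP] : forall ab : W * W, exists w,
    [/\ sorted M (ab.1 :: w), last ab.1 w = ab.2,
    psi_word psi (ab.1 :: w) = 1%g & (n <= size (ab.1 :: w))%N].
  by move=> [a b]; exact: long_transitive_word.
pose fw a b := a :: f (a, b).
exists (allpairs fw s s); split; first by rewrite size_allpairs.
  move=> U /allpairsP [[a b] /= [_ _ ->]].
  by have [] := fP (a, b).
move=> p q ps qs.
have [a sa pa] : exists2 a, a \in s & sorted M (p ++ [:: a]).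
  have [c cp] : exists c, p = [::] \/ exists p', p = rcons p' c.
    by case/lastP: p {ps} => [|p c];
      [exists (some_letter M); left|exists c; right; exists p].
  have [a [_ [sa _ ca _]]] := Ib c; exists a => //.
  case: cp ps => [->//|[p' ->]].
  rewrite -cats1; case: p' => [|d p'] /=; first by rewrite ca.
  by rewrite !cat_path /= !last_cat /= ca !andbT.
have [b sb qb] : exists2 b, b \in s & sorted M (b :: q).
  case: q qs => [|c q] qs; first by have [b [_ [sb _ _ _]]] := Ib (some_letter M); exists b.
  by have [_ [b [_ sb _ bc]]] := Ib c; exists b => //=; rewrite bc.
exists (fw a b); first by apply/allpairsP; exists (a, b).
have [/= fs fb _ _] := fP (a, b).
have fq : path M a (f (a, b) ++ q) by rewrite cat_path fs fb.
case: p {ps} pa => [|c p] /=; first by move=> _; exact: fq.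
rewrite cat_path /= => /andP[cp /andP[pa _]].
by rewrite cat_path /= cp pa fq.
Qed.

End Connectors.

(** * Weights of words *)

Section SeqSums.
Context (R : realDomainType) (T S : eqType).
Implicit Types (s t : seq T).

Lemma sum_subset s t (F : T -> R) : uniq s -> uniq t -> {subset s <= t} ->
  (forall i, 0 <= F i) -> \sum_(i <- s) F i <= \sum_(i <- t) F i.
Proof.
move=> us ut st F0; rewrite [leRHS](bigID (fun i => i \in s)) /=.
rewrite -[X in _ <= X + _]big_filter.
have -> : \sum_(i <- s) F i = \sum_(i <- [seq x <- t | x \in s]) F i.
  apply/perm_big/uniq_perm; rewrite ?filter_uniq// => i.
  by rewrite mem_filter; case: (boolP (i \in s)) => // /st ->.
by rewrite lerDl sumr_ge0.
Qed.

Lemma sum_fibers (g : T -> S) s (F : T -> R) :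
  \sum_(i <- s) F i =
  \sum_(b <- undup (map g s)) \sum_(i <- s | g i == b) F i.
Proof.
under [RHS]eq_bigr do rewrite big_mkcond.
rewrite exchange_big /= big_seq [RHS]big_seq; apply: eq_bigr => i si.
rewrite -big_mkcond /= -big_filter.
suff -> : [seq b <- undup (map g s) | g i == b] = [:: g i] by rewrite big_seq1.
have gi : g i \in undup (map g s) by rewrite mem_undup map_f.
rewrite (eq_filter (a2 := pred1 (g i))); last by move=> b; rewrite /= eq_sym.
by rewrite filter_pred1_uniq// undup_uniq.
Qed.

End SeqSums.

(** Words are read as pasts which grow to the left: the pasts described by the
    words of a suffix-free set exclude each other, as those at a stopping time
    do. *)
Definition suffix_free (W : eqType) (E : seq (seq W)) :=
  forall u v, u \in E -> v \in E -> suffix u v -> u = v.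

Lemma same_size_suffix_free (W : eqType) n (E : seq (seq W)) :
  (forall w, w \in E -> size w = n) -> suffix_free E.
Proof.
move=> En u v uE vE /suffixP [p vE'].
have := congr1 size vE'; rewrite size_cat (En _ uE) (En _ vE) -[X in X = _]add0n.
by move=> /eqP; rewrite eqn_add2r eq_sym => /eqP /size0nil p0; rewrite vE' p0.
Qed.

Section Weights.
Context (R : realType) (W : countType) (adm : rel W).
Implicit Types (m : seq W -> R) (K : R) (u v w p q U : seq W).

(** Weights are multiplicative up to [K] on admissible words; the Gibbs property
    of the measure is used in this form. *)
Definition quasi_bernoulli m K := [/\ 1 <= K,
  forall w, 0 <= m w, forall w, sorted adm w -> 0 < m w,
  forall u v, m (u ++ v) <= K * (m u * m v) &
  forall u v, sorted adm (u ++ v) -> m u * m v <= K * m (u ++ v)].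

(** The inequality of Kraft for suffix codes. *)
Definition kraft m := forall E : seq (seq W), uniq E -> suffix_free E ->
  \sum_(w <- E) m w <= 1.

Context (m : seq W -> R) (K : R).
Context (mK : quasi_bernoulli m K) (mkraft : kraft m).

Let K1 : 1 <= K. Proof. by have [] := mK. Qed.
Let K0 : 0 <= K. Proof. exact: le_trans K1. Qed.
Let m0 w : 0 <= m w. Proof. by have [] := mK. Qed.

Lemma kraft_size n E : uniq E -> (forall w, w \in E -> size w = n) ->
  \sum_(w <- E) m w <= 1.
Proof.
by move=> uE En; apply: mkraft => //; exact: same_size_suffix_free En.
Qed.

Lemma kraft_image (T : eqType) (s : seq T) (f : T -> seq W) n : uniq s ->
  {in s &, injective f} -> (forall i, i \in s -> size (f i) = n) ->
  \sum_(i <- s) m (f i) <= 1.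
Proof.
move=> us fi fn; rewrite -(big_map f xpredT m); apply: (@kraft_size n).
  by rewrite map_inj_in_uniq.
by move=> w /mapP [i /fn + ->].
Qed.

Definition occurs U i w := take (size U) (drop i w) == U.

Lemma occursE U i w : occurs U i w ->
  w = take i w ++ U ++ drop (i + size U) w.
Proof.
by move=> /eqP {1}<-; rewrite addnC -drop_drop cat_take_drop cat_take_drop.
Qed.

(** Summing over the letters before the place [i] costs nothing by the inequality
    of Kraft, and the letters of [U] contribute the factor [m U]; what remains is
    the mass of the words which follow. *)
Lemma occurs_then U (t : pred (seq W)) i n A : uniq A ->
  (forall w, w \in A -> size w = n) -> (i + size U <= n)%N ->
  \sum_(w <- A | occurs U i w && t (drop (i + size U) w)) m w <=
  K ^+ 2 * m U * \sum_(q <- undup [seq drop (i + size U) w | w <- A] | t q) m q.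
Proof.
move=> uA An iUn; set j := (i + size U)%N.
rewrite -big_filter; set A' := [seq w <- A | _].
have A'A w : w \in A' -> [/\ w \in A, occurs U i w & t (drop j w)].
  by rewrite mem_filter => /andP[/andP[]].
have uA' : uniq A' by exact: filter_uniq.
clearbody A'.
have le1 w : w \in A' -> m w <= K ^+ 2 * m U * (m (take i w) * m (drop j w)).
  move=> /A'A[_ /occursE wE _]; rewrite {1}wE.
  have [_ _ _ catl _] := mK.
  apply: le_trans (catl _ _) _.
  rewrite [leRHS](_ : _ = K * (m (take i w) * (K * (m U * m (drop j w))))).
    by rewrite ler_wpM2l// ler_wpM2l.
  by rewrite expr2; ring.
rewrite big_seq; apply: le_trans (ler_sum _ le1) _; rewrite -big_seq.
rewrite -mulr_sumr ler_wpM2l ?mulr_ge0 ?exprn_ge0//.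
rewrite (sum_fibers (drop j)).
have -> : \sum_(q <- undup [seq drop j w | w <- A'])
     \sum_(w <- A' | drop j w == q) m (take i w) * m (drop j w) =
  \sum_(q <- undup [seq drop j w | w <- A'])
     m q * \sum_(w <- A' | drop j w == q) m (take i w).
  apply: eq_bigr => q _; rewrite mulr_sumr; apply: eq_bigr => w /eqP <-.
  by rewrite mulrC.
apply: (@le_trans _ _ (\sum_(q <- undup [seq drop j w | w <- A']) m q)).
  apply: ler_sum => q _; rewrite -[leRHS]mulr1 ler_wpM2l// -big_filter.
  apply: (@kraft_image _ _ _ i); first exact: filter_uniq.
    move=> w w' /=; rewrite !mem_filter => /andP[/eqP wq /A'A[_ /occursE wE _]].
    move=> /andP[/eqP wq' /A'A[_ /occursE wE' _]] ww'.
    by rewrite wE wE' ww' -/j wq wq'.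
  move=> w; rewrite mem_filter => /andP[_ /A'A[/An wn _ _]].
  by rewrite size_takel// wn (leq_trans _ iUn)// leq_addr.
rewrite -[leRHS]big_filter; apply: sum_subset => //.
- exact: undup_uniq.
- by rewrite filter_uniq// undup_uniq.
- move=> q; rewrite mem_filter !mem_undup => /mapP [w /A'A[wA _ tw] ->].
  by rewrite tw map_f.
Qed.

Lemma occurs_once U i n A : uniq A -> (forall w, w \in A -> size w = n) ->
  (i + size U <= n)%N -> \sum_(w <- A | occurs U i w) m w <= K ^+ 2 * m U.
Proof.
move=> uA An iUn.
have := occurs_then predT uA An iUn; under eq_bigl do rewrite andbT.
move=> /le_trans; apply; rewrite -[leRHS]mulr1 ler_wpM2l ?mulr_ge0 ?exprn_ge0//.
apply: (@kraft_size (n - (i + size U))); first exact: undup_uniq.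
by move=> w; rewrite mem_undup => /mapP [v /An vn ->]; rewrite size_drop vn.
Qed.

Lemma occurs_twice U i j n A : uniq A -> (forall w, w \in A -> size w = n) ->
  (i + size U <= j)%N -> (j + size U <= n)%N ->
  \sum_(w <- A | occurs U i w && occurs U j w) m w <= (K ^+ 2 * m U) ^+ 2.
Proof.
move=> uA An iUj jUn.
have iUn : (i + size U <= n)%N.
  by apply: leq_trans jUn; apply: leq_trans iUj _; rewrite leq_addr.
have := occurs_then (occurs U (j - (i + size U))) uA An iUn.
rewrite [X in X <= _ -> _](eq_bigl (fun w => occurs U i w && occurs U j w)).
  move=> /le_trans; apply; rewrite expr2 ler_wpM2l ?mulr_ge0 ?exprn_ge0//.
  apply: (@occurs_once _ _ (n - (i + size U))); first exact: undup_uniq.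
    by move=> w; rewrite mem_undup => /mapP [v /An vn ->]; rewrite size_drop vn.
  by lia.
by move=> w; rewrite /occurs drop_drop subnK.
Qed.

End Weights.

(** * Excessive functions and the insertion of words *)

Section Excessive.
Context (R : realType) (W : countType) (adm : rel W) (G : groupType).
Context (psi : W -> G) (m : seq W -> R) (K : R).
Context (mK : quasi_bernoulli adm m K) (mkraft : kraft m).
Context (rho C : R) (H : G -> R).
Implicit Types (u v w p q U : seq W) (A E : seq (seq W)).

(** For the words [w] of a given length this says that [k |-> H k] is
    superharmonic at level [rho], up to the constant [C], for the walk which
    multiplies from the left by the value of a random word.  Allowing suffix-free
    sets amounts to allowing stopping times. *)
Definition excessive := forall E k, uniq E -> suffix_free E ->
  (forall w, w \in E -> sorted adm w) ->
  \sum_(w <- E) m w * (rho ^- size w * H (psi_word psi w * k)%g) <= C * H k.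

(** Along a past, these values form a nonnegative process which behaves like a
    supermartingale. *)
Definition scaled w := rho ^- size w * H (psi_word psi w).

Context (rho01 : 0 < rho < 1) (Hexc : excessive).

Let rho0 : 0 < rho. Proof. by case/andP: rho01. Qed.
Let K1 : 1 <= K. Proof. by have [] := mK. Qed.
Let K0 : 0 <= K. Proof. exact: le_trans K1. Qed.
Let m0 w : 0 <= m w. Proof. by have [] := mK. Qed.

Lemma sum_scaled E : uniq E -> suffix_free E ->
  (forall w, w \in E -> sorted adm w) ->
  \sum_(w <- E) m w * scaled w <= C * H 1%g.
Proof.
move=> uE sE aE; have := Hexc 1%g uE sE aE.
by under eq_bigr do rewrite mulg1.
Qed.

Lemma C_H_ge0 k : 0 <= C * H k.
Proof.
by have := @Hexc [::] k isT; rewrite big_nil; apply.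
Qed.

Lemma markov_scaled d E : 0 < d -> uniq E -> suffix_free E ->
  (forall w, w \in E -> sorted adm w) ->
  (forall w, w \in E -> d < scaled w) -> \sum_(w <- E) m w <= C * H 1%g / d.
Proof.
move=> d0 uE sE aE dE; rewrite ler_pdivlMr// mulr_suml.
apply: le_trans (sum_scaled uE sE aE).
by rewrite big_seq [leRHS]big_seq; apply: ler_sum => w wE; rewrite ler_wpM2l// ltW// dE.
Qed.

Definition insert U i w := take i w ++ U ++ drop i w.

Lemma insert_inj U i n : {in [pred w | size w == n] &, injective (insert U i)}.
Proof.
move=> w w' /eqP wn /eqP w'n; rewrite /insert => /eqP.
rewrite eqseq_cat ?size_take ?wn ?w'n// eqseq_cat// => /and3P[/eqP t _ /eqP d].
by rewrite -(cat_take_drop i w) t d cat_take_drop.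
Qed.

Lemma occurs_insert U i w : (i <= size w)%N -> occurs U i (insert U i w).
Proof.
move=> iw; rewrite /occurs /insert drop_size_cat ?size_takel//.
by rewrite take_size_cat.
Qed.

Definition occurrences n U w : R := \sum_(i < n) (occurs U i w)%:R.

Lemma count_close l n (i : nat) :
  \sum_(j < n) ((j < i + l) && (i < j + l))%N%:R <= (2 * l)%:R :> R.
Proof.
rewrite -natr_sum ler_nat -(big_mkord xpredT
  (fun j => nat_of_bool ((j < i + l) && (i < j + l))%N)).
rewrite -big_mkcond sum1_count -size_filter.
rewrite -[X in (_ <= X)%N](size_iota (i.+1 - l)); apply: uniq_leq_size.
  by rewrite filter_uniq// /index_iota iota_uniq.
move=> j; rewrite mem_filter mem_iota => /andP[/andP[ji ij] _].
by apply/andP; split; lia.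
Qed.

(** The second moment of the number of occurrences is, up to terms of lower
    order, at most a constant times the square of the first one. *)
Lemma occurrences_moment2 n U A : uniq A ->
  (forall w, w \in A -> size w = n + size U)%N ->
  \sum_(w <- A) m w * occurrences n.+1 U w ^+ 2 <=
  n.+1%:R ^+ 2 * (K ^+ 2 * m U) ^+ 2 +
  n.+1%:R * (2 * size U)%:R * (K ^+ 2 * m U).
Proof.
move=> uA An.
pose close (i j : nat) := ((j < i + size U) && (i < j + size U))%N.
have mU0 : 0 <= K ^+ 2 * m U by rewrite mulr_ge0// exprn_ge0.
have pair (i j : 'I_n.+1) :
    \sum_(w <- A | occurs U i w && occurs U j w) m w <=
    (K ^+ 2 * m U) ^+ 2 + (close i j)%:R * (K ^+ 2 * m U).
  have iU (k : 'I_n.+1) : (k + size U <= n + size U)%N.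
    by rewrite leq_add2r -ltnS.
  have [ij|ij] := leqP (i + size U) j.
    apply: le_trans (occurs_twice mK mkraft uA An ij (iU j)) _.
    by rewrite lerDl mulr_ge0.
  have [ji|ji] := leqP (j + size U) i.
    under eq_bigl do rewrite andbC.
    apply: le_trans (occurs_twice mK mkraft uA An ji (iU i)) _.
    by rewrite lerDl mulr_ge0.
  rewrite /close ij ji mul1r -[leLHS]add0r lerD ?sqr_ge0//.
  apply: le_trans (occurs_once mK mkraft uA An (iU i)).
  rewrite [leRHS](bigID (occurs U j)) /= lerDl.
  by rewrite sumr_ge0.
have -> : \sum_(w <- A) m w * occurrences n.+1 U w ^+ 2 =
    \sum_(i < n.+1) \sum_(j < n.+1)
      \sum_(w <- A | occurs U i w && occurs U j w) m w.
  under [RHS]eq_bigr => i _.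
    under eq_bigr do rewrite big_mkcond.
    rewrite exchange_big /=; over.
  rewrite exchange_big /=; apply: eq_bigr => w _.
  rewrite expr2 /occurrences mulr_suml mulr_sumr; apply: eq_bigr => i _.
  rewrite mulr_sumr mulr_sumr; apply: eq_bigr => j _.
  by case: (occurs U i w); case: (occurs U j w);
    rewrite ?(mul0r, mulr0, mul1r, mulr1).
apply: (@le_trans _ _ (\sum_(i < n.+1) (n.+1%:R * (K ^+ 2 * m U) ^+ 2 +
    (2 * size U)%:R * (K ^+ 2 * m U)))).
  apply: ler_sum => i _.
  apply: le_trans (ler_sum _ (fun j _ => pair i j)) _.
  rewrite big_split /= sumr_const card_ord -[X in X + _]mulr_natl lerD2l.
  by rewrite -mulr_suml ler_wpM2r// count_close.
rewrite sumr_const card_ord -[leLHS]mulr_natl; lra.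
Qed.

(** Inserting a word [U] with trivial group value raises [scaled] by the factor
    [rho ^- size U] for the [n + 1] possible places of insertion.  As the places
    where [U] occurs in a word are about [n * m U] many in square mean, the
    words with [scaled] above [d] weigh little. *)
Lemma insertion_bound U n A d t : 0 < d -> 0 < t ->
  sorted adm U -> psi_word psi U = 1%g ->
  uniq A -> (forall w, w \in A -> size w = n) ->
  (forall w, w \in A -> d < scaled w) ->
  \sum_(i < n.+1) \sum_(w <- A | sorted adm (insert U i w)) m w <=
  n.+1%:R * (K ^+ 3 * (t * (C * H 1%g / d * rho ^+ size U) + K ^+ 4 / t)) +
  2 * K ^+ 5 * (size U)%:R / (t * m U).
Proof.
move=> d0 t0 aU U1 uA An dA.
have [_ _ mgt0 catl catr] := mK.
have mU0 : 0 < m U by exact: mgt0.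
(* Cutting w at i and gluing U in between costs one factor K each time. *)
have ins_m i w : sorted adm (insert U i w) -> m w <= K ^+ 3 / m U * m (insert U i w).
  move=> wU; rewrite mulrAC ler_pdivlMr//.
  have /(_ (take i w) (drop i w)) := catl; rewrite cat_take_drop => h1.
  have h3 := catr _ _ wU.
  have h2 : m U * m (drop i w) <= K * m (U ++ drop i w).
    by apply: catr; move: wU; rewrite /insert => /cat_sorted2[].
  apply: (@le_trans _ _ (K * (m (take i w) * m (drop i w)) * m U)).
    by rewrite ler_wpM2r// ltW.
  apply: (@le_trans _ _ (K * (m (take i w) * (K * m (U ++ drop i w))))).
    rewrite -!mulrA; apply: ler_wpM2l => //; apply: ler_wpM2l => //.
    by rewrite mulrC.
  apply: (@le_trans _ _ (K * K * (m (take i w) * m (U ++ drop i w)))).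
    by rewrite le_eqVlt; apply/orP; left; apply/eqP; ring.
  rewrite (_ : K ^+ 3 * m _ = K * K * (K * m (insert U i w))); last by ring.
  by apply: ler_wpM2l => //; rewrite mulr_ge0.
pose A' := undup (flatten [seq [seq insert U i w | w <- A & sorted adm (insert U i w)]
  | i <- iota 0 n.+1]).
have A'P w : w \in A' -> [/\ sorted adm w, size w = (n + size U)%N &
    rho ^- size U * d < scaled w].
  rewrite mem_undup => /flattenP [s /mapP [i _ ->]] /mapP [v].
  rewrite mem_filter => /andP[vs vA ->]; split=> //.
    by rewrite /insert !size_cat addnCA -size_cat cat_take_drop (An _ vA) addnC.
  rewrite /scaled /insert !psi_word_cat U1 mul1g -psi_word_cat cat_take_drop.
  rewrite !size_cat addnCA -size_cat cat_take_drop exprD invfM -mulrA.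
  by rewrite ltr_pM2l ?invr_gt0 ?exprn_gt0//; exact: dA.
have uA' : uniq A' by exact: undup_uniq.
have ins_occ (i : 'I_n.+1) : \sum_(w <- A | sorted adm (insert U i w)) m w <=
    K ^+ 3 / m U * \sum_(w <- A' | occurs U i w) m w.
  apply: le_trans (ler_sum _ (fun w => @ins_m i w)) _.
  rewrite -mulr_sumr ler_wpM2l ?divr_ge0 ?exprn_ge0//.
  rewrite -big_filter -(big_map (insert U i) xpredT m) -[leRHS]big_filter.
  apply: sum_subset; rewrite ?filter_uniq//.
    rewrite map_inj_in_uniq ?filter_uniq// => v w.
    rewrite !mem_filter => /andP[_ /An vn] /andP[_ /An wn].
    by apply: (@insert_inj U i n); rewrite inE ?vn ?wn.
  move=> w /mapP [v vA ->]; rewrite mem_filter occurs_insert; last first.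
    by move: vA; rewrite mem_filter => /andP[_ /An ->]; rewrite -ltnS.
  rewrite mem_undup; apply/flattenP; eexists; last exact: (map_f _ vA).
  by apply/mapP; exists (val i) => //; rewrite mem_iota ltn_ord.
apply: le_trans (ler_sum _ (fun i _ => ins_occ i)) _; rewrite -mulr_sumr.
have -> : \sum_(i < n.+1) \sum_(w <- A' | occurs U i w) m w =
    \sum_(w <- A') m w * occurrences n.+1 U w.
  under eq_bigr do rewrite big_mkcond.
  rewrite exchange_big /=; apply: eq_bigr => w _; rewrite mulr_sumr.
  by apply: eq_bigr => i _; case: occurs; rewrite ?(mulr1, mulr0).
have [T TE] : exists T, T = t * (n.+1%:R * m U) by eexists.
have T0 : 0 < T by rewrite TE !mulr_gt0.
(* Mean counts are bounded through second moments; T is a multiple of the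
   expected number of occurrences. *)
have occT w : occurrences n.+1 U w <= T + occurrences n.+1 U w ^+ 2 / T.
  set x := occurrences _ _ _.
  rewrite -(ler_pM2r T0) mulrDl divfK ?gt_eqF//.
  have : 0 <= (T - x) ^+ 2 by exact: sqr_ge0.
  have := T0; nra.
have sumA' : \sum_(w <- A') m w <= C * H 1%g / d * rho ^+ size U.
  have -> : C * H 1%g / d * rho ^+ size U = C * H 1%g / (rho ^- size U * d).
    by rewrite invfM invrK; ring.
  apply: markov_scaled => //.
  - by rewrite mulr_gt0// invr_gt0 exprn_gt0.
  - by apply: (@same_size_suffix_free _ (n + size U)) => w /A'P[].
  - by move=> w /A'P[].
  - by move=> w /A'P[].
have momA' := @occurrences_moment2 n U A' uA'
  (fun w wA => let: And3 _ b _ := A'P w wA in b).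
have sumocc : \sum_(w <- A') m w * occurrences n.+1 U w <=
    T * (C * H 1%g / d * rho ^+ size U) +
    (n.+1%:R ^+ 2 * (K ^+ 2 * m U) ^+ 2 +
     n.+1%:R * (2 * size U)%:R * (K ^+ 2 * m U)) / T.
  apply: (@le_trans _ _ (\sum_(w <- A')
      (T * m w + (m w * occurrences n.+1 U w ^+ 2) / T))).
    apply: ler_sum => w _; apply: le_trans (ler_wpM2l (m0 w) (occT w)) _.
    by rewrite mulrDr mulrA [X in X + _]mulrC.
  rewrite big_split /= -mulr_sumr -mulr_suml lerD//.
    by rewrite ler_wpM2l// ltW.
  by rewrite ler_wpM2r// invr_ge0 ltW.
apply: le_trans (ler_wpM2l _ sumocc) _.
  by rewrite divr_ge0// ?exprn_ge0.
rewrite le_eqVlt; apply/orP; left; apply/eqP; rewrite TE.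
have n0 : n.+1%:R != 0 :> R by rewrite pnatr_eq0.
rewrite natrM; move: n0; generalize (n.+1%:R : R) => N n0; field.
by rewrite n0 !gt_eqF.
Qed.

End Excessive.

(** * Large values of an excessive function are rare *)

Section Smallness.
Context (R : realType) (W : countType) (adm : rel W) (G : groupType).
Context (psi : W -> G) (m : seq W -> R) (K : R).
Context (mK : quasi_bernoulli adm m K) (mkraft : kraft m).
Context (rho C : R) (H : G -> R).
Context (rho01 : 0 < rho < 1) (H0 : forall k, 0 <= H k).
Context (Hexc : excessive adm psi m rho C H).
Context (connect : exists D, forall n, exists UU : seq (seq W),
  [/\ (size UU <= D)%N,
      forall U, U \in UU ->
        [/\ sorted adm U, psi_word psi U = 1%g & (n <= size U)%N] &
      forall p q, sorted adm p -> sorted adm q ->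
        exists2 U, U \in UU & sorted adm (p ++ U ++ q)]).
Implicit Types (u v w p q U : seq W) (A E : seq (seq W)).
Local Notation sc := (scaled psi rho H).

Let rho0 : 0 < rho. Proof. by case/andP: rho01. Qed.
Let K1 : 1 <= K. Proof. by have [] := mK. Qed.
Let K0 : 0 <= K. Proof. exact: le_trans K1. Qed.
Let m0 w : 0 <= m w. Proof. by have [] := mK. Qed.

Lemma exists_expr_lt (a e : R) : 0 < e -> exists n, a * rho ^+ n < e.
Proof.
move=> e0; have : (fun n => a * rho ^+ n) @ \oo --> (0 : R).
  rewrite -(mulr0 a); apply: cvgM; first exact: cvg_cst.
  by apply: cvg_expr; case/andP: rho01 => r0 r1; rewrite gtr0_norm.
move=> /cvgr_lt/(_ e e0) [n _ nP]; exists n; exact: (nP n (leqnn n)).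
Qed.

(** The constants in [insertion_bound] do not depend on the inserted words: the
    parameter [t] makes the contribution of the second moments small, inserting
    words of length at least [k] makes that of [rho ^+ k] small since [rho < 1],
    and the remaining term vanishes as [n] grows. *)
Lemma scaled_mass_small d e : 0 < d -> 0 < e -> exists n, forall A, uniq A ->
  (forall w, w \in A -> [/\ sorted adm w, size w = n & d < sc w]) ->
  \sum_(w <- A) m w <= e.
Proof.
move=> d0 e0; have [D DP] := connect.
have [t [t0 tE]] : exists t, 0 < t /\ D%:R * (K ^+ 3 * (K ^+ 4 / t)) <= e / 3.
  have [D' D'E] : exists D' : R, D' = D.+1%:R by eexists.
  have D0 : 0 < D' by rewrite D'E ltr0n.
  have K00 : 0 < K by exact: lt_le_trans K1.
  exists (3 * D' * K ^+ 7 / e); split.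
    by rewrite divr_gt0// mulr_gt0 ?exprn_gt0// mulr_gt0.
  have -> : D%:R * (K ^+ 3 * (K ^+ 4 / (3 * D' * K ^+ 7 / e))) =
      e / 3 * (D%:R / D').
    by field; rewrite !gt_eqF.
  rewrite -[leRHS]mulr1 ler_wpM2l ?divr_ge0 ?(ltW e0)//.
  by rewrite ler_pdivrMr// mul1r D'E ler_nat.
have [k kE] := exists_expr_lt (D%:R * (K ^+ 3 * (t * (C * H 1%g / d))))
  (divr_gt0 e0 (ltr0n _ 3)).
have [UU [UUD UUP UUc]] := DP k.
pose S : R := \sum_(U <- UU) 2 * K ^+ 5 * (size U)%:R / (t * m U).
have S0 : 0 <= S.
  apply: sumr_ge0 => U _; rewrite divr_ge0// ?mulr_ge0 ?exprn_ge0// ltW//.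
have [n nS] : exists n, S <= n.+1%:R * (e / 3).
  exists (Num.bound (S / (e / 3))).
  rewrite -ler_pdivrMr ?divr_gt0//; apply: ltW.
  apply: lt_trans (archi_boundP _) _; first by rewrite divr_ge0// divr_ge0// ltW.
  by rewrite ltr_nat.
exists n => A uA AP.
have n0 : 0 < n.+1%:R :> R by rewrite ltr0n.
rewrite -(ler_pM2l n0).
apply: (@le_trans _ _ (\sum_(U <- UU) \sum_(i < n.+1)
    \sum_(w <- A | sorted adm (insert U i w)) m w)).
  rewrite exchange_big /= mulr_natl -[X in _ *+ X](card_ord n.+1) -sumr_const.
  apply: ler_sum => i _.
  under [leRHS]eq_bigr do rewrite big_mkcond.
  rewrite exchange_big /= big_seq [leRHS]big_seq; apply: ler_sum => w wA.
  have [ws wn _] := AP _ wA.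
  have [/(_ w) tw dw] : (forall w, sorted adm w -> sorted adm (take i w)) /\
     sorted adm (drop i w).
    by split=> [v|]; [exact: take_sorted|exact: drop_sorted].
  have [U UUU wU] := UUc _ _ (tw ws) dw.
  rewrite (big_rem U UUU) /= [X in if X then _ else _]wU lerDl sumr_ge0// => V _.
  by case: ifP.
apply: (@le_trans _ _ (\sum_(U <- UU) (n.+1%:R *
    (K ^+ 3 * (t * (C * H 1%g / d * rho ^+ k) + K ^+ 4 / t)) +
    2 * K ^+ 5 * (size U)%:R / (t * m U)))).
  rewrite big_seq [leRHS]big_seq; apply: ler_sum => U /UUP [aU U1 kU].
  have := insertion_bound mK mkraft rho01 Hexc d0 t0 aU U1 uA
    (fun w wA => let: And3 _ b _ := AP w wA in b)
    (fun w wA => let: And3 _ _ b := AP w wA in b).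
  move=> /le_trans; apply; rewrite lerD2r ler_wpM2l ?(ltW n0)// ler_wpM2l ?exprn_ge0//.
  rewrite lerD2r ler_wpM2l ?(ltW t0)//; apply: ler_wpM2l.
    by apply: divr_ge0; [exact: C_H_ge0 Hexc 1%g|exact: ltW].
  by case/andP: rho01 => _ /ltW r1; apply: ler_wiXn2l => //; exact: ltW.
rewrite big_split /= -/S big_const_seq count_predT iter_addr addr0.
rewrite -[X in X + _]mulr_natl.
set B := K ^+ 3 * _.
have B0 : 0 <= B.
  rewrite mulr_ge0 ?exprn_ge0// addr_ge0// ?divr_ge0 ?exprn_ge0 ?(ltW t0)//.
  apply: mulr_ge0; first exact: ltW.
  apply: mulr_ge0; last by rewrite exprn_ge0// ltW.
  by apply: divr_ge0; [exact: C_H_ge0 Hexc 1%g|exact: ltW].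
have BD : D%:R * B <= e / 3 + e / 3.
  rewrite /B 2!mulrDr lerD//.
  by apply: le_trans (ltW kE); rewrite le_eqVlt; apply/orP; left; apply/eqP; ring.
apply: (@le_trans _ _ (n.+1%:R * (D%:R * B) + n.+1%:R * (e / 3))).
  rewrite lerD// mulrCA ler_wpM2l ?(ltW n0)// ler_wpM2r// ler_nat//.
by rewrite -mulrDr ler_wpM2l ?(ltW n0)//; apply: le_trans (lerD BD (lexx _)) _; lra.
Qed.

(** Only the words of a fixed length [n] need to be controlled: whatever the
    lengths of its extensions to the left, an excessive function rarely becomes
    large when it is small at time [n]. *)
Lemma suffix_free_mass_small d e : 0 < d -> 0 < e -> exists n, forall E, uniq E ->
  suffix_free E ->
  (forall w, w \in E -> [/\ sorted adm w, (n <= size w)%N & d < sc w]) ->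
  \sum_(w <- E) m w <= e.
Proof.
move=> d0 e0.
have K00 : 0 < K by exact: lt_le_trans K1.
have C0 : 0 < `|C| + 1 by rewrite ltr_wpDl.
pose d' := d * e / (2 * K * (`|C| + 1)).
have d'0 : 0 < d' by rewrite divr_gt0 ?mulr_gt0.
have e'0 : 0 < e / (2 * K) by rewrite divr_gt0 ?mulr_gt0.
have [n nP] := scaled_mass_small d'0 e'0.
exists n => E uE sE EP.
pose u w := drop (size w - n) w.
pose p w := take (size w - n) w.
have wE w : w = p w ++ u w by rewrite cat_take_drop.
have un w : w \in E -> size (u w) = n.
  by move=> /EP[_ nw _]; rewrite size_drop subKn.
have us w : w \in E -> sorted adm (u w).
  by move=> /EP[ws _ _]; exact: drop_sorted.
have fib_inj a : {in [seq w <- E | u w == a] &, injective p}.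
  move=> v w; rewrite !mem_filter => /andP[/eqP va _] /andP[/eqP wa _] pvw.
  by rewrite (wE v) (wE w) pvw va wa.
have fib_free a : suffix_free [seq p w | w <- E & u w == a].
  move=> q r /mapP [v + ->] /mapP [w + ->].
  rewrite !mem_filter => /andP[/eqP va vE] /andP[/eqP wa wE'] /suffixP [t tE].
  suff -> : v = w by [].
  apply: sE => //; apply/suffixP; exists t.
  by rewrite [LHS]wE tE -catA wa -va -wE.
have fib_uniq a : uniq [seq p w | w <- E & u w == a].
  by rewrite map_inj_in_uniq ?filter_uniq//; exact: fib_inj.
have [_ _ _ catl _] := mK.
have fib_le a : \sum_(w <- E | u w == a) m w <= K * m a.
  apply: (@le_trans _ _ (\sum_(w <- E | u w == a) K * m a * m (p w))).
    apply: ler_sum => w /eqP <-; rewrite {1}(wE w); apply: le_trans (catl _ _) _.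
    by rewrite -mulrA [m (p w) * _]mulrC.
  rewrite -mulr_sumr -[leRHS]mulr1 ler_wpM2l ?mulr_ge0//.
  by rewrite -big_filter -(big_map p xpredT m); exact: mkraft.
have fib_le2 a : size a = n -> \sum_(w <- E | u w == a) m w <= K / d * (`|C| + 1) * (m a * sc a).
  move=> an; apply: (@le_trans _ _ (\sum_(w <- E | u w == a) K / d * (m a * rho ^- n *
    (m (p w) * (rho ^- size (p w) * H (psi_word psi (p w) * psi_word psi a)%g))))).
    rewrite -[leLHS]big_filter -[leRHS]big_filter big_seq [leRHS]big_seq.
    apply: ler_sum => w; rewrite mem_filter => /andP[/eqP ua wE'].
    have [_ _ dw] := EP _ wE'.
    have -> : K / d * (m a * rho ^- n * (m (p w) * (rho ^- size (p w) *
       H (psi_word psi (p w) * psi_word psi a)%g))) =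
       K * (m (p w) * m a) * (sc w / d).
      have -> : sc w = rho ^- n * (rho ^- size (p w) *
          H (psi_word psi (p w) * psi_word psi a)%g).
        rewrite /scaled {1 2}(wE w) psi_word_cat size_cat ua an exprD invfM.
        by ring.
      by ring.
    rewrite -[leLHS]mulr1; apply: ler_pM => //.
      by rewrite {1}(wE w) ua; exact: catl.
    by rewrite ler_pdivlMr// mul1r ltW.
  rewrite -!mulr_sumr -[leRHS]mulrA; apply: ler_wpM2l.
    by apply: divr_ge0 => //; exact: ltW.
  rewrite -big_filter -(big_map p xpredT (fun q => m q * (rho ^- size q *
    H (psi_word psi q * psi_word psi a)%g))).
  rewrite -mulrA [leRHS]mulrCA; apply: ler_wpM2l => //.
  have := Hexc (psi_word psi a) (fib_uniq a) (fib_free a).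
  have -> : (`|C| + 1) * sc a = rho ^- n * ((`|C| + 1) * H (psi_word psi a)).
    by rewrite /scaled an; ring.
  move=> h; apply: ler_wpM2l; first by rewrite invr_ge0 exprn_ge0// ltW.
  apply: le_trans (h _) _.
    move=> q /mapP [w]; rewrite mem_filter => /andP[_ /EP[ws _ _]] ->.
    exact: take_sorted.
  by rewrite ler_wpM2r//; apply: le_trans (ler_norm _) _; rewrite lerDl.
pose F := undup (map u E).
have uF : uniq F by exact: undup_uniq.
have FP a : a \in F -> sorted adm a /\ size a = n.
  by rewrite mem_undup => /mapP [w wE' ->]; split; [exact: us|exact: un].
rewrite (sum_fibers u) -/F (bigID (fun a => d' < sc a)) /=.
rewrite [e]splitr; apply: lerD.
  apply: (@le_trans _ _ (K * \sum_(a <- F | d' < sc a) m a)).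
    by rewrite mulr_sumr; apply: ler_sum => a _; exact: fib_le.
  have -> : e / 2 = K * (e / (2 * K)) by field; rewrite gt_eqF.
  rewrite ler_wpM2l// -big_filter; apply: nP; first exact: filter_uniq.
  by move=> a; rewrite mem_filter => /andP[da /FP[? ?]].
rewrite -big_filter big_seq.
apply: (@le_trans _ _ (\sum_(a <- [seq a <- F | ~~ (d' < sc a)]) e / 2 * m a)).
  rewrite [leRHS]big_seq; apply: ler_sum => a.
  rewrite mem_filter -leNgt => /andP[da /FP[_ an]].
  apply: le_trans (fib_le2 _ an) _.
  have -> : e / 2 * m a = K / d * (`|C| + 1) * (m a * d').
    by rewrite /d'; field; rewrite !gt_eqF.
  apply: ler_wpM2l; last exact: ler_wpM2l.
  by rewrite mulr_ge0 ?divr_ge0 ?(ltW d0) ?(ltW C0).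
rewrite -mulr_sumr -[leRHS]mulr1 ler_wpM2l ?divr_ge0 ?(ltW e0)//.
apply: (@kraft_size _ _ _ mkraft n); first exact: filter_uniq.
by move=> a; rewrite mem_filter => /andP[_ /FP[]].
Qed.

End Smallness.

(** * The Gibbs property *)

(** As a supremum over simple functions, the integral is monotone also on
    functions which are not known to be measurable, such as the image of an
    indicator function under [transfer]. *)
Lemma integral_monotone d (T : measurableType d) (R : realType)
    (mu : {measure set T -> \bar R}) (f g : T -> \bar R) :
  (forall x, 0 <= f x)%E -> (forall x, f x <= g x)%E ->
  (\int[mu]_x f x <= \int[mu]_x g x)%E.
Proof.
move=> f0 fg; rewrite !ge0_integralTE//; last first.
  by move=> x; exact: le_trans (fg x).
apply: ge_ereal_sup => _ [h hf <-]; apply: ereal_sup_ubound.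
by exists h => // x; exact: le_trans (hf x) (fg x).
Qed.

Section Gibbs.
Context (R : realType) (W : countType) (M : transition_matrix W).
Local Notation Sigma := (shift_space M).
Context (phi : Sigma -> R) (mu : probability Sigma R).
Implicit Types (x y : Sigma) (u v w : seq W) (a : W).

Definition weight_of w : R := fine (mu (cylinder M w)).

Lemma mu_cylinderE w : mu (cylinder M w) = (weight_of w)%:E.
Proof. by rewrite fineK// fin_num_measure//; exact: measurable_cylinder. Qed.

Lemma weight_of_ge0 w : 0 <= weight_of w.
Proof. by rewrite fine_ge0. Qed.

Lemma weight_of_nil : weight_of [::] = 1.
Proof.
rewrite /weight_of (_ : cylinder M [::] = setT) ?probability_setT//.
by rewrite predeqE.
Qed.

Context (phi_gt0 : forall x, 0 < phi x).
Context (phi_holder : locally_holder (fun x => ln (phi x))).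
Context (mu_conformal : conformal phi mu).

Lemma transfer_cylinder a w x :
  transfer phi (fun y => (\1_(cylinder M (a :: w)) y)%:E) x =
  if `[< cylinder M w x /\ fits [:: a] x >] then (phi (tau [:: a] x))%:E else 0%E.
Proof.
rewrite /transfer (esumID [set a])/=; last first.
  by move=> b _; rewrite mule_ge0// lee_fin// ltW.
rewrite [X in (_ + X)%E]esum1 ?adde0; last first.
  move=> b [/cylinder_imageP bx /= ba]; rewrite indicE memNset ?mule0//.
  rewrite -[a :: w]cat1s => /cylinder_cat[/cylinder1 c1 _].
  by have /cylinder1 := tau_cylinder bx; rewrite c1 => /esym.
case: asboolP => [[wx ax]|nx].
  have cx : cylinder M (a :: w) (tau [:: a] x).
    rewrite -[a :: w]cat1s; apply/cylinder_cat; rewrite (iter_theta_tau ax).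
    by split=> //; exact: tau_cylinder.
  rewrite (_ : _ `&` _ = [set a]); last first.
    by rewrite predeqE => b; split=> [[]//|->]; split=> //; exact/cylinder_imageP.
  rewrite esum_set1 indicE mem_set// mule1// lee_fin ltW//.
apply: esum1 => b [/cylinder_imageP bx /= ba]; subst b.
rewrite indicE memNset ?mule0// -[a :: w]cat1s => /cylinder_cat[_].
by rewrite (iter_theta_tau bx) => wx; exact: nx.
Qed.

Lemma measurable_cylinder_image a : measurable (cylinder_image M [:: a]).
Proof.
apply: (@measurable_letters _ _ _ 1%N) => x y xy /cylinder_imageP ax.
by apply/cylinder_imageP; rewrite /fits -(xy 0%N).
Qed.

(** Conformality, applied to the indicator function of a cylinder, expresses its
    measure as an integral of the potential, which is constant there up to the
    factor [expR e]. *)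
Lemma conformal_step (e : R) a w y :
  (forall x z, cylinder M (a :: w) x -> cylinder M (a :: w) z ->
     ln (phi x) <= e + ln (phi z)) ->
  cylinder M (a :: w) y ->
  let B := cylinder M w `&` cylinder_image M [:: a] in
  weight_of (a :: w) <= expR e * phi y * fine (mu B) /\
  phi y * fine (mu B) <= expR e * weight_of (a :: w).
Proof.
move=> osc yaw B.
have mB : measurable B.
  by apply: measurableI; [exact: measurable_cylinder|exact: measurable_cylinder_image].
have phiosc x z : cylinder M (a :: w) x -> cylinder M (a :: w) z ->
    phi x <= expR e * phi z.
  move=> cx cz; rewrite -[phi x]lnK ?posrE// -[phi z in leRHS]lnK ?posrE//.
  by rewrite -expRD ler_expR; exact: osc.
have Bx x : B x -> cylinder M (a :: w) (tau [:: a] x).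
  move=> [wx /cylinder_imageP ax]; rewrite -cat1s; apply/cylinder_cat.
  by rewrite (iter_theta_tau ax); split=> //; exact: tau_cylinder.
have intE : (\int[mu]_x transfer phi (fun y => (\1_(cylinder M (a :: w)) y)%:E) x =
    (weight_of (a :: w))%:E)%E.
  have mc := measurable_cylinder (M := M) (a :: w).
  rewrite -mu_cylinderE mu_conformal.
  - by rewrite integral_indic// setIT.
  - by apply/measurable_EFinP; exact: measurable_indic.
  - by move=> x; rewrite lee_fin.
have intB (c : R) : 0 <= c -> (\int[mu]_x (c * \1_B x)%:E = (c * fine (mu B))%:E)%E.
  move=> c0; rewrite (integralZl_indic _ (fun=> B))//; last by rewrite ltNge c0.
  by rewrite integral_indic// setIT EFinM fineK// fin_num_measure.
have tr x : transfer phi (fun y => (\1_(cylinder M (a :: w)) y)%:E) x =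
    (phi (tau [:: a] x) * \1_B x)%:E.
  rewrite transfer_cylinder indicE; case: asboolP => [[wx ax]|nx].
    by rewrite mem_set ?mulr1//; split => //; exact/cylinder_imageP.
  by rewrite memNset ?mulr0// => -[wx /cylinder_imageP ax]; exact: nx.
have y0 : 0 <= phi y by exact: ltW.
split.
  rewrite -lee_fin -intE -intB ?mulr_ge0 ?expR_ge0//.
  apply: integral_monotone => x; rewrite tr lee_fin.
    by rewrite mulr_ge0// ltW.
  rewrite indicE; case: (boolP (x \in B)) => [|_]; rewrite ?mulr0// !mulr1.
  by rewrite inE => /Bx cx; exact: phiosc.
rewrite -[leLHS]mul1r -(expRxMexpNx_1 e) -mulrA ler_wpM2l ?expR_ge0//.
rewrite -lee_fin mulrA -intB ?mulr_ge0 ?expR_ge0// -intE.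
apply: integral_monotone => x; rewrite ?tr lee_fin.
  by rewrite !mulr_ge0// expR_ge0.
rewrite indicE; case: (boolP (x \in B)) => [|_]; rewrite ?mulr0// !mulr1.
rewrite inE => /Bx cx; rewrite expRN mulrC ler_pdivrMr ?expR_gt0// mulrC.
exact: phiosc.
Qed.

Context (mu_gibbs_markov : gibbs_markov mu).

(** Conformality is iterated along the letters of the word.  The oscillations add
    up to a bounded quantity by Hoelder continuity, and the last letter is taken
    care of by the lower bound for the images of cylinders. *)
Lemma gibbs_property : exists2 K : R, 1 <= K & forall w x, cylinder M w x ->
  birkhoff_prod phi (size w) x <= K * weight_of w /\
  weight_of w <= K * birkhoff_prod phi (size w) x.
Proof.
have [r [C [/andP[r0 r1] C0 hol]]] := phi_holder.
have osc n x y : (0 < n)%N -> (forall k, (k < n)%N -> x k = y k) ->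
    ln (phi x) <= C * r ^+ n + ln (phi y).
  move=> n0 xy; rewrite -lerBlDr; apply: le_trans (ler_norm _) _.
  rewrite -lee_fin; apply: le_trans (hol n n0); apply: ereal_sup_ubound.
  by exists x, y.
have [c [c0 c1 cP]] : exists c : R, [/\ 0 < c, c <= 1 &
    forall a, c <= fine (mu (cylinder_image M [:: a]))].
  have [_ inf0 _] := mu_gibbs_markov.
  have fin_im a : mu (cylinder_image M [:: a]) \is a fin_num.
    by rewrite fin_num_measure//; exact: measurable_cylinder_image.
  have le1 a : (fine (mu (cylinder_image M [:: a])) <= 1).
    rewrite -lee_fin fineK//; apply: probability_le1.
    exact: measurable_cylinder_image.
  set I := ereal_inf _ in inf0.
  have Ile a : (I <= mu (cylinder_image M [:: a]))%E.
    by apply: ereal_inf_lbound; exists a.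
  have Ifin : I \is a fin_num.
    rewrite fin_numElt (lt_trans _ inf0)//=; apply: le_lt_trans (Ile (some_letter M)) _.
    by rewrite ltey_eq fin_im.
  exists (fine I); split.
  - by rewrite fine_gt0// inf0/= ltey_eq Ifin.
  - apply: le_trans (le1 (some_letter M)).
    by apply: fine_le.
  - by move=> a; apply: fine_le.
pose sg n := \sum_(i < n) C * r ^+ i.+1.
have key w x : w != [::] -> cylinder M w x ->
    c * birkhoff_prod phi (size w) x <= expR (sg (size w)) * weight_of w /\
    weight_of w <= expR (sg (size w)) * birkhoff_prod phi (size w) x.
  elim: w x => // a w IHw x _ aw.
  have oscw y z : cylinder M (a :: w) y -> cylinder M (a :: w) z ->
      ln (phi y) <= C * r ^+ (size w).+1 + ln (phi z).
    move=> cy cz; apply: osc => // k kw.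
    exact: (cylinder_agree cy cz).
  have [up lo] := conformal_step oscw aw.
  have sgS : expR (sg (size w).+1) = expR (C * r ^+ (size w).+1) * expR (sg (size w)).
    by rewrite /sg big_ord_recr /= expRD mulrC.
  have pE : birkhoff_prod phi (size (a :: w)) x =
      phi x * birkhoff_prod phi (size w) (theta x).
    by rewrite /= -add1n birkhoff_prodD birkhoff_prod1.
  case: w IHw aw oscw up lo sgS pE => [|b w] IHw aw oscw up lo sgS pE.
    have BE : cylinder M [::] `&` cylinder_image M [:: a] = cylinder_image M [:: a].
      by rewrite predeqE => z; split=> [[]|].
    rewrite BE in up lo; rewrite pE sgS /sg big_ord0 expR0 mulr1.
    rewrite /birkhoff_prod big_ord0 mulr1; split.
      apply: le_trans lo; rewrite mulrC ler_wpM2l ?cP// ltW//.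
    apply: le_trans up _; rewrite -[leRHS]mulr1 ler_wpM2l//.
      by rewrite mulr_ge0 ?expR_ge0 ?ltW.
    rewrite -lee_fin fineK; last by rewrite fin_num_measure//; exact: measurable_cylinder_image.
    apply: probability_le1; exact: measurable_cylinder_image.
  have bw : cylinder M (b :: w) (theta x).
    by have /(cylinder_cat [:: a])[] := aw.
  have BE : cylinder M (b :: w) `&` cylinder_image M [:: a] = cylinder M (b :: w).
    rewrite predeqE => z; split=> [[]//|bz]; split=> //; apply/cylinder_imageP.
    have := cylinder_sorted aw; rewrite /fits /= => /andP[ab _].
    move: bz; rewrite -[b :: w]cat1s => /cylinder_cat[/cylinder1 -> _].
    by rewrite ab.
  rewrite BE -/(weight_of (b :: w)) in up lo.
  have [IH1 IH2] := IHw _ isT bw; rewrite sgS pE; split.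
    rewrite mulrCA; apply: (@le_trans _ _
      (phi x * (expR (sg (size (b :: w))) * weight_of (b :: w)))).
      by rewrite ler_wpM2l// ltW.
    by rewrite mulrCA [X in _ <= X * _]mulrC -mulrA ler_wpM2l ?expR_ge0.
  apply: le_trans up _.
  rewrite -!mulrA ler_wpM2l ?expR_ge0// mulrCA ler_wpM2l//.
  by rewrite ltW.
have sgle n : sg n <= C / (1 - r).
  rewrite /sg -mulr_sumr ler_wpM2l ?(ltW C0)// -[leRHS]mul1r ler_pdivlMr ?subr_gt0//.
  under eq_bigr do rewrite exprS.
  rewrite -mulr_sumr -mulrA [X in r * X]mulrC -opprB mulNr -subrX1 opprB.
  have rn0 : 0 <= r ^+ n by rewrite exprn_ge0// ltW.
  nra.
have [K KE] : exists K, K = expR (C / (1 - r)) / c by eexists.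
have e1 : 1 <= expR (C / (1 - r)).
  by rewrite -[leLHS]expR0 ler_expR divr_ge0 ?subr_ge0 ?ltW.
have eK : expR (C / (1 - r)) <= K.
  by rewrite KE -[leLHS]mulr1 ler_wpM2l ?expR_ge0// invf_ge1.
have K1 : 1 <= K by exact: le_trans eK.
exists K => // -[|a w] x wx.
  by rewrite weight_of_nil /birkhoff_prod big_ord0 mulr1.
have [h1 h2] := key (a :: w) x isT wx.
have phin0 : 0 <= birkhoff_prod phi (size (a :: w)) x.
  by apply: ltW; exact: birkhoff_prod_gt0.
have ele : expR (sg (size (a :: w))) <= expR (C / (1 - r)) by rewrite ler_expR.
split.
  rewrite KE mulrAC ler_pdivlMr// mulrC; apply: le_trans h1 _.
  by rewrite ler_wpM2r ?weight_of_ge0.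
apply: le_trans h2 _; rewrite ler_wpM2r//; exact: le_trans ele eK.
Qed.

Context (mu_invariant : forall (A : set Sigma) n,
  (forall x y, (forall k, (k < n)%N -> x k = y k) -> A x -> A y) ->
  mu (@theta W M @^-1` A) = mu A).

Lemma mu_iter_invariant n w : mu (iter n (@theta W M) @^-1` cylinder M w) =
  mu (cylinder M w).
Proof.
elim: n => // n <-; rewrite -[RHS](@mu_invariant _ (n + size w)%N); last first.
  move=> x y xy.
  apply: cylinder_letters => k kw; rewrite !iter_thetaE; apply: xy.
  by rewrite ltn_add2l.
congr (mu _); rewrite predeqE => x /=.
by rewrite -iterS iterSr.
Qed.

(** Placing all words so that they end at the same time, the cylinders of a
    suffix-free set of words become disjoint. *)
Lemma weight_of_kraft : kraft weight_of.
Proof.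
move=> E uE sE.
pose L := \max_(w <- E) size w.
have EL w : w \in E -> (size w <= L)%N by move=> wE; exact: leq_bigmax_seq.
pose A w := iter (L - size w) (@theta W M) @^-1` cylinder M w.
have mA w : measurable (A w).
  apply: (@measurable_letters _ _ _ (L - size w + size w)%N) => x y xy.
  apply: cylinder_letters => k kw; rewrite !iter_thetaE; apply: xy.
  by rewrite ltn_add2l.
have disj v w x : v \in E -> w \in E -> A v x -> A w x -> v = w.
  wlog vw : v w / (size v <= size w)%N.
    move=> H vE wE Av Aw; have [vw|/ltnW vw] := leqP (size v) (size w).
      exact: H.
    by apply/esym; exact: H.
  move=> vE wE Av Aw; apply: sE => //; apply/suffixP.
  exists (take (size w - size v) w).
  rewrite -[LHS](cat_take_drop (size w - size v)); congr cat.
  have := Aw; rewrite /A /=.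
  rewrite -{1}(cat_take_drop (size w - size v) w) => /cylinder_cat[_].
  rewrite size_takel ?leq_subr// -iterD addnC.
  have -> : (L - size w + (size w - size v) = L - size v)%N.
    by have := EL _ wE; lia.
  move: Av; rewrite /A /cylinder /= => vE' dE.
  by rewrite -dE size_drop subKn// vE'.
have := @probability_le1 _ _ _ mu (\bigcup_(w in [set` E]) A w).
rewrite measure_fin_bigcup; first last.
- by move=> w _; exact: mA.
- apply/trivIsetP => v w /= vE wE /eqP vw; rewrite -subset0 => x [Av Aw].
  by apply: vw; exact: disj Av Aw.
- exact: finite_seq.
rewrite -fsbig_seq//.
have -> : (\sum_(w <- E) mu (A w) = (\sum_(w <- E) weight_of w)%:E)%E.
  rewrite -sumEFin; apply: eq_bigr => w _.
  by rewrite mu_iter_invariant mu_cylinderE.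
rewrite lee_fin; apply; apply: fin_bigcup_measurable => [|w _]; last exact: mA.
exact: finite_seq.
Qed.

Lemma weight_of_quasi_bernoulli : exists K, quasi_bernoulli M weight_of K /\
  forall w x, cylinder M w x ->
  birkhoff_prod phi (size w) x <= K * weight_of w /\
  weight_of w <= K * birkhoff_prod phi (size w) x.
Proof.
have [K K1 KP] := gibbs_property.
have K0 : 0 <= K by exact: le_trans K1.
have m0 := weight_of_ge0.
have p0 n x : 0 <= birkhoff_prod phi n x by apply: ltW; exact: birkhoff_prod_gt0.
have KK : K <= K ^+ 3 by rewrite -[leLHS]expr1 ler_weXn2l.
exists (K ^+ 3); split; last first.
  move=> w x /KP[h1 h2]; split.
    by apply: le_trans h1 _; rewrite ler_wpM2r.
  by apply: le_trans h2 _; rewrite ler_wpM2r.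
split=> //; first exact: le_trans KK.
- move=> w /cylinder_neq0 [x /KP[h _]].
  have Kw : 0 < K * weight_of w by apply: lt_le_trans h; exact: birkhoff_prod_gt0.
  rewrite lt_neqAle m0 andbT; apply/negP => /eqP w0.
  by rewrite -w0 mulr0 ltxx in Kw.
- move=> u v; case: (boolP (sorted M (u ++ v))) => [/cylinder_neq0 [x uvx]|nuv].
    have /cylinder_cat[ux vx] := uvx.
    have [_ h] := KP _ _ uvx; have [h1 _] := KP _ _ ux; have [h2 _] := KP _ _ vx.
    apply: le_trans h _; rewrite size_cat birkhoff_prodD.
    rewrite (_ : K ^+ 3 * _ = K * (K * weight_of u * (K * weight_of v))); last by ring.
    by rewrite ler_wpM2l// ler_pM.
  rewrite {1}/weight_of (_ : cylinder M (u ++ v) = set0).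
    by rewrite measure0 !mulr_ge0 ?exprn_ge0.
  rewrite -subset0 => x /cylinder_sorted; exact/negP.
- move=> u v /cylinder_neq0 [x uvx].
  have /cylinder_cat[ux vx] := uvx.
  have [h _] := KP _ _ uvx; have [_ h1] := KP _ _ ux; have [_ h2] := KP _ _ vx.
  rewrite size_cat birkhoff_prodD in h.
  apply: le_trans (ler_pM (m0 _) (m0 _) h1 h2) _.
  rewrite (_ : K * _ * _ = K * K * (birkhoff_prod phi (size u) x *
    birkhoff_prod phi (size v) (iter (size u) (@theta W M) x))); last by ring.
  rewrite (_ : K ^+ 3 * _ = K * K * (K * weight_of (u ++ v))); last by ring.
  by rewrite ler_wpM2l// mulr_ge0.
Qed.

End Gibbs.

(** * The transfer operator as a sum over words *)

Section ESums.
Local Open Scope ereal_scope.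
Context (R : realType).

Lemma esum_ge_seq (T : choiceType) (P : set T) (a : T -> \bar R) (s : seq T) :
  uniq s -> (forall i, i \in s -> P i) -> \sum_(i <- s) a i <= \esum_(i in P) a i.
Proof.
move=> us sP; apply: ereal_sup_ubound; exists [set` s].
  by split; [exact: finite_seq|move=> i /= /sP].
by rewrite -fsbig_seq.
Qed.

Lemma esum_le_seq (T : choiceType) (P : set T) (a : T -> \bar R) (B : \bar R) :
  (forall s, uniq s -> (forall i, i \in s -> P i) -> \sum_(i <- s) a i <= B) ->
  \esum_(i in P) a i <= B.
Proof.
move=> sB; apply: ge_ereal_sup => _ [F [finF FP] <-].
rewrite fsbig_finite//=; apply: sB; first exact: finmap.fset_uniq.
by move=> i; rewrite in_fset_set// => /set_mem /FP.
Qed.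

Lemma esum_subset (T : choiceType) (P Q : set T) (a : T -> \bar R) :
  P `<=` Q -> \esum_(i in P) a i <= \esum_(i in Q) a i.
Proof.
by move=> PQ; apply: esum_le_seq => s us sP; apply: esum_ge_seq => // i /sP /PQ.
Qed.

Lemma esumZ (T : choiceType) (P : set T) (a : T -> \bar R) (c : R) :
  (0 <= c)%R -> (forall i, P i -> 0 <= a i) ->
  \esum_(i in P) c%:E * a i = c%:E * \esum_(i in P) a i.
Proof.
have le_esumZ (b : T -> \bar R) (r : R) : (0 <= r)%R -> (forall i, P i -> 0 <= b i) ->
    \esum_(i in P) r%:E * b i <= r%:E * \esum_(i in P) b i.
  move=> r0 b0; apply: esum_le_seq => s us sP.
  rewrite big_seq -ge0_sume_distrr -?big_seq; last by move=> i /sP /b0.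
  by rewrite lee_wpmul2l// ?lee_fin//; exact: esum_ge_seq.
rewrite le_eqVlt => /orP[/eqP <- _|c0 a0].
  by rewrite mul0e esum1// => i _; rewrite mul0e.
apply/eqP; rewrite eq_le le_esumZ ?(ltW c0)//=.
have : \esum_(i in P) c^-1%:E * (c%:E * a i) <= c^-1%:E * \esum_(i in P) c%:E * a i.
  apply: le_esumZ => [|i Pi]; first by rewrite invr_ge0 ltW.
  by rewrite mule_ge0 ?a0// lee_fin ltW.
have E i : P i -> c^-1%:E * (c%:E * a i) = a i.
  by move=> _; rewrite muleA -EFinM mulVf ?gt_eqF// mul1e.
rewrite (eq_esum E) => h; have := lee_wpmul2l (ltW c0 : 0 <= c%:E) h.
by rewrite muleA -EFinM divff ?gt_eqF// mul1e.
Qed.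

(** Each term on the left is dominated, up to a factor, by one on the right, to
    which it is sent by one of finitely many injections; a term on the right is
    hit at most once by each of them, so that the factors add up. *)
Lemma esum_le_injections (T T' : choiceType) (I : eqType) (J : seq I)
    (P : set T) (Q : set T') (a : T -> \bar R) (b : T' -> \bar R)
    (e : I -> T -> T') (c : I -> R) :
  (forall i, i \in J -> 0 <= c i)%R -> (forall y, 0 <= b y) ->
  (forall x, P x -> exists2 i, i \in J &
     Q (e i x) /\ a x <= (c i)%:E * b (e i x)) ->
  (forall i x y, P x -> P y -> e i x = e i y -> x = y) ->
  \esum_(x in P) a x <= (\sum_(i <- J) c i)%:E * \esum_(y in Q) b y.
Proof.
move=> c0 b0 aP inj; apply: esum_le_seq => s us sP.
pose F i x : \bar R := if `[< Q (e i x) >] then (c i)%:E * b (e i x) else 0.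
have F0 i x : i \in J -> 0 <= F i x.
  by move=> iJ; rewrite /F; case: ifP => // _; rewrite mule_ge0// lee_fin c0.
apply: (@le_trans _ _ (\sum_(i <- J) \sum_(x <- s) F i x)).
  rewrite exchange_big /= big_seq [leRHS]big_seq; apply: lee_sum => x xs.
  have [i iJ [Qi ai]] := aP _ (sP _ xs).
  apply: le_trans ai _; rewrite (big_rem i iJ) /= {1}/F asboolT// leeDl//.
  by rewrite big_seq; apply: sume_ge0 => j /mem_rem; exact: F0.
rewrite -sumEFin big_seq [X in _ <= X * _]big_seq.
rewrite ge0_sume_distrl; last by move=> i /c0; rewrite lee_fin.
apply: lee_sum => i iJ; rewrite /F -big_mkcond /= -big_filter.
rewrite -ge0_sume_distrr; last by move=> x _; exact: b0.
apply: lee_wpmul2l; first by rewrite lee_fin c0.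
rewrite -(big_map (e i) xpredT b); apply: esum_ge_seq.
  rewrite map_inj_in_uniq ?filter_uniq// => x y; rewrite !mem_filter.
  by move=> /andP[_ /sP Px] /andP[_ /sP Py]; exact: inj.
by move=> y /mapP [x + ->]; rewrite mem_filter => /andP[/asboolP].
Qed.

End ESums.

Section Transfer.
Local Open Scope ereal_scope.
Context (R : realType) (W : countType) (M : transition_matrix W) (G : groupType).
Local Notation Sigma := (shift_space M).
Local Notation X := (Sigma * discrete_group G)%type.
Context (phi : Sigma -> R) (psi : W -> G) (phi_gt0 : forall x, (0 < phi x)%R).
Implicit Types (f : X -> \bar R) (x : Sigma) (g : discrete_group G) (w : seq W).

Let phin0 n x : (0 <= birkhoff_prod phi n x)%R.
Proof. by apply: ltW; exact: birkhoff_prod_gt0. Qed.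

Lemma iter_ext_transferE n f x g : (forall z, 0 <= f z) ->
  iter n (ext_transfer phi psi) f (x, g) =
  \esum_(w in [set w | size w = n /\ fits w x])
    (birkhoff_prod phi n (tau w x))%:E *
    f (tau w x, (g * (psi_word psi w)^-1)%g).
Proof.
move=> f0; elim: n x g => [|n IHn] x g.
  rewrite (_ : mkset _ = [set [::]]); last first.
    by rewrite predeqE => w /=; split=> [[/size0nil]|->].
  have x0 : tau [::] x = x by exact: (@tau_iter_theta _ _ [::] x).
  rewrite esum_set1 ?mule_ge0 ?lee_fin// x0 /birkhoff_prod big_ord0 mul1e.
  by rewrite /psi_word big_nil invg1 mulg1.
rewrite iterS /ext_transfer /=.
under eq_esum => v _.
  rewrite IHn -esumZ; last 2 first.
  - exact: ltW.
  - by move=> w _; rewrite mule_ge0// lee_fin.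
  over.
rewrite esum_esum; last first.
  by move=> v w _ _; rewrite !mule_ge0// lee_fin// ltW.
pose Q := [set w | size w = n.+1 /\ fits w x].
rewrite (@reindex_esum _ _ _ ([set v | cylinder_image M [:: v] x] `*``
    (fun v => [set w | size w = n /\ fits w (tau [:: v] x)])) Q
    (fun k => rcons k.2 k.1)).
  apply: eq_esum => -[v w] [/cylinder_imageP vx [wn wvx]] /=.
  have wv : fits (w ++ [:: v]) x by rewrite fits_catE.
  rewrite -cats1 -(tau_cat wv) muleA -EFinM.
  rewrite -addn1 birkhoff_prodD birkhoff_prod1 -wn (iter_theta_tau wvx).
  by rewrite psi_word_cat psi_word1 invgM mulgA [(phi _ * _)%R]mulrC.
split.
- move=> [v w] [/= /cylinder_imageP vx [wn wvx]].
  by rewrite -cats1; split; [rewrite size_cat addn1 wn|rewrite fits_catE].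
- by move=> [v w] [v' w'] _ _ /= /rcons_inj [-> ->].
- move=> w [wn wx]; case/lastP: w wn wx => // w v.
  rewrite size_rcons -cats1 => -[wn] wx; exists (v, w); last by rewrite /= cats1.
  have vx := fits_cat wx.
  split => /=; first exact/cylinder_imageP.
  by rewrite -fits_catE.
Qed.

Lemma series_ext_transferE (c : nat -> R) f x g :
  (forall n, 0 <= c n)%R -> (forall z, 0 <= f z) ->
  \sum_(1 <= n <oo) (c n)%:E * iter n (ext_transfer phi psi) f (x, g) =
  \esum_(w in [set w | w <> [::] /\ fits w x])
    (c (size w))%:E * ((birkhoff_prod phi (size w) (tau w x))%:E *
    f (tau w x, (g * (psi_word psi w)^-1)%g)).
Proof.
move=> c0 f0.
pose F n : \bar R := (c n)%:E * iter n (ext_transfer phi psi) f (x, g).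
have F0 n : 0 <= F n.
  rewrite /F iter_ext_transferE// mule_ge0// ?lee_fin//; apply: esum_ge0 => w _.
  by rewrite mule_ge0// lee_fin.
transitivity (\sum_(n <oo | (1 <= n)%N) F n).
  congr (limn _); apply/funext => k.
  by rewrite (big_nat_widenl 1 0).
rewrite nneseries_esum//.
under eq_esum => n _.
  rewrite /F iter_ext_transferE// -esumZ//; last first.
    by move=> w _; rewrite mule_ge0// lee_fin.
  over.
rewrite esum_esum; last first.
  by move=> n w _ _; rewrite !mule_ge0// lee_fin.
rewrite (@reindex_esum _ _ _ [set w | w <> [::] /\ fits w x] _ (fun w => (size w, w)))//.
split.
- by move=> w /= [w0 wx]; split=> //=; case: w w0 {wx}.
- by move=> v w _ _ /= [].
- by move=> [n w] /= [n0 [wn wx]]; exists w; [split=> //; move=> w0; rewrite -wn w0 in n0|rewrite wn].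
Qed.

End Transfer.

(** * Weighted sums over the words which end at a point *)

Lemma cat_cancelr (T : eqType) (s : seq T) : injective (cat^~ s).
Proof.
move=> p q pq; have /eqP := congr1 size pq; rewrite !size_cat eqn_add2r => /eqP pq'.
by move: (congr1 (take (size p)) pq); rewrite take_size_cat// pq' take_size_cat.
Qed.

Lemma suffix_cat_le (T : eqType) (u v p q : seq T) :
  p ++ u = q ++ v -> (size u <= size v)%N -> suffix u v.
Proof.
move=> pq uv; have /(congr1 size) := pq; rewrite !size_cat => spq.
rewrite suffixE; apply/eqP.
transitivity (drop (size p) (p ++ u)); last by rewrite drop_size_cat.
have -> : size p = (size v - size u + size q)%N by lia.
by rewrite pq -drop_drop drop_size_cat.
Qed.

Section WordSums.
Context (R : realType) (W : countType) (M : transition_matrix W) (G : groupType).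
Local Notation Sigma := (shift_space M).
Local Notation X := (Sigma * discrete_group G)%type.
Context (phi : Sigma -> R) (psi : W -> G) (phi_gt0 : forall x, 0 < phi x).
Context (m : seq W -> R) (K : R) (mK : quasi_bernoulli M m K) (mkraft : kraft m).
Context (gibbs : forall w x, cylinder M w x ->
  birkhoff_prod phi (size w) x <= K * m w /\
  m w <= K * birkhoff_prod phi (size w) x).
Context (connect : exists UU : seq (seq W),
  (forall U, U \in UU ->
     [/\ sorted M U, psi_word psi U = 1%g & (1 <= size U)%N]) /\
  forall p q, sorted M p -> sorted M q ->
        exists2 U, U \in UU & sorted M (p ++ U ++ q)).
Context (b : nat -> R) (b_gt0 : forall n, 0 < b n).
Context (b_mono : forall n k, (n <= k)%N -> b n <= b k).
Implicit Types (u v w p q U V : seq W) (x y : Sigma) (s : R) (k g : G).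

Let K1 : 1 <= K. Proof. by have [] := mK. Qed.
Let K0 : 0 <= K. Proof. exact: le_trans K1. Qed.
Let m0 w : 0 <= m w. Proof. by have [] := mK. Qed.
Let mgt0 w : sorted M w -> 0 < m w. Proof. by have [_ _ + _ _] := mK; apply. Qed.
Let catr u v : sorted M (u ++ v) -> m u * m v <= K * m (u ++ v).
Proof. by have [_ _ _ _ +] := mK; apply. Qed.
Let phin0 n x : 0 <= birkhoff_prod phi n x.
Proof. by apply: ltW; exact: birkhoff_prod_gt0. Qed.

Definition coef s n := s ^- n * b n.

Lemma coef_ge0 s n : 0 < s -> 0 <= coef s n.
Proof. by move=> s0; rewrite mulr_ge0 ?invr_ge0 ?exprn_ge0 ?ltW. Qed.

Definition words_to x := [set w | w <> [::] /\ fits w x].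

(** Up to a constant, this is the Poincare series of a fiber, with the products
    of the potential replaced by the weights of words.  Words can be cut, glued
    and reversed, which gives the comparisons below. *)
Definition word_sum s x k : \bar R :=
  \esum_(w in words_to x) (coef s (size w) * m w * (psi_word psi w == k^-1)%g%:R)%:E.

Lemma word_term_ge0 s w k : 0 < s ->
  (0 <= (coef s (size w) * m w * (psi_word psi w == k^-1)%g%:R)%:E)%E.
Proof. by move=> s0; rewrite lee_fin; apply: mulr_ge0 => //; rewrite mulr_ge0// coef_ge0. Qed.

Definition fiber_sum s x k : \bar R :=
  (\sum_(1 <= n <oo) (coef s n)%:E *
     iter n (ext_transfer phi psi) (fun z => (\1_(fiber M k) z)%:E) (x, 1%g))%E.

Lemma fiber_sumE s x k : 0 < s -> fiber_sum s x k =
  (\esum_(w in words_to x) (coef s (size w) *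
     birkhoff_prod phi (size w) (tau w x) * (psi_word psi w == k^-1)%g%:R)%:E)%E.
Proof.
move=> s0; rewrite /fiber_sum series_ext_transferE//; last first.
  by move=> n; exact: coef_ge0.
apply: eq_esum => w _; rewrite -!EFinM mulrA indicE; congr ((_ * _%:R)%:E).
rewrite mul1g; congr nat_of_bool; apply/idP/eqP => [/set_mem|wk].
  by rewrite /fiber /= => <-; rewrite invgK.
by apply/mem_set; rewrite /fiber /= wk invgK.
Qed.

Lemma fiber_sum_le s x k : 0 < s ->
  (fiber_sum s x k <= K%:E * word_sum s x k)%E.
Proof.
move=> s0; rewrite fiber_sumE// -esumZ//; last by move=> w _; exact: word_term_ge0.
apply: le_esum => w [_ wx]; rewrite -EFinM lee_fin mulrA ler_wpM2r// mulrCA.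
rewrite ler_wpM2l ?coef_ge0//.
by have [] := gibbs (tau_cylinder wx).
Qed.

Lemma word_sum_le s x k : 0 < s ->
  (word_sum s x k <= K%:E * fiber_sum s x k)%E.
Proof.
move=> s0; rewrite fiber_sumE// -esumZ//; last first.
  by move=> w _; rewrite lee_fin; apply: mulr_ge0 => //; rewrite mulr_ge0// coef_ge0.
apply: le_esum => w [_ wx]; rewrite -EFinM lee_fin mulrA ler_wpM2r// mulrCA.
rewrite ler_wpM2l ?coef_ge0//.
by have [] := gibbs (tau_cylinder wx).
Qed.

Lemma fiber_sum_ge0 s x k : 0 < s -> (0 <= fiber_sum s x k)%E.
Proof.
move=> s0; rewrite fiber_sumE//; apply: esum_ge0 => w _.
by rewrite lee_fin; apply: mulr_ge0 => //; rewrite mulr_ge0// coef_ge0.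
Qed.

Lemma coef_add s n i : 0 < s -> coef s n <= s ^+ i * coef s (n + i).
Proof.
move=> s0; rewrite /coef mulrA exprD invfM mulrCA mulfV ?expf_neq0 ?gt_eqF// mulr1.
rewrite ler_wpM2l ?invr_ge0 ?exprn_ge0 ?(ltW s0)//.
by apply: b_mono; rewrite leq_addr.
Qed.

(** Words ending at [x] are turned into words ending at [x'] by appending
    connecting words; these do not change the group value. *)
Lemma word_sum_map (f : seq W -> seq W) (B : R) : 0 <= B ->
  injective f -> (forall q, size (f q) = size q) ->
  (forall q, sorted M q -> sorted M (f q) /\ m q <= B * m (f q)) ->
  forall s', 0 < s' -> exists C, forall s x x' k k', 0 < s -> s <= s' ->
  (forall q, psi_word psi q = k^-1 -> psi_word psi (f q) = k'^-1)%g ->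
  (word_sum s x k <= C%:E * word_sum s x' k')%E.
Proof.
move=> B0 finj fsize fm s' s'0; have [UU [UU1 UU2]] := connect.
exists (\sum_(U <- UU) B * K * s' ^+ size U / m U) => s x x' k k' s0 ss' fk.
apply: (@esum_le_injections _ _ _ _ _ _ _ _ _ (fun U q => f q ++ U)).
- by move=> U _; rewrite divr_ge0// !mulr_ge0// exprn_ge0// ltW.
- by move=> w; exact: word_term_ge0.
- move=> q [q0 qx].
  have [fs mq] := fm _ (fits_sorted qx).
  have [U UUU fU] := UU2 _ [:: x' 0%N] fs isT.
  have [Us U1 _] := UU1 _ UUU.
  exists U => //; split.
    split; last by rewrite /fits -catA.
    by move=> /(congr1 size)/eqP; rewrite size_cat fsize /= addn_eq0 => /andP[/eqP/size0nil].
  rewrite -EFinM lee_fin psi_word_cat U1 mulg1.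
  case: eqP => [/fk ->|_]; last first.
    rewrite mulr0; apply: mulr_ge0; last first.
      have := word_term_ge0 (f q ++ U) k' s0.
      by rewrite lee_fin psi_word_cat U1 mulg1.
    by rewrite divr_ge0// !mulr_ge0// exprn_ge0// ltW.
  rewrite eqxx !mulr1 size_cat fsize.
  have mU0 := mgt0 Us.
  apply: (@le_trans _ _ ((s' ^+ size U * coef s (size q + size U)) *
      (B * (K * m (f q ++ U) / m U)))).
    apply: ler_pM => //; first exact: coef_ge0.
      apply: le_trans (coef_add _ (size U) s0) _.
      by rewrite ler_wpM2r ?coef_ge0// lerXn2r ?nnegrE ?(ltW s0) ?(ltW s'0).
    apply: le_trans mq _; rewrite ler_wpM2l// ler_pdivlMr//; apply: catr.
    by move: fU; rewrite catA => /cat_sorted2[].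
  by rewrite le_eqVlt; apply/orP; left; apply/eqP; field; rewrite gt_eqF.
- by move=> U p q _ _ /cat_cancelr /finj.
Qed.

Lemma sum_esum (T1 T2 : choiceType) (E : seq T1) (Q : set T2)
    (a : T1 -> T2 -> \bar R) : uniq E ->
  (forall i j, 0 <= a i j)%E ->
  (\sum_(i <- E) \esum_(j in Q) a i j =
   \esum_(k in [set` E] `*` Q) a k.1 k.2)%E.
Proof.
move=> uE a0; rewrite fsbig_seq// -esum_fset//; last first.
  by move=> i _; exact: esum_ge0.
by rewrite esum_esum.
Qed.

(** A word [q] ending at [x] and a word [w] in [E] are combined into the word
    [q ++ U ++ w ++ V] ending at [x], where [U] and [V] are connecting words.
    Given [U] and [V], the pair can be recovered as [E] is suffix-free. *)
Lemma word_sum_excessive s' : 0 < s' -> exists C, forall s x k E, 0 < s -> s <= s' ->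
  uniq E -> suffix_free E -> (forall w, w \in E -> sorted M w) ->
  (\sum_(w <- E) (m w * s ^- size w)%:E * word_sum s x (psi_word psi w * k)%g <=
   C%:E * word_sum s x k)%E.
Proof.
move=> s'0; have [UU [UU1 UU2]] := connect.
pose c UV := K ^+ 3 * s' ^+ (size UV.1 + size UV.2) / (m UV.1 * m UV.2).
have c0 UV : 0 <= c UV.
  by rewrite /c divr_ge0// !mulr_ge0// exprn_ge0// ltW.
exists (\sum_(UV <- allpairs pair UU UU) c UV) => s x k E s0 ss' uE sE aE.
have ws0 w : 0 <= m w * s ^- size w by rewrite mulr_ge0// invr_ge0 exprn_ge0// ltW.
under eq_bigr => w _.
  rewrite /word_sum -esumZ; last 2 first.
  - exact: ws0.
  - by move=> q _; exact: word_term_ge0.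
  over.
rewrite sum_esum//; last first.
  by move=> w q; rewrite mule_ge0 ?word_term_ge0// lee_fin.
apply: (@esum_le_injections _ _ _ _ _ _ _ _ _
  (fun (UV wq : seq W * seq W) => wq.2 ++ UV.1 ++ wq.1 ++ UV.2)).
- by move=> UV _; exact: c0.
- by move=> w; exact: word_term_ge0.
- move=> [w q] /= [wE [q0 qx]].
  have ws := aE _ wE.
  have [V VUU wV] := UU2 _ [:: x 0%N] ws isT.
  have [U UUU qU] := UU2 _ _ (fits_sorted qx) wV.
  have [Us U1 _] := UU1 _ UUU; have [Vs V1 _] := UU1 _ VUU.
  have all_s : sorted M (q ++ U ++ w ++ V).
    by move: qU; rewrite !catA => /cat_sorted2[].
  have UwV : sorted M (U ++ w ++ V) by have /cat_sorted2[] := all_s.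
  have wVs : sorted M (w ++ V) by have /cat_sorted2[] := UwV.
  exists (U, V); first by apply/allpairsP; exists (U, V).
  split; first by split; [case: (q) q0|rewrite /fits -!catA].
  rewrite -!EFinM lee_fin !psi_word_cat U1 V1 mulg1 mul1g.
  case: eqP => [->|_]; last first.
    rewrite !mulr0; apply: mulr_ge0; first exact: c0.
    apply: mulr_ge0 => //; rewrite mulr_ge0// coef_ge0//.
  rewrite invgM mulgVK eqxx !mulr1 !size_cat /c /=.
  set l := (size q + (size U + (size w + size V)))%N.
  have lE : l = ((size q + (size U + size V)) + size w)%N.
    by rewrite /l (addnC (size w)) !addnA.
  have mU0 := mgt0 Us; have mV0 := mgt0 Vs.
  have mass : m q * m w <= K ^+ 3 / (m U * m V) * m (q ++ U ++ w ++ V).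
    rewrite mulrAC ler_pdivlMr ?mulr_gt0//.
    apply: (@le_trans _ _ (m q * (m U * (m w * m V)))).
      by rewrite le_eqVlt; apply/orP; left; apply/eqP; ring.
    apply: (@le_trans _ _ (m q * (m U * (K * m (w ++ V))))).
      by do 2 apply: ler_wpM2l => //; exact: catr.
    apply: (@le_trans _ _ (K * m q * (K * m (U ++ w ++ V)))).
      rewrite [leLHS](_ : _ = K * m q * (m U * m (w ++ V))); last by ring.
      by apply: ler_wpM2l; [exact: mulr_ge0|exact: catr].
    rewrite [leLHS](_ : _ = K * K * (m q * m (U ++ w ++ V))); last by ring.
    rewrite [leRHS](_ : _ = K * K * (K * m (q ++ U ++ w ++ V))); last by ring.
    by apply: ler_wpM2l; [exact: mulr_ge0|exact: catr].
  have cf : s ^- size w * coef s (size q) <= s' ^+ (size U + size V) * coef s l.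
    apply: (@le_trans _ _ (s ^- size w * (s ^+ (size U + size V) *
        coef s (size q + (size U + size V))))).
      by rewrite ler_wpM2l ?invr_ge0 ?exprn_ge0 ?(ltW s0)//; exact: coef_add.
    rewrite mulrCA; apply: ler_pM.
    + by rewrite exprn_ge0// ltW.
    + by rewrite mulr_ge0 ?coef_ge0// invr_ge0 exprn_ge0// ltW.
    + by rewrite lerXn2r ?nnegrE ?(ltW s0) ?(ltW s'0).
    + rewrite lE /coef [in leRHS]exprD invfM.
      rewrite mulrA [X in X * _ <= _]mulrC ler_wpM2l//.
        by rewrite mulr_ge0// invr_ge0 exprn_ge0// ltW.
      by apply: b_mono; rewrite leq_addr.
  rewrite [leLHS](_ : _ = (s ^- size w * coef s (size q)) * (m q * m w)); last by ring.
  rewrite [leRHS](_ : _ = (s' ^+ (size U + size V) * coef s l) *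
    (K ^+ 3 / (m U * m V) * m (q ++ U ++ w ++ V))); last by ring.
  apply: ler_pM => //; last exact: mulr_ge0.
  by rewrite mulr_ge0 ?coef_ge0// invr_ge0 exprn_ge0// ltW.
- move=> [U V] [w q] [w' q'] /= [wE _] [w'E _]; rewrite !catA => /cat_cancelr.
  move=> qq; suff ww' : w = w'.
    by move: qq; rewrite ww' => /cat_cancelr /cat_cancelr ->.
  case: (leqP (size w) (size w')) => [|/ltnW] ww.
    by apply: sE => //; exact: suffix_cat_le qq ww.
  by apply/esym/sE => //; exact: suffix_cat_le (esym qq) ww.
Qed.

Lemma fiber_sum_excessive s' : 0 < s' -> exists C, forall s x k E,
  0 < s -> s <= s' ->
  uniq E -> suffix_free E -> (forall w, w \in E -> sorted M w) ->
  (\sum_(w <- E) (m w * s ^- size w)%:E * fiber_sum s x (psi_word psi w * k)%g <=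
   C%:E * fiber_sum s x k)%E.
Proof.
move=> s'0; have [C CP] := word_sum_excessive s'0.
exists (K * (`|C| * K)) => s x k E s0 ss' uE sE aE.
have ws0 w : 0 <= m w * s ^- size w by rewrite mulr_ge0// invr_ge0 exprn_ge0// ltW.
apply: (@le_trans _ _ (\sum_(w <- E) K%:E * ((m w * s ^- size w)%:E *
    word_sum s x (psi_word psi w * k)%g))%E).
  apply: lee_sum => w _; rewrite muleCA; apply: lee_wpmul2l; first by rewrite lee_fin.
  exact: fiber_sum_le.
have wsg0 j : (0 <= word_sum s x j)%E.
  by apply: esum_ge0 => w _; exact: word_term_ge0.
rewrite -ge0_sume_distrr; last by move=> w _; rewrite mule_ge0// lee_fin.
rewrite EFinM -muleA; apply: lee_wpmul2l; first by rewrite lee_fin.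
apply: le_trans (CP s x k E s0 ss' uE sE aE) _.
rewrite EFinM -muleA; apply: (@le_trans _ _ (`|C|%:E * word_sum s x k)%E).
  by apply: lee_wpmul2r => //; rewrite lee_fin ler_norm.
by apply: lee_wpmul2l; [rewrite lee_fin|exact: word_sum_le].
Qed.

Lemma fiber_sum_map (f : seq W -> seq W) (B : R) : 0 <= B ->
  injective f -> (forall q, size (f q) = size q) ->
  (forall q, sorted M q -> sorted M (f q) /\ m q <= B * m (f q)) ->
  forall s', 0 < s' -> exists2 C, 0 <= C & forall s x x' k k', 0 < s -> s <= s' ->
  (forall q, psi_word psi q = k^-1 -> psi_word psi (f q) = k'^-1)%g ->
  (fiber_sum s x k <= C%:E * fiber_sum s x' k')%E.
Proof.
move=> B0 finj fsize fm s' s'0.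
have [C CP] := word_sum_map B0 finj fsize fm s'0.
exists (K * (`|C| * K)) => [|s x x' k k' s0 ss' fk]; first by rewrite !mulr_ge0.
apply: le_trans (fiber_sum_le _ _ s0) _.
rewrite EFinM -muleA; apply: lee_wpmul2l; first by rewrite lee_fin.
apply: le_trans (CP s x x' k k' s0 ss' fk) _.
have wsg0 j : (0 <= word_sum s x' j)%E.
  by apply: esum_ge0 => w _; exact: word_term_ge0.
rewrite EFinM -muleA; apply: (@le_trans _ _ (`|C|%:E * word_sum s x' k')%E).
  by apply: lee_wpmul2r => //; rewrite lee_fin ler_norm.
by apply: lee_wpmul2l; [rewrite lee_fin|exact: word_sum_le].
Qed.

Lemma fiber_sum_gt0 s x : 0 < s -> (0 < fiber_sum s x 1%g)%E.
Proof.
move=> s0; have [UU [UU1 /(_ [::] [:: x 0%N] isT isT)[U UUU Ux]]] := connect.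
have [Us U1 U0] := UU1 _ UUU.
have bnd : (0 < word_sum s x 1%g)%E.
  apply: lt_le_trans (@esum_ge_seq _ _ _ _ [:: U] isT _); last first.
    by move=> q; rewrite inE => /eqP ->; split => //; case: (U) U0.
  rewrite big_seq1 U1 invg1 eqxx mulr1 lte_fin mulr_gt0 ?mgt0//.
  by rewrite mulr_gt0// invr_gt0 exprn_gt0.
have := lt_le_trans bnd (word_sum_le _ _ s0).
by rewrite !lt0e mule_eq0 negb_or => /andP[/andP[_ ->] _]; exact: fiber_sum_ge0.
Qed.

Context (psi_onto : forall k, exists2 p, sorted M p & psi_word psi p = k).

(** All fibers are reached from the fiber of the identity, and the base points
    can be interchanged. *)
Lemma fiber_sum_bound s' x' k : 0 < s' -> exists2 B, 0 <= B &
  forall s x, 0 < s -> s <= s' ->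
  (fiber_sum s x k <= B%:E * fiber_sum s x' 1%g)%E.
Proof.
move=> s'0; have [p ps pk] := psi_onto k; have mp := mgt0 ps.
have [C CP] := fiber_sum_excessive s'0.
have [C' C'0 C'P] := @fiber_sum_map id 1 ler01 (@inj_id _)
  (fun q => erefl) (fun q qs => conj qs (eq_ind_r (fun t => _ <= t) (lexx _) (mul1r _)))
  _ s'0.
exists (s' ^+ size p / m p * (`|C| * C')) => [|s x s0 ss'].
  by rewrite mulr_ge0 ?mulr_ge0 ?exprn_ge0 ?invr_ge0// ltW.
have ws0 : 0 < m p * s ^- size p by rewrite mulr_gt0// invr_gt0 exprn_gt0.
have := CP s x 1%g [:: p] s0 ss' isT.
rewrite big_seq1 mulg1 pk => /(_ _ _)/le_trans h.
have : (fiber_sum s x k <= (m p * s ^- size p)^-1%:E * (`|C|%:E * fiber_sum s x 1%g))%E.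
  rewrite lee_pdivlMl//; apply: h.
  - by move=> u v; rewrite !inE => /eqP -> /eqP ->.
  - by move=> u; rewrite inE => /eqP ->.
  - by apply: lee_wpmul2r; [exact: fiber_sum_ge0|rewrite lee_fin ler_norm].
move=> /le_trans; apply.
rewrite EFinM -muleA; apply: lee_pmul.
- by rewrite lee_fin invr_ge0 ltW.
- by rewrite mule_ge0// fiber_sum_ge0.
- rewrite lee_fin invfM invrK mulrC ler_wpM2r ?invr_ge0 ?(ltW mp)//.
  by rewrite lerXn2r ?nnegrE ?(ltW s0) ?(ltW s'0).
- by rewrite EFinM -muleA; apply: lee_wpmul2l; [rewrite lee_fin|apply: C'P].
Qed.

Context (b_ratio : forall l, exists N, forall n, (N <= n)%N -> b (n + l) <= 2 * b n).

Definition cylinder_sum s x w g : \bar R :=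
  (\sum_(1 <= n <oo) (coef s n)%:E *
     iter n (ext_transfer phi psi) (fun z => (\1_(ext_cylinder M w g) z)%:E) (x, 1%g))%E.

Lemma esum_size_lt L : (\esum_(q in [set q : seq W | (size q < L)%N]) (m q)%:E <= L%:R%:E)%E.
Proof.
apply: esum_le_seq => E uE EL; rewrite sumEFin lee_fin.
have -> : \sum_(q <- E) m q = \sum_(i < L) \sum_(q <- E | size q == i) m q.
  under [RHS]eq_bigr do rewrite big_mkcond.
  rewrite exchange_big /= big_seq [RHS]big_seq; apply: eq_bigr => q qE.
  by rewrite -big_mkcond /= (big_pred1 (Ordinal (EL _ qE))).
have -> : L%:R = \sum_(i < L) 1 :> R by rewrite sumr_const card_ord.
apply: ler_sum => i _; rewrite -big_filter.
apply: (@kraft_size _ _ _ mkraft i); first exact: filter_uniq.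
by move=> q; rewrite mem_filter => /andP[/eqP].
Qed.

(** Deleting the prefix [w] from a word multiplies its term by about
    [s ^+ size w / m w], up to the quotient of the weights [b], which is close to
    [1] except for finitely many lengths. *)
Lemma cylinder_sum_le r w g : 0 < r -> exists B, forall s x, r <= s ->
  (cylinder_sum s x w g <=
   B%:E + (2 * K ^+ 3 * m w * s ^- size w)%:E * fiber_sum s x (g * psi_word psi w)%g)%E.
Proof.
move=> r0; have [N NP] := b_ratio (size w).
pose L := (N + size w).+1.
exists ((\sum_(n < L) coef r n) * K * L%:R) => s x rs.
have s0 : 0 < s by exact: lt_le_trans rs.
rewrite /cylinder_sum series_ext_transferE//; last by move=> n; exact: coef_ge0.
pose F q : \bar R := ((coef s (size q))%:E *
  ((birkhoff_prod phi (size q) (tau q x))%:E *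
   (\1_(ext_cylinder M w g) (tau q x, (1 * (psi_word psi q)^-1)%g))%:E))%E.
pose P := words_to x.
rewrite [X in (X <= _)%E](_ : _ = \esum_(q in P) F q)//.
have F0 q : P q -> (0 <= F q)%E.
  by move=> _; rewrite /F !mule_ge0// lee_fin// coef_ge0.
(* A nonzero term of a word of length at least L comes from a word which has
   the prefix w and more than N further letters. *)
rewrite (esumID [set q | (size q < L)%N])//; apply: leeD.
  rewrite EFinM.
  apply: (@le_trans _ _ (\esum_(q in P `&` [set q | (size q < L)%N])
      ((\sum_(n < L) coef r n) * K)%:E * (m q)%:E)%E).
    apply: le_esum => q [[_ qx] qL].
    rewrite /F -!EFinM lee_fin.
    have [phim _] := gibbs (tau_cylinder qx).
    set ind := \1_ _ _; have ind0 : 0 <= ind by [].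
    have ind1 : ind <= 1 by rewrite /ind indicE; case: (_ \in _).
    have Sq : coef s (size q) <= \sum_(n < L) coef r n.
      rewrite (bigD1 (Ordinal qL)) //=; apply: (@le_trans _ _ (coef r (size q))).
        rewrite /coef ler_wpM2r ?(ltW (b_gt0 _))// lef_pV2 ?posrE ?exprn_gt0//.
        by rewrite lerXn2r ?nnegrE ?(ltW s0) ?(ltW r0).
      by rewrite lerDl; apply: sumr_ge0 => i _; exact: coef_ge0.
    apply: (@le_trans _ _ ((\sum_(n < L) coef r n) *
        (birkhoff_prod phi (size q) (tau q x) * ind))).
      by apply: ler_wpM2r => //; exact: mulr_ge0.
    rewrite -[leRHS]mulrA; apply: ler_wpM2l.
      by apply: sumr_ge0 => i _; exact: coef_ge0.
    apply: le_trans phim; rewrite -[leRHS]mulr1; exact: ler_wpM2l.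
  rewrite esumZ//; last 2 first.
  - by rewrite mulr_ge0// sumr_ge0// => i _; exact: coef_ge0.
  - by move=> q _; rewrite lee_fin.
  apply: lee_wpmul2l.
    by rewrite lee_fin mulr_ge0// sumr_ge0// => i _; exact: coef_ge0.
  apply: le_trans (esum_size_lt L).
  by apply: esum_subset => q [].
rewrite (esumID [set q | prefix w q]) => [|q [/F0]//].
rewrite [X in (_ + X)%E]esum1 ?adde0; last first.
  move=> q [[[_ qx] /= /negP]]; rewrite -leqNgt => Lq nwq.
  rewrite /F indicE memNset ?mule0// => -[/= wq _]; apply: nwq.
  have qq := tau_cylinder qx.
  have wsize : (size w <= size q)%N by apply: leq_trans Lq; rewrite /L leqW// leq_addl.
  rewrite prefixE -[X in take _ X]qq /mkseq -map_take take_iota.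
  by rewrite (minn_idPl wsize); apply/eqP.
rewrite (_ : 2 * K ^+ 3 * m w * s ^- size w =
  (\sum_(i <- [:: tt]) 2 * K ^+ 2 * m w * s ^- size w) * K); last first.
  by rewrite big_seq1; ring.
rewrite EFinM -muleA; apply: le_trans; last first.
  apply: lee_wpmul2l; last exact: word_sum_le.
  rewrite big_seq1 lee_fin !mulr_ge0// ?exprn_ge0// invr_ge0 exprn_ge0// ltW//.
apply: (@esum_le_injections _ _ _ _ _ _ _ _ _ (fun=> drop (size w))).
- move=> _ _; rewrite !mulr_ge0// ?exprn_ge0// invr_ge0 exprn_ge0// ltW//.
- by move=> q; exact: word_term_ge0.
- move=> q [[[q0 qx] /= /negP]]; rewrite -leqNgt => Lq /prefixP [p qE].
  have [_ _ _ catl _] := mK.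
  exists tt => //; rewrite qE drop_size_cat//.
  have pq : size q = (size p + size w)%N by rewrite qE size_cat addnC.
  have Np : (N < size p)%N.
    by rewrite -(ltn_add2r (size w)) -pq; exact: Lq.
  split.
    split; last by apply: (@fits_cat _ _ w); rewrite -qE.
    by move=> p0; rewrite p0 in Np.
  have [phim _] := gibbs (tau_cylinder qx).
  rewrite /F indicE -!EFinM lee_fin -qE.
  set i1 := (_ \in _); set i2 := (_ == _).
  have i12 : (i1 <= i2)%N.
    rewrite /i1; case: (boolP (_ \in _)) => // /set_mem [/= _ gE].
    rewrite lt0b /i2 -gE mul1g qE psi_word_cat invgM.
    by rewrite !invgM !invgK mulgA mulVg mul1g.
  rewrite mulrA; apply: (@le_trans _ _ (coef s (size q) *
      birkhoff_prod phi (size q) (tau q x) * i2%:R)).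
    by rewrite ler_wpM2l ?ler_nat// mulr_ge0// coef_ge0.
  rewrite [leRHS](_ : _ = (2 * (s ^- size w * coef s (size p))) *
      (K * (K * (m w * m p))) * i2%:R); last by ring.
  apply: ler_wpM2r => //; apply: ler_pM => //; first exact: coef_ge0.
    rewrite /coef pq exprD invfM [X in X * _ <= _]mulrC -mulrA [leRHS]mulrCA.
    rewrite ler_wpM2l ?invr_ge0 ?exprn_ge0 ?(ltW s0)// [leRHS]mulrCA.
    by rewrite ler_wpM2l ?invr_ge0 ?exprn_ge0 ?(ltW s0)//; apply: NP; exact: ltnW.
  by apply: le_trans phim _; rewrite ler_wpM2l//= qE; exact: catl.
- move=> _ q q' [_ /prefixP [p ->]] [_ /prefixP [p' ->]].
  by rewrite !drop_size_cat// => ->.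
Qed.

End WordSums.

(** * The critical exponent *)

Lemma cvg_exprn (R : realType) (u : nat -> R) (a : R) n :
  u @ \oo --> a -> (fun k => u k ^+ n) @ \oo --> a ^+ n.
Proof. by move=> ua; exact: (cvg_comp u _ ua (@exprn_continuous R n a)). Qed.

Section Weights.
Context (R : realType) (lambda : nat -> R).
Context (lambda_ge1 : forall k, (1 <= k)%N -> 1 <= lambda k).
Context (lambda_mono : forall j k, (1 <= j)%N -> (j <= k)%N -> lambda k <= lambda j).
Context (lambda_cvg : lambda @ \oo --> (1 : R)).

Lemma weightS n : weight lambda n.+1 = weight lambda n * lambda n.+1.
Proof. by rewrite /weight big_nat_recr. Qed.

Lemma weight_gt0 n : 0 < weight lambda n.
Proof.
elim: n => [|n IHn]; first by rewrite /weight big_nil.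
by rewrite weightS mulr_gt0// (lt_le_trans ltr01)// lambda_ge1.
Qed.

Lemma weight_mono n k : (n <= k)%N -> weight lambda n <= weight lambda k.
Proof.
move=> /subnK <-; elim: (k - n)%N => [|l IHl]; first by rewrite add0n.
rewrite addSn weightS; apply: le_trans IHl _.
by rewrite ler_peMr ?lambda_ge1// ltW// weight_gt0.
Qed.

(** The weights grow subexponentially as [lambda] tends to [1]. *)
Lemma weight_ratio l : exists N, forall n, (N <= n)%N ->
  weight lambda (n + l) <= 2 * weight lambda n.
Proof.
have : (fun k => lambda k ^+ l) @ \oo --> (1 : R).
  rewrite -[X in _ --> X](expr1n R l).
  exact: cvg_exprn.
move=> /cvgr_lt/(_ 2 (ltr1n R 2)) [N _ NP]; exists N.+1 => n Nn.
apply: (@le_trans _ _ (lambda N.+1 ^+ l * weight lambda n)).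
  elim: l {NP} => [|l IHl]; first by rewrite addn0 mul1r.
  rewrite addnS weightS exprSr mulrAC; apply: ler_pM => //.
  - exact/ltW/weight_gt0.
  - by apply: le_trans ler01 _; apply: lambda_ge1.
  - by apply: lambda_mono => //; apply: leq_trans Nn _; rewrite -addnS leq_addr.
rewrite ler_wpM2r ?(ltW (weight_gt0 _))//; apply: ltW.
by apply: NP => /=; exact: leqnSn.
Qed.

End Weights.

Section CriticalExponent.
Context (R : realType) (W : countType) (M : transition_matrix W) (G : groupType).
Local Notation Sigma := (shift_space M).
Context (phi : Sigma -> R) (psi : W -> G) (phi_gt0 : forall x, 0 < phi x).
Context (m : seq W -> R) (K : R) (mK : quasi_bernoulli M m K) (mkraft : kraft m).
Context (gibbs : forall w x, cylinder M w x ->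
  birkhoff_prod phi (size w) x <= K * m w /\
  m w <= K * birkhoff_prod phi (size w) x).
Implicit Types (u v w p q U V : seq W) (x y xi : Sigma) (k g : G).

Let K1 : 1 <= K. Proof. by have [] := mK. Qed.
Let K0 : 0 < K. Proof. exact: lt_le_trans K1. Qed.
Let m0 w : 0 <= m w. Proof. by have [] := mK. Qed.
Let mgt0 w : sorted M w -> 0 < m w. Proof. by have [_ _ + _ _] := mK; apply. Qed.
Let phin0 n x : 0 <= birkhoff_prod phi n x.
Proof. by apply: ltW; exact: birkhoff_prod_gt0. Qed.

Lemma Zn_ge0 xi n : (0 <= Zn phi psi xi n)%E.
Proof.
rewrite /Zn iter_ext_transferE//; apply: esum_ge0 => w _.
by rewrite mule_ge0// lee_fin.
Qed.

Lemma Zn_ge xi q : fits q xi -> psi_word psi q = 1%g ->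
  ((m q / K)%:E <= Zn phi psi xi (size q))%E.
Proof.
move=> qx q1; rewrite /Zn iter_ext_transferE//.
apply: le_trans (@esum_ge_seq _ _ _ _ [:: q] isT _); last first.
  by move=> w; rewrite inE => /eqP ->.
rewrite big_seq1 q1 indicE mem_set; last by rewrite /fiber /= invg1 mulg1.
rewrite mule1 lee_fin ler_pdivrMr// mulrC.
by have [] := gibbs (tau_cylinder qx).
Qed.

Lemma Zn_le xi n : (Zn phi psi xi n <= K%:E)%E.
Proof.
rewrite /Zn iter_ext_transferE//.
apply: esum_le_seq => E uE EP.
apply: (@le_trans _ _ (\sum_(q <- E) (K * m q)%:E)%E).
  rewrite big_seq [leRHS]big_seq; apply: lee_sum => q /EP[<- qx].
  rewrite -EFinM lee_fin indicE -[leRHS]mulr1.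
  have [h _] := gibbs (tau_cylinder qx).
  by apply: ler_pM => //; case: (_ \in _).
rewrite sumEFin lee_fin -mulr_sumr -[leRHS]mulr1 ler_wpM2l ?(ltW K0)//.
by apply: (@kraft_size _ _ _ mkraft n) => // q /EP[].
Qed.

(** A loop through the first letter of [xi] with trivial group value can be
    repeated, so that the return sums decay at most exponentially. *)
Lemma growth_rate_gt0 xi v : sorted M (xi 0%N :: v ++ [:: xi 0%N]) ->
  psi_word psi (xi 0%N :: v) = 1%g -> (0 < growth_rate phi psi xi)%E.
Proof.
set a := xi 0%N; set q := a :: v => qa q1.
have qs : sorted M q by move: qa; rewrite -cat_cons => /cat_sorted2[].
pose qn j := iter j (cat q) [::].
have qnS j : qn j.+1 = q ++ qn j by [].
have qnx j : exists t, qn j ++ [:: a] = a :: t /\ sorted M (a :: t).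
  elim: j => [|j [t [tE ts]]]; first by exists [::].
  exists (v ++ a :: t); rewrite qnS -catA tE; split=> //.
  rewrite /= cat_path /=; move: qa ts; rewrite /= cat_path /= => /and3P[-> -> _].
  by move=> ->.
have qn1 j : psi_word psi (qn j) = 1%g.
  elim: j => [|j IHj]; first by rewrite /psi_word big_nil.
  by rewrite qnS psi_word_cat q1 IHj mulg1.
have qnf j : fits (qn j) xi by have [t [tE ts]] := qnx j; rewrite /fits tE.
have qnsz j : size (qn j) = (j * size q)%N.
  by elim: j => // j IHj; rewrite qnS size_cat IHj mulSn.
have mq := mgt0 qs.
pose t := m q / K ^+ 3.
have t0 : 0 < t by rewrite divr_gt0// exprn_gt0.
have [_ _ _ catl catr] := mK.
have mqn j : (m q / K) ^+ j <= K * m (qn j).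
  elim: j => [|j IHj].
    have := catl [::] q; rewrite cat0s mulrA -[X in X <= _]mul1r ler_pM2r//.
  rewrite qnS exprS.
  have := catr q (qn j) (fits_sorted (qnf j.+1)) => h.
  apply: (@le_trans _ _ (m q / K * (K * m (qn j)))).
    by rewrite ler_wpM2l// divr_ge0// ltW.
  by rewrite mulrA divfK ?gt_eqF.
have low j : ((t ^+ j.+1)%:E <= Zn phi psi xi (j.+1 * size q))%E.
  rewrite -qnsz; apply: le_trans (Zn_ge (qnf _) (qn1 _)).
  rewrite lee_fin ler_pdivlMr// -(ler_pM2l K0); apply: le_trans (mqn _).
  have -> : t = m q / K * K ^- 2 by rewrite /t exprS invfM mulrA.
  rewrite exprMn [leLHS](_ : _ = (m q / K) ^+ j.+1 * (K * (K ^- 2 ^+ j.+1 * K))); last by ring.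
  rewrite -[leRHS]mulr1 ler_wpM2l//.
    by rewrite exprn_ge0// divr_ge0// ltW.
  have k1 : K ^- 2 <= 1 by rewrite invf_le1 ?exprn_gt0// exprn_ege1.
  apply: (@le_trans _ _ (K * (K ^- 2 * K))).
    rewrite ler_wpM2l ?(ltW K0)// ler_wpM2r ?(ltW K0)// exprS ler_piMr//.
      by rewrite invr_ge0 exprn_ge0// ltW.
    by rewrite exprn_ile1// invr_ge0 exprn_ge0// ltW.
  by rewrite le_eqVlt; apply/orP; left; apply/eqP; field; rewrite gt_eqF.
rewrite /growth_rate limn_esup_lim.
apply: (@lt_le_trans _ _ (t `^ (size q)%:R^-1)%:E).
  by rewrite lte_fin powR_gt0.
apply: lime_ge; first exact: is_cvg_esups.
apply: nearW => n.
apply: (@le_trans _ _ (Zn phi psi xi (n.+1 * size q) `^ (n.+1 * size q)%:R^-1)%E).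
  apply: (@le_trans _ _ ((t ^+ n.+1)%:E `^ (n.+1 * size q)%:R^-1)%E); last first.
    apply: gt0_ler_poweR; rewrite ?in_itv/= ?leey ?andbT//.
      by rewrite lee_fin exprn_ge0// ltW.
    exact: Zn_ge0.
  rewrite poweR_EFin lee_fin -powR_mulrn ?(ltW t0)// -powRrM natrM invfM mulrA.
  by rewrite mulfV ?pnatr_eq0// mul1r.
apply: ereal_sup_ubound; exists (n.+1 * size q)%N => //=.
by apply: leq_trans (leqnSn n) _; rewrite leq_pmulr.
Qed.

Section Divergence.
Context (lambda : nat -> R) (rho : R) (s : nat -> R) (xi : Sigma).
Context (lambda_ge1 : forall n, (1 <= n)%N -> 1 <= lambda n).
Context (rho_gt0 : 0 < rho).
Context (divergent : poincare phi psi xi lambda rho = +oo%E).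
Context (s_rho : decreases_to s rho).

(** A partial sum which is large at [rho] is large nearby by continuity. *)
Lemma poincare_cvg_pinfty : forall A : R, \forall j \near \oo,
  (A%:E <= poincare phi psi xi lambda (s j))%E.
Proof.
move=> A; have [s_gt _ s_cvg] := s_rho.
have b0 n : 0 <= weight lambda n by exact/ltW/weight_gt0.
pose z n := fine (Zn phi psi xi n).
have zE n : Zn phi psi xi n = (z n)%:E.
  rewrite fineK// ge0_fin_numE ?Zn_ge0//.
  by apply: le_lt_trans (Zn_le _ _) _; rewrite ltry.
pose part N (t : R) := \sum_(1 <= n < N) t ^- n * weight lambda n * z n.
have partE N t : (\sum_(1 <= n < N) (t ^- n * weight lambda n)%:E * Zn phi psi xi n =
    (part N t)%:E)%E.
  by rewrite /part -sumEFin; apply: eq_bigr => n _; rewrite zE.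
have part_le N t : 0 < t -> ((part N t)%:E <= poincare phi psi xi lambda t)%E.
  move=> t0; rewrite -partE; apply: nneseries_lim_ge => n _ _.
  by rewrite mule_ge0 ?Zn_ge0// lee_fin mulr_ge0// invr_ge0 exprn_ge0// ltW.
have [N NA] : exists N, A < part N rho.
  have : poincare phi psi xi lambda rho = +oo%E by [].
  rewrite /poincare => lim_oo.
  have cv : (fun N => (part N rho)%:E) @ \oo --> +oo%E.
    rewrite -[X in _ --> X]lim_oo.
    rewrite [X in X @ _ --> _](_ : _ = (fun N => \sum_(1 <= n < N)
       (rho ^- n * weight lambda n)%:E * Zn phi psi xi n)%E); last first.
      by apply/funext => N; rewrite partE.
    apply: is_cvg_nneseries => n _ _.
    by rewrite mule_ge0 ?Zn_ge0// lee_fin mulr_ge0// invr_ge0 exprn_ge0// ltW.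
  move/cvgeyPge : cv => /(_ (A + 1)) [N _ /(_ N (leqnn N))] /=.
  by rewrite lee_fin => h; exists N; apply: lt_le_trans h; rewrite ltrDl.
have part_cvg : (fun j => part N (s j)) @ \oo --> part N rho.
  rewrite /part; elim: (index_iota 1 N) => [|n l IHl].
    rewrite big_nil; under eq_fun do rewrite big_nil; exact: cvg_cst.
  rewrite big_cons; under eq_fun do rewrite big_cons.
  apply: cvgD => //; apply: cvgMl; apply: cvgMl.
  apply: cvgV; first by rewrite expf_neq0// gt_eqF.
  exact: cvg_exprn.
have [J _ JP] := cvgr_ge _ part_cvg _ NA; exists J => // j /JP jA.
apply: (@le_trans _ _ (part N (s j))%:E); first by rewrite lee_fin.
by apply: part_le; exact: lt_trans (s_gt j).
Qed.

End Divergence.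

End CriticalExponent.

(** * The measures of the fibers form an excessive function *)

Section Clopen.
Context (R : realType).

Lemma continuous_indic (T : topologicalType) (A : set T) :
  open A -> closed A -> continuous (\1_A : T -> R).
Proof.
move=> oA cA x; apply: cvg_near_cst; case: (pselect (A x)) => [Ax|nAx].
  have : nbhs x A by exact: open_nbhs_nbhs.
  by apply: filterS => y Ay; rewrite !indicE !mem_set.
have : nbhs x (~` A) by apply: open_nbhs_nbhs; split=> //; rewrite openC.
by apply: filterS => y Ay; rewrite !indicE !memNset.
Qed.

Context (W : countType) (M : transition_matrix W) (G : groupType).
Local Notation X := (shift_space M * discrete_group G)%type.

Lemma open_preimage_snd (A : set (discrete_group G)) : open ((@snd _ _ : X -> _) @^-1` A).
Proof.
by apply: open_comp => [z _|]; [exact: cvg_snd|exact: discrete_open].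
Qed.

Lemma closed_preimage_snd (A : set (discrete_group G)) :
  closed ((@snd _ _ : X -> _) @^-1` A).
Proof.
by rewrite -[X in closed X]setCK closedC preimage_setC; exact: open_preimage_snd.
Qed.

Lemma open_preimage_cylinder w : open ((@fst _ _ : X -> _) @^-1` cylinder M w).
Proof.
apply: open_comp => [z _|]; first exact: cvg_fst.
exact: open_letters (@cylinder_letters _ M w).
Qed.

Lemma closed_preimage_cylinder w : closed ((@fst _ _ : X -> _) @^-1` cylinder M w).
Proof.
apply: closed_comp => [z _|]; first exact: cvg_fst.
exact: closed_letters (@cylinder_letters _ M w).
Qed.

Lemma continuous_fiber (g : G) : continuous (\1_(fiber M g : set X) : X -> R).
Proof.
apply: continuous_indic.
  exact: (@open_preimage_snd [set g : discrete_group G]).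
exact: (@closed_preimage_snd [set g : discrete_group G]).
Qed.

Lemma continuous_ext_cylinder w (g : G) :
  continuous (\1_(ext_cylinder M w g : set X) : X -> R).
Proof.
apply: continuous_indic.
  apply: openI; first exact: open_preimage_cylinder.
  exact: (@open_preimage_snd [set g : discrete_group G]).
apply: closedI; first exact: closed_preimage_cylinder.
exact: (@closed_preimage_snd [set g : discrete_group G]).
Qed.

End Clopen.

Section Patterson.
Context (R : realType) (W : countType) (M : transition_matrix W) (G : groupType).
Local Notation Sigma := (shift_space M).
Local Notation X := (Sigma * discrete_group G)%type.
Context (phi : Sigma -> R) (psi : W -> G) (phi_gt0 : forall x, 0 < phi x).
Context (m : seq W -> R) (K : R) (mK : quasi_bernoulli M m K) (mkraft : kraft m).
Context (gibbs : forall w x, cylinder M w x ->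
  birkhoff_prod phi (size w) x <= K * m w /\
  m w <= K * birkhoff_prod phi (size w) x).
Context (connect : exists UU : seq (seq W),
  (forall U, U \in UU ->
     [/\ sorted M U, psi_word psi U = 1%g & (1 <= size U)%N]) /\
  forall p q, sorted M p -> sorted M q ->
        exists2 U, U \in UU & sorted M (p ++ U ++ q)).
Context (psi_onto : forall k, exists2 p, sorted M p & psi_word psi p = k).
Context (lambda : nat -> R) (rho : R) (s : nat -> R) (xi x0 : Sigma).
Context (lambda_div : divergence_weights phi psi xi rho lambda).
Context (rho_gt0 : 0 < rho) (s_rho : decreases_to s rho).
Context (nu0 : {measure set X -> \bar R}).
Context (nu0P : forall f : X -> R, continuous f -> (forall y, 0 <= f y) ->
    (exists B : R, forall y, f y <= B) ->
    (exists F : set G, finite_set F /\ forall y : X, ~ F y.2 -> f y = 0) ->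
    (fun k => (poincare phi psi xi lambda (s k))^-1 *
       \sum_(1 <= n <oo) (weight lambda n * s k ^- n)%:E *
          iter n (ext_transfer phi psi) (fun y => (f y)%:E) (x0, 1%g))%E @ \oo
      --> (\int[nu0]_y (f y)%:E)%E).
Implicit Types (u v w p q U V : seq W) (k g : G).

Local Notation b := (weight lambda).
Local Notation fsum := (fiber_sum phi psi b).

Let K0 : 0 <= K. Proof. by have [K1 _ _ _ _] := mK; exact: le_trans K1. Qed.
Let m0 w : 0 <= m w. Proof. by have [] := mK. Qed.
Let lge1 n : (1 <= n)%N -> 1 <= lambda n.
Proof. by have [h _ _ _ _] := lambda_div; exact: h. Qed.
Let lmono i j : (1 <= i)%N -> (i <= j)%N -> lambda j <= lambda i.
Proof. by have [_ h _ _ _] := lambda_div; exact: h. Qed.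
Let lcvg : lambda @ \oo --> (1 : R).
Proof. by have [] := lambda_div. Qed.
Let b0 n : 0 < b n. Proof. exact: weight_gt0. Qed.
Let bm i j : (i <= j)%N -> b i <= b j. Proof. exact: weight_mono. Qed.
Let br l : exists N, forall n, (N <= n)%N -> b (n + l) <= 2 * b n.
Proof. exact: weight_ratio. Qed.
Let sgt j : rho < s j. Proof. by have [] := s_rho. Qed.
Let s0 j : 0 < s j. Proof. exact: lt_trans (sgt j). Qed.
Let sle j : s j <= s 0%N. Proof. by have [_ h _] := s_rho; exact: h. Qed.

Let p j : R := fine (poincare phi psi xi lambda (s j)).

Let poincareE j : poincare phi psi xi lambda (s j) = fsum (s j) xi 1%g.
Proof. by []. Qed.

Let pE j : poincare phi psi xi lambda (s j) = (p j)%:E.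
Proof.
rewrite /p fineK// ge0_fin_numE ?poincareE; last exact: fiber_sum_ge0.
by have [_ _ _ _ h] := lambda_div; exact: h.
Qed.

Let p0 j : 0 < p j.
Proof.
rewrite -lte_fin -pE poincareE.
exact: (fiber_sum_gt0 phi_gt0 mK gibbs connect b0).
Qed.

Let p_cvg : (fun j => (p j)^-1) @ \oo --> (0 : R).
Proof.
have [_ _ _ div _] := lambda_div.
apply/gtr0_cvgV0; first exact: nearW.
apply/cvgryPge => A.
have := poincare_cvg_pinfty phi_gt0 mK mkraft gibbs lge1 rho_gt0
  (div rho rho_gt0 (lexx _)) s_rho A.
by apply: filterS => j; rewrite pE lee_fin.
Qed.

Let inv_p j : ((poincare phi psi xi lambda (s j))^-1 = ((p j)^-1)%:E)%E.
Proof. by rewrite pE inver gt_eqF. Qed.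

Let fiber_cvg k : (fun j => ((p j)^-1)%:E * fsum (s j) x0 k)%E @ \oo -->
  nu0 (fiber M k).
Proof.
have mf : measurable (fiber M k : set X).
  rewrite (_ : fiber M k = (@snd _ _ : X -> _) @^-1` [set k])//.
  by rewrite -[X in measurable X]setTI; exact: measurable_snd.
have -> : nu0 (fiber M k) = (\int[nu0]_y (\1_(fiber M k) y)%:E)%E.
  by rewrite integral_indic// setIT.
rewrite [X in X @ _ --> _](_ : _ = (fun j => (poincare phi psi xi lambda (s j))^-1 *
       \sum_(1 <= n <oo) (weight lambda n * s j ^- n)%:E *
          iter n (ext_transfer phi psi) (fun y => (\1_(fiber M k) y)%:E) (x0, 1%g))%E).
  apply: nu0P => //.
  - exact: continuous_fiber.
  - by exists 1 => y; rewrite indicE; case: (_ \in _).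
  - exists [set k]; split=> // y yk; rewrite indicE memNset//.
apply/funext => j; rewrite inv_p; congr (_ * _)%E; congr (limn _).
by apply/funext => N; apply: eq_bigr => n _; rewrite [in RHS]mulrC.
Qed.

Definition fiber_mass k := fine (nu0 (fiber M k)).

Lemma fiber_mass_ge0 k : 0 <= fiber_mass k.
Proof. by rewrite fine_ge0. Qed.

Let ratio j k := (p j)^-1 * fine (fsum (s j) x0 k).

Let fsum_fin j k : fsum (s j) x0 k \is a fin_num.
Proof.
have [B _ BP] := fiber_sum_bound phi_gt0 mK gibbs connect b0 bm psi_onto xi k (s0 0%N).
rewrite ge0_fin_numE; last exact: fiber_sum_ge0.
apply: le_lt_trans (BP _ x0 (s0 j) (sle j)) _.
by rewrite -poincareE pE -EFinM ltry.
Qed.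

Let ratioE j k : (((p j)^-1)%:E * fsum (s j) x0 k = (ratio j k)%:E)%E.
Proof. by rewrite /ratio EFinM fineK. Qed.

Lemma fiber_massE k : nu0 (fiber M k) = (fiber_mass k)%:E.
Proof.
have [B B0 BP] := fiber_sum_bound phi_gt0 mK gibbs connect b0 bm psi_onto xi k (s0 0%N).
rewrite /fiber_mass fineK// ge0_fin_numE//.
apply: (@le_lt_trans _ _ B%:E); last by rewrite ltry.
apply: (cvge_to_le (@fiber_cvg k)); apply: nearW => j.
apply: (@le_trans _ _ (((p j)^-1)%:E * (B%:E * fsum (s j) xi 1%g))%E).
  by apply: lee_wpmul2l; [rewrite lee_fin invr_ge0 ltW|exact: BP].
by rewrite -poincareE pE -!EFinM lee_fin mulrCA mulVf ?mulr1// gt_eqF.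
Qed.

Let ratio_cvg k : (fun j => ratio j k) @ \oo --> fiber_mass k.
Proof.
have := @fiber_cvg k; rewrite fiber_massE => /fine_cvg.
by under eq_fun do rewrite /= ratioE /=.
Qed.

Let pow_cvg n : (fun j => s j ^- n) @ \oo --> rho ^- n.
Proof.
have [_ _ s_cvg] := s_rho.
apply: cvgV; first by rewrite expf_neq0// gt_eqF.
exact: cvg_exprn.
Qed.

(** The inequalities between the series pass to the limit since [E] is a finite
    set. *)
Lemma fiber_mass_excessive : exists C, excessive M psi m rho C fiber_mass.
Proof.
have [C CP] := fiber_sum_excessive phi_gt0 mK gibbs connect b0 bm (s0 0%N).
exists C => E k uE sE aE.
have cvgl : (fun j => \sum_(w <- E) m w * (s j ^- size w * ratio j (psi_word psi w * k)%g))
    @ \oo --> \sum_(w <- E) m w * (rho ^- size w * fiber_mass (psi_word psi w * k)%g).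
  elim: E {uE sE aE} => [|w E IHE].
    rewrite big_nil; under eq_fun do rewrite big_nil; exact: cvg_cst.
  rewrite big_cons; under eq_fun do rewrite big_cons.
  apply: cvgD => //; apply: cvgM; first exact: cvg_cst.
  by apply: cvgM; [exact: pow_cvg|exact: ratio_cvg].
have cvgr : (fun j => C * ratio j k) @ \oo --> C * fiber_mass k.
  by apply: cvgM; [exact: cvg_cst|exact: ratio_cvg].
apply: ler_cvg_to cvgl cvgr _; apply: nearW => j.
have := CP (s j) x0 k E (s0 j) (sle j) uE sE aE.
have -> : (\sum_(w <- E) (m w * s j ^- size w)%:E * fsum (s j) x0 (psi_word psi w * k)%g =
  (\sum_(w <- E) (m w * s j ^- size w) * fine (fsum (s j) x0 (psi_word psi w * k)%g))%:E)%E.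
  by rewrite -sumEFin; apply: eq_bigr => w _; rewrite [in RHS]EFinM fineK.
rewrite -[in X in (_ <= X)%E](fineK (fsum_fin j k)) -EFinM lee_fin => h.
have -> : \sum_(w <- E) m w * (s j ^- size w * ratio j (psi_word psi w * k)%g) =
  (p j)^-1 * \sum_(w <- E) (m w * s j ^- size w) * fine (fsum (s j) x0 (psi_word psi w * k)%g).
  by rewrite mulr_sumr; apply: eq_bigr => w _; rewrite /ratio; ring.
rewrite /ratio mulrCA; apply: ler_wpM2l h.
by rewrite invr_ge0 ltW.
Qed.

Lemma fiber_mass_map (f : seq W -> seq W) (B : R) : 0 <= B ->
  injective f -> (forall q, size (f q) = size q) ->
  (forall q, sorted M q -> sorted M (f q) /\ m q <= B * m (f q)) ->
  exists2 C, 0 <= C & forall k k',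
  (forall q, psi_word psi q = k^-1 -> psi_word psi (f q) = k'^-1)%g ->
  fiber_mass k <= C * fiber_mass k'.
Proof.
move=> B0 finj fsize fm.
have [C C0 CP] := fiber_sum_map phi_gt0 mK gibbs connect b0 bm B0 finj fsize fm (s0 0%N).
exists C => // k k' fk.
have cvgr : (fun j => C * ratio j k') @ \oo --> C * fiber_mass k'.
  by apply: cvgM; [exact: cvg_cst|exact: ratio_cvg].
apply: ler_cvg_to (@ratio_cvg k) cvgr _; apply: nearW => j.
have := CP (s j) x0 x0 k k' (s0 j) (sle j) fk.
rewrite -[X in (X <= _)%E](fineK (fsum_fin j k)).
rewrite -[X in (_ <= _ * X)%E](fineK (fsum_fin j k')).
rewrite -EFinM lee_fin => h; rewrite /ratio mulrCA; apply: ler_wpM2l h.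
by rewrite invr_ge0 ltW.
Qed.

(** The summand [B] in [cylinder_sum_le] disappears in the limit because the
    Poincare series diverges at [rho]. *)
Lemma ext_cylinder_mass w g :
  (nu0 (ext_cylinder M w g) <=
    (2 * K ^+ 3 * m w * (rho ^- size w * fiber_mass (g * psi_word psi w)%g))%:E)%E.
Proof.
have [B BP] := cylinder_sum_le psi phi_gt0 mK mkraft gibbs b0 br w g rho_gt0.
have mc : measurable (ext_cylinder M w g : set X).
  by apply: measurableX => //; exact: measurable_cylinder.
have cvgl : (fun j => ((p j)^-1)%:E * cylinder_sum phi psi b (s j) x0 w g)%E @ \oo -->
    nu0 (ext_cylinder M w g).
  have -> : nu0 (ext_cylinder M w g) = (\int[nu0]_y (\1_(ext_cylinder M w g) y)%:E)%E.
    by rewrite integral_indic// setIT.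
  rewrite [X in X @ _ --> _](_ : _ = (fun j => (poincare phi psi xi lambda (s j))^-1 *
       \sum_(1 <= n <oo) (weight lambda n * s j ^- n)%:E *
          iter n (ext_transfer phi psi) (fun y => (\1_(ext_cylinder M w g) y)%:E) (x0, 1%g))%E).
    apply: nu0P => //.
    - exact: continuous_ext_cylinder.
    - by exists 1 => y; rewrite indicE; case: (_ \in _).
    - by exists [set g]; split=> // y yk; rewrite indicE memNset// => -[].
  apply/funext => j; rewrite inv_p; congr (_ * _)%E; congr (limn _).
  by apply/funext => N; apply: eq_bigr => n _; rewrite [in RHS]mulrC.
pose c := 2 * K ^+ 3 * m w.
have cvgr : (fun j => ((p j)^-1 * B + c * (s j ^- size w * ratio j (g * psi_word psi w)%g))%:E)
    @ \oo --> (0 * B + c * (rho ^- size w * fiber_mass (g * psi_word psi w)%g))%:E.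
  apply: cvg_EFin; first exact: nearW.
  apply: cvgD; first by apply: cvgM => //; exact: cvg_cst.
  apply: cvgM; first exact: cvg_cst.
  by apply: cvgM; [exact: pow_cvg|exact: ratio_cvg].
rewrite mul0r add0r in cvgr.
apply: lee_cvg_to cvgl cvgr _; apply: nearW => j.
have := BP (s j) x0 (ltW (sgt j)).
rewrite -[fiber_sum _ _ _ _ _ _]fineK// -EFinM -EFinD => h.
apply: le_trans (lee_wpmul2l _ h) _; first by rewrite lee_fin invr_ge0 ltW.
rewrite -EFinM lee_fin mulrDr lerD2l /ratio /c.
by rewrite le_eqVlt; apply/orP; left; apply/eqP; ring.
Qed.

End Patterson.

(** * Almost sure convergence *)

Section FirstPassage.
Context (R : realType) (W : countType) (d : measure_display).
Context (T : measurableType d) (mu : {measure set T -> \bar R}).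
Context (D : set T) (cur : T -> nat -> seq W) (A : seq W -> set T).
Context (mm : seq W -> R) (bad : set (seq W)).
Context (cur_size : forall t k, size (cur t k) = k).
Context (cur_suffix : forall t j k, (j <= k)%N -> suffix (cur t j) (cur t k)).
Context (cur_A : forall t k, D t -> (0 < k)%N -> A (cur t k) t).
Context (mA : forall w, measurable (A w)).
Context (muA : forall w, w <> [::] -> bad w -> (mu (A w) <= (mm w)%:E)%E).
Context (mm_small : forall e : R, 0 < e -> exists n, forall E : seq (seq W), uniq E ->
  suffix_free E -> (forall w, w \in E -> bad w /\ (n <= size w)%N) ->
  \sum_(w <- E) mm w <= e).

Let cur_unique t k v : suffix v (cur t k) -> v = cur t (size v).
Proof.
move=> vk; have := size_suffix vk; rewrite cur_size => /(cur_suffix t) vk'.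
move: vk vk'; rewrite !suffixE !cur_size => /eqP h1 /eqP h2.
exact: etrans (esym h1) h2.
Qed.

(** The words at the first time after [n] at which a bad word is seen form a
    suffix-free set. *)
Lemma infinitely_often_negligible :
  mu.-negligible [set t | D t /\ forall n, exists2 k, (n <= k)%N & bad (cur t k)].
Proof.
set Z := mkset _.
have small (e : R) : 0 < e ->
    exists B, [/\ measurable B, Z `<=` B & (mu B <= e%:E)%E].
  move=> e0; have [n nP] := mm_small e0.
  (* The count starts after n in order to exclude the empty word. *)
  pose first (w : seq W) := [/\ bad w, (n < size w)%N &
    forall v, suffix v w -> (n < size v)%N -> bad v -> v = w].
  pose F j := if pickle_inv j is Some w then
    (if `[< first w >] then A w else set0) else set0.
  have mF j : measurable (F j).
    by rewrite /F; case: pickle_inv => [w|//]; case: asboolP.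
  have mB : measurable (\bigcup_j F j) by exact: bigcup_measurable.
  exists (\bigcup_j F j); split=> //.
    move=> t [Dt /(_ n.+1) [k0 nk0 bk0]].
    have ex : exists k, (n < k)%N && `[< bad (cur t k) >].
      by exists k0; rewrite nk0; exact/asboolP.
    case: (ex_minnP ex) => k /andP[nk /asboolP bk] kmin.
    have kfirst : first (cur t k).
      split; rewrite ?cur_size// => v vk nv bv.
      have vE := cur_unique vk; rewrite [RHS](_ : _ = cur t (size v))//.
      congr (cur t _); apply/eqP; rewrite eqn_leq.
      have -> : (size v <= k)%N by have := size_suffix vk; rewrite cur_size.
      by rewrite andbT; apply: kmin; rewrite nv -vE; exact/asboolP.
    exists (pickle (cur t k)) => //; rewrite /F pickleK_inv.
    by rewrite asboolT//; apply: cur_A => //; exact: leq_trans nk.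
  apply: le_trans (measure_sigma_subadditive _ mF mB (fun _ h => h)) _.
  apply: lime_le; first by apply: is_cvg_nneseries => j _ _; exact: measure_ge0.
  apply: nearW => N.
  pose E := [seq w <- pmap (@pickle_inv (seq W)) (iota 0 N) | `[< first w >]].
  have EP w : w \in E -> first w by rewrite mem_filter => /andP[/asboolP].
  apply: (@le_trans _ _ (\sum_(w <- E) (mm w)%:E)%E); last first.
    rewrite sumEFin lee_fin; apply: nP.
    - rewrite filter_uniq// (@pmap_uniq _ _ _ (@pickle _)) ?iota_uniq//.
      exact: pickle_invK.
    - move=> u v /EP[bu nu _] /EP[_ _ h] uv; exact: h.
    - by move=> w /EP[bw nw _]; split=> //; exact: ltnW.
  rewrite /E big_filter /index_iota subn0.
  elim: (iota 0 N) => [|j l IHl]; first by rewrite big_nil /= big_nil.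
  rewrite big_cons /= {1}/F; case: pickle_inv => [w|] /=; last by rewrite measure0 add0e.
  rewrite big_cons; case: asboolP => [[bw nw _]|_]; last by rewrite measure0 add0e.
  by apply: leeD => //; apply: muA => // w0; rewrite w0 in nw.
have /choice [B BP] (i : nat) : exists B, [/\ measurable B, Z `<=` B &
    (mu B <= (i.+1%:R^-1)%:E)%E].
  by apply: small; rewrite invr_gt0.
have mI : measurable (\bigcap_i B i).
  by apply: bigcap_measurable => // i _; have [] := BP i.
exists (\bigcap_i B i); split=> //; last by move=> t Zt i _; have [_ + _] := BP i; apply.
apply/eqP; rewrite eq_le measure_ge0 andbT; apply/lee_addgt0Pr => e e0; rewrite add0e.
have [i ie] : exists i : nat, i.+1%:R^-1 < e.
  exists (Num.bound e^-1); rewrite invf_plt ?posrE//.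
  by apply: lt_trans (archi_boundP _) _; rewrite ?invr_ge0 ?ltW// ltr_nat.
have [mBi _ Be] := BP i.
apply: (@le_trans _ _ (mu (B i))); last by apply: le_trans Be _; rewrite lee_fin ltW.
by apply: le_measure; rewrite ?inE// => t; exact.
Qed.

End FirstPassage.

(** Convergence to zero off a null set reduces to the infinitely frequent
    occurrence of values above one of countably many levels. *)
Lemma negligible_not_cvg0 d (T : measurableType d) (R : realType)
    (mu : {measure set T -> \bar R}) (D : set T) (u : T -> nat -> R) :
  (forall t n, 0 <= u t n) ->
  (forall e : R, 0 < e ->
     mu.-negligible [set t | D t /\ forall n, exists2 k, (n <= k)%N & e < u t k]) ->
  mu.-negligible [set t | D t /\ ~ (u t @ \oo --> (0 : R))].
Proof.
move=> u0 ueps.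
have inv0 (i : nat) : 0 < i.+1%:R^-1 :> R by rewrite invr_gt0.
apply: negligibleS (negligible_bigcup (fun i => ueps _ (inv0 i))).
move=> t [Dt ncvg]; apply: contrapT => nbad; apply: ncvg.
apply/cvgr0Pnorm_le => e e0.
have [i ie] : exists i : nat, i.+1%:R^-1 < e.
  exists (Num.bound e^-1); rewrite invf_plt ?posrE//.
  by apply: lt_trans (archi_boundP _) _; rewrite ?invr_ge0 ?ltW// ltr_nat.
have [n nP] : exists n, forall k, (n <= k)%N -> ~ (i.+1%:R^-1 < u t k).
  apply: contrapT => nn; apply: nbad; exists i => //; split=> // n.
  apply: contrapT => nk; apply: nn; exists n => k nk' ik; apply: nk; by exists k.
exists n => // k /= /nP /negP; rewrite -leNgt => uk.
by rewrite ger0_norm//; apply: le_trans uk (ltW ie).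
Qed.

(** * The natural extension *)

Section MuG.
Context (R : realType) (W : countType) (M : transition_matrix W) (G : groupType).
Local Notation Sigma := (shift_space M).
Local Notation X := (Sigma * discrete_group G)%type.
Context (mu : probability Sigma R).

Lemma mu_G_graph (P : set Sigma) (h : Sigma -> discrete_group G) : measurable P ->
  mu_G G mu [set z : X | P z.1 /\ z.2 = h z.1] = mu P.
Proof.
move=> mP; rewrite /mu_G /product_measure1.
rewrite -[in RHS](setIT P) -integral_indic//; apply: eq_integral => x _ /=.
rewrite indicE; case: (boolP (x \in P)) => [/set_mem Px|/negP nPx].
  rewrite (_ : xsection _ x = [set h x]).
    rewrite /counting asboolT; last exact: finite_set1.
    by rewrite fset_set1 finmap.cardfs1.
  rewrite predeqE => g; split=> [/xsectionP[]//|->].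
  by rewrite /xsection /= inE.
rewrite (_ : xsection _ x = set0).
  by rewrite measure0.
rewrite -subset0 => g /xsectionP [/= Px _]; apply: nPx; exact/mem_set.
Qed.

Lemma mu_G_ext_cylinder w (g : G) : mu_G G mu (ext_cylinder M w g) = mu (cylinder M w).
Proof.
rewrite -(@mu_G_graph _ (fun=> g))//; last exact: measurable_cylinder.
Qed.

(** Apply the invariance under the extension to [A `*` [set 1%g]], whose preimage
    is a graph over the preimage of [A]. *)
Lemma shift_invariant (psi : W -> G) : ext_invariant psi (mu_G G mu) ->
  forall (A : set Sigma) n,
  (forall x y : Sigma, (forall k, (k < n)%N -> x k = y k) -> A x -> A y) ->
  mu (@theta W M @^-1` A) = mu A.
Proof.
move=> inv A n An.
have mA := measurable_letters An.
have mtA : measurable (@theta W M @^-1` A).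
  apply: (@measurable_letters _ _ _ n.+1) => x y xy /=; apply: An => k kn.
  exact: xy.
rewrite -(@mu_G_graph _ (fun=> 1%g) mA) -inv; last first.
  by rewrite (_ : mkset _ = A `*` [set 1%g])//; exact: measurableX.
rewrite -(@mu_G_graph _ (fun x => (psi (x 0%N))^-1%g) mtA); congr mu_G.
rewrite predeqE => -[x g] /=; split=> -[Ax gx]; split=> //.
  by rewrite gx mulVg.
by apply/eqP; rewrite -mulg_eq1// gx.
Qed.

End MuG.

Section Past.
Context (W : countType) (M : transition_matrix W) (G : groupType) (psi : W -> G).
Local Notation Y := (natural_space M psi).
Implicit Types (y : Y) (w : seq W) (g : G).

Lemma measurable_coord (i : int) (c : W * G) : measurable [set y : Y | y i = c].
Proof.
apply: sub_sigma_algebra.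
exists ((@^~ i : {ptws int -> discrete_topology (W * G)%type} -> _) @^-1` [set c]) => //.
apply: open_comp; last exact: discrete_open.
move=> f _; exact: (@proj_continuous int (fun=> discrete_topology (W * G)%type) i).
Qed.

(** The past is [w] and the present group coordinate is [g].  The latter is
    expressed through the coordinate before [w], since [natural_extension] speaks
    of words which start at a given coordinate. *)
Definition past_cylinder g w : set Y :=
  [set y : Y | mkseq (fun j => y (- (size w)%:Z + j%:Z)) (size w) =
    lift_word psi (g * (psi_word psi w)^-1)%g w].

Lemma size_lift_word g w : size (lift_word psi g w) = size w.
Proof. by elim: w g => //= v w IHw g; rewrite IHw. Qed.

Lemma measurable_past_cylinder g w : measurable (past_cylinder g w).
Proof.
set l := lift_word psi (g * (psi_word psi w)^-1)%g w.
have [|w0] := eqVneq (size w) 0%N.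
  move=> /size0nil w0; rewrite (_ : past_cylinder g w = setT)//.
  by rewrite predeqE => y; rewrite /past_cylinder w0.
case: w w0 @l => // v w _ l.
rewrite (_ : past_cylinder g (v :: w) = \bigcap_(j in `I_(size (v :: w)))
    [set y : Y | y (- (size (v :: w))%:Z + j%:Z) = nth (v, g) l j]).
  apply: fin_bigcap_measurable => [|j _]; last exact: measurable_coord.
  exact: finite_II.
rewrite predeqE => y; split=> [yl j /= jw|yl].
  by rewrite -[l]yl nth_mkseq.
apply: (@eq_from_nth _ (v, g)); rewrite size_mkseq; first by rewrite size_lift_word.
by move=> j jw; rewrite nth_mkseq//; exact: yl.
Qed.

Lemma coords_lift_word y (i : int) n :
  mkseq (fun j => y (i + j%:Z)) n = lift_word psi (y i).2 (mkseq (fun j => (y (i + j%:Z)).1) n) /\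
  (y (i + n%:Z)).2 = ((y i).2 * psi_word psi (mkseq (fun j => (y (i + j%:Z)).1) n))%g.
Proof.
elim: n i => [|n IHn] i; first by rewrite addr0 /psi_word big_nil mulg1.
have E (T : Type) (f : int -> T) :
    mkseq (fun j => f (i + j%:Z)) n.+1 = f i :: mkseq (fun j => f (i + 1 + j%:Z)) n.
  rewrite /mkseq /= addr0; congr cons; rewrite -[1%N]addn0 iotaDl -map_comp.
  by apply: eq_map => j /=; rewrite PoszD addrA.
have [h1 h2] := IHn (i + 1).
rewrite (E _ (fun i => y i)) (E _ (fun i => (y i).1)) /=.
have [_ yg] := coordsP y i.
split; first by rewrite -yg -h1; case: (y i).
rewrite -addn1 addnC PoszD addrA h2 yg.
by rewrite -cat1s psi_word_cat psi_word1 mulgA.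
Qed.

Lemma pastE y n : past y n = mkseq (fun j => (y (- n%:Z + j%:Z)).1) n.
Proof. by apply: eq_map => j; rewrite addrC. Qed.

Lemma past_cylinderP y n : past_cylinder (y 0).2 (past y n) y.
Proof.
rewrite /past_cylinder /= pastE size_mkseq.
have [h1 h2] := coords_lift_word y (- n%:Z) n.
by rewrite addNr in h2; rewrite h2 mulgK.
Qed.

Lemma size_past y n : size (past y n) = n.
Proof. exact: size_mkseq. Qed.

Lemma past_sorted y n : sorted M (past y n).
Proof.
apply/(sortedP (y 0).1) => j; rewrite size_past => jn.
rewrite pastE !nth_mkseq//; last exact: ltnW.
have [h _] := coordsP y (- n%:Z + j%:Z).
by rewrite -addn1 PoszD addrA.
Qed.

Lemma past_suffix y j k : (j <= k)%N -> suffix (past y j) (past y k).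
Proof.
move=> jk; rewrite suffixE !size_past; apply/eqP.
apply: (@eq_from_nth _ (y 0).1); rewrite size_drop !size_past ?subKn// => i ij.
rewrite nth_drop !pastE !nth_mkseq//; last by rewrite -ltn_subRL subKn.
by congr (y _).1; rewrite PoszD -subzn//; ring.
Qed.

End Past.

(** * Convergence along almost every past and almost every path *)

Section AlmostSure.
Context (R : realType) (W : countType) (M : transition_matrix W) (G : groupType).
Local Notation Sigma := (shift_space M).
Context (psi : W -> G) (mu : probability Sigma R) (rho : R) (H : G -> R).
Context (rho_gt0 : 0 < rho) (H0 : forall k, 0 <= H k).
Local Notation m := (weight_of mu).
Local Notation sc := (scaled psi rho H).
Context (small : forall d e : R, 0 < d -> 0 < e -> exists n,
  forall E : seq (seq W), uniq E -> suffix_free E ->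
  (forall w, w \in E -> [/\ sorted M w, (n <= size w)%N & d < sc w]) ->
  \sum_(w <- E) m w <= e).
Implicit Types (u v w p q : seq W) (g : G).

Let sc0 w : 0 <= sc w.
Proof. by rewrite /scaled mulr_ge0// invr_ge0 exprn_ge0// ltW. Qed.

(** Given the present group coordinate [g], the event of a past [w] has measure
    [m w], so that the estimates apply on each of countably many pieces. *)
Lemma past_scaled_cvg0 (muhat : {measure set (natural_space M psi) -> \bar R}) :
  countable [set: G] -> natural_extension (mu_G G mu) muhat ->
  muhat.-negligible [set y | ~ ((fun n => sc (past y n)) @ \oo --> (0 : R))].
Proof.
move=> Gc [_ hat].
have fixed g : muhat.-negligible [set y : natural_space M psi | (y 0).2 = g /\
    ~ ((fun n => sc (past y n)) @ \oo --> (0 : R))].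
  apply: (@negligible_not_cvg0 _ _ _ muhat [set y : natural_space M psi | (y 0).2 = g]
    (fun y n => sc (past y n))) => [y n|e e0]; first exact: sc0.
  have := @infinitely_often_negligible _ _ _ _ muhat
    [set y : natural_space M psi | (y 0).2 = g] (fun y k => past y k)
    (@past_cylinder _ M _ psi g) m [set w | sorted M w /\ e < sc w].
  move=> /(_ (@size_past _ _ _ _) (@past_suffix _ _ _ _)) io.
  apply: negligibleS (io _ _ _ _).
  - move=> y [yg yio]; split=> // n; have [k nk ek] := yio n; exists k => //.
    by split=> //; exact: past_sorted.
  - by move=> y k <- _; exact: past_cylinderP.
  - by move=> w; exact: measurable_past_cylinder.
  - move=> w w0 [ws _]; rewrite /past_cylinder hat; last first.
      by rewrite /admissible ws andbT; exact/eqP.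
    by rewrite mu_G_ext_cylinder mu_cylinderE.
  - move=> e' e'0; have [n nP] := small e0 e'0; exists n => E uE sE EP.
    by apply: nP => // w /EP[[]].
have /countable_injP [f finj] := Gc.
apply: (@negligibleS _ _ _ _ (\bigcup_n [set y : natural_space M psi |
    f (y 0).2 = n /\ ~ ((fun n => sc (past y n)) @ \oo --> (0 : R))])).
  by move=> y ny; exists (f ((y : natural_space M psi) 0).2).
apply: negligible_bigcup => n.
have [[g gn]|nog] := pselect (exists g, f g = n).
  apply: negligibleS (fixed g) => y [yn ny]; split=> //.
  by apply: finj; rewrite ?inE// yn gn.
apply: negligibleS (negligible_set0 _) => y [yn _]; apply: nog.
by exists ((y : natural_space M psi) 0).2.
Qed.

Context (dag : W -> W) (dagK : forall a, dag (dag a) = a).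
Context (dagM : forall a b, M a b = M (dag b) (dag a)).
Context (psi_dag : forall a, psi (dag a) = (psi a)^-1%g).

Lemma psi_word_dag w : psi_word psi (map dag w) = (psi_word psi (rev w))^-1%g.
Proof.
elim: w => [|v w IHw]; first by rewrite /psi_word !big_nil invg1.
rewrite /= -cat1s psi_word_cat psi_word1 IHw rev_cons -cats1 psi_word_cat.
by rewrite psi_word1 psi_dag invgM.
Qed.

Lemma sorted_dag w : sorted M (map dag w) = sorted M (rev w).
Proof.
rewrite rev_sorted sorted_map; apply: eq_sorted => v u.
by rewrite [RHS]dagM.
Qed.

Context (B C : R) (B0 : 0 < B) (C0 : 0 < C).
Context (m_dag : forall w, sorted M w -> m w <= B * m (rev (map dag w))).
Context (H_inv : forall k : G, H k <= C * H k^-1%g).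

(** The involution reverses words and turns the one-sided sequence into a past,
    to which the estimates for suffix-free sets apply. *)
Lemma path_scaled_cvg0 :
  mu.-negligible [set x : Sigma | ~ ((fun n => sc (mkseq x n)) @ \oo --> (0 : R))].
Proof.
have := @negligible_not_cvg0 _ _ _ mu setT
  (fun (x : Sigma) n => sc (mkseq x n)) (fun _ _ => sc0 _).
move=> neg; apply: negligibleS (neg _) => [x nx|e e0]; first by split.
have := @infinitely_often_negligible _ _ _ _ mu setT (fun (x : Sigma) n => rev (mkseq x n))
    (fun w => cylinder M (rev w)) (fun w => m (rev w))
    [set w | sorted M (rev w) /\ e < sc (rev w)] => io.
apply: negligibleS (io _ _ _ _ _ _).
- move=> x [_ xio]; split=> // n; have [i ni ei] := xio n; exists i => //.
  by rewrite /= revK; split=> //; exact: sorted_mkseq.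
- by move=> x i; rewrite size_rev size_mkseq.
- move=> x i j ij; rewrite suffix_rev prefixE size_mkseq /mkseq -map_take.
  by rewrite take_iota (minn_idPl ij).
- by move=> x i _ _; rewrite revK /cylinder /= size_mkseq.
- by move=> w; exact: measurable_cylinder.
- by move=> w _ _; rewrite -mu_cylinderE.
- move=> e' e'0; have [n nP] := small (divr_gt0 e0 C0) (divr_gt0 e'0 B0).
  exists n => E uE sE EP.
  have dinj : injective (map dag) by apply: inj_map; exact: can_inj dagK.
  apply: (@le_trans _ _ (\sum_(w <- map (map dag) E) B * m w)).
    rewrite big_map big_seq [leRHS]big_seq; apply: ler_sum => w wE.
    have [[ws _] _] := EP _ wE.
    by rewrite -[X in B * m X]revK -map_rev; exact: m_dag.
  rewrite -mulr_sumr mulrC -ler_pdivlMr//; apply: nP.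
  - by rewrite map_inj_uniq.
  - move=> _ _ /mapP [u uE' ->] /mapP [v vE ->] /suffixP [t tE].
    congr (map dag _); apply: sE => //; apply/suffixP; exists (map dag t).
    apply: dinj; rewrite map_cat -map_comp tE; congr (_ ++ _).
    by rewrite -[LHS]map_id; apply: eq_map => z /=; rewrite dagK.
  - move=> _ /mapP [w /EP [[ws we] nw] ->].
    split; [by rewrite sorted_dag|by rewrite size_map|].
    rewrite ltr_pdivrMr//; apply: lt_le_trans we _.
    rewrite /scaled psi_word_dag size_rev size_map -mulrA ler_wpM2l//.
      by rewrite invr_ge0 exprn_ge0// ltW.
    by rewrite [leRHS]mulrC; exact: H_inv.
Qed.

End AlmostSure.

(** * The limits for the fibers and for the cylinders *)

Lemma cvge0_le (R : realType) (u : nat -> \bar R) (v : nat -> R) (c : R) :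
  (forall n, 0 <= u n)%E -> (forall n, u n <= (c * v n)%:E)%E ->
  v @ \oo --> (0 : R) -> u @ \oo --> 0%E.
Proof.
move=> u0 uv v0; apply: (@squeeze_cvge _ _ _ _ (fun=> 0%E) u (fun n => (c * v n)%:E)).
- by apply: nearW => n; rewrite u0 uv.
- exact: cvg_cst.
- apply: cvg_EFin; first exact: nearW.
  by rewrite -(mulr0 c); apply: cvgM => //; exact: cvg_cst.
Qed.

(** A single word with value [g] is a suffix-free set. *)
Lemma excessive_translate (R : realType) (W : countType) (M : transition_matrix W)
    (G : groupType) (psi : W -> G) (m : seq W -> R) (K rho C : R) (H : G -> R) :
  quasi_bernoulli M m K -> 0 < rho -> excessive M psi m rho C H ->
  (forall k, 0 <= H k) -> (forall k, exists2 p, sorted M p & psi_word psi p = k) ->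
  forall g, exists2 c, 0 <= c & forall k, H (g * k)%g <= c * H k.
Proof.
move=> [_ _ mgt0 _ _] rho0 Hexc H0 onto g; have [p ps pg] := onto g.
have mp := mgt0 _ ps; have rp : 0 < rho ^- size p by rewrite invr_gt0 exprn_gt0.
exists (`|C| / (m p * rho ^- size p)) => [|k].
  by rewrite divr_ge0// mulr_ge0// ltW.
have := Hexc [:: p] k isT; rewrite big_seq1 pg => /(_ _ _) h.
rewrite mulrAC ler_pdivlMr ?mulr_gt0// mulrC -mulrA; apply: le_trans (h _ _) _.
- by move=> u v; rewrite !inE => /eqP -> /eqP ->.
- by move=> w; rewrite inE => /eqP ->.
- by rewrite ler_wpM2r// ler_norm.
Qed.

Theorem corollary6p3 (R : realType) (W : countType) (M : transition_matrix W)
    (G : groupType) (phi : shift_space M -> R) (psi : W -> G)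
    (mu : probability (shift_space M) R)
    (xi : shift_space M) (rho : R) (lambda : nat -> R) (s : nat -> R)
    (nu : shift_space M * discrete_group G ->
          {measure set (shift_space M * discrete_group G) -> \bar R})
    (xi0 : shift_space M * discrete_group G)
    (muhat : {measure set (natural_space M psi) -> \bar R})
    (G_countable : countable [set: G])
    (phi_gt0 : forall x, 0 < phi x)
    (M_bip : bip M)
    (phi_holder : locally_holder (fun x => ln (phi x)))
    (phi_pressure : forall a : W, pressure phi a = 0%E)
    (mu_conformal : conformal phi mu)
    (mu_gibbs_markov : gibbs_markov mu)
    (psi_transitive : ext_transitive M psi)
    (rhoE : rho%:E = growth_rate phi psi xi)
    (prop_C : property_C phi psi xi rho lambda)
    (s_rho : decreases_to s rho)
    (nuP : patterson_family phi psi xi lambda s nu)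
    (xi0_id : fiber M 1%g xi0)
    (muhatP : natural_extension (mu_G G mu) muhat)
    (rho_lt1 : rho < 1)
    (mu_G_invariant : ext_invariant psi (mu_G G mu)) :
  let nu_o := nu xi0 in
  {ae muhat, forall y : natural_space M psi,
     ((fun n => nu_o (fiber M ((y 0%R).2 * psi_word psi (past y n))%g)
                / (rho ^+ n)%:E)%E @ \oo --> 0%E) /\
     ((fun n => nu_o (ext_cylinder M (past y n) (y 0%R).2)
                / mu (cylinder M (past y n)))%E @ \oo --> 0%E)} /\
  (symmetric_extension phi psi ->
   {ae mu, forall x : shift_space M,
     ((fun n => nu_o (fiber M (psi_n psi n x)) / (rho ^+ n)%:E)%E
        @ \oo --> 0%E) /\
     forall g : G,
       (fun n => nu_o (ext_cylinder M (mkseq x n)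
                         (psi_n psi n x * g * (psi_n psi n x)^-1)%g)
                 / mu (cylinder M (mkseq x n)))%E @ \oo --> 0%E}).
Proof.
have [x0 x0E] : exists x0, xi0 = (x0, 1%g).
  by case: xi0 xi0_id => x0 g0; rewrite /fiber /= => ->; exists x0.
rewrite {xi0 xi0_id}x0E => nu_o.
have [K [mK gibbs]] :=
  weight_of_quasi_bernoulli phi_gt0 phi_holder mu_conformal mu_gibbs_markov.
have mkraft := weight_of_kraft (shift_invariant mu_G_invariant).
have connect := connecting_words M_bip psi_transitive.
have connect1 : exists UU : seq (seq W),
  (forall U, U \in UU ->
     [/\ sorted M U, psi_word psi U = 1%g & (1 <= size U)%N]) /\
  forall p q, sorted M p -> sorted M q ->
        exists2 U, U \in UU & sorted M (p ++ U ++ q).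
  by have [D /(_ 1%N) [UU [_ h1 h2]]] := connect; exists UU.
have onto (k : G) : exists2 p, sorted M p & psi_word psi p = k.
  have [w [ws _ wk]] := transitive_word (some_letter M) (some_letter M) k psi_transitive.
  by exists (some_letter M :: w).
have rho_gt0 : 0 < rho.
  have [v [vs vl v1]] :=
    transitive_word (xi 0%N) (prev_letter M (xi 0%N)) 1%g psi_transitive.
  rewrite -lte_fin rhoE; apply: (growth_rate_gt0 phi_gt0 mK gibbs _ v1).
  rewrite /= cat_path; apply/andP; split=> //=; rewrite vl andbT.
  exact: prev_letterP.
have rho01 : 0 < rho < 1 by rewrite rho_gt0.
have [lambda_div _] := prop_C.
have [_ nu0P] := nuP (x0, 1%g).
have [C Hexc] := fiber_mass_excessive phi_gt0 mK gibbs connect1 onto lambda_div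
  rho_gt0 s_rho nu0P.
set H := fiber_mass nu_o in Hexc.
have H0 k : 0 <= H k by exact: fiber_mass_ge0.
have nuE k : nu_o (fiber M k) = (H k)%:E.
  by rewrite (fiber_massE phi_gt0 mK gibbs connect1 onto lambda_div rho_gt0 s_rho nu0P).
have nu_cyl := ext_cylinder_mass phi_gt0 mK mkraft gibbs connect1 onto lambda_div
  rho_gt0 s_rho nu0P.
have small := suffix_free_mass_small mK mkraft rho01 H0 Hexc connect.
have translate := excessive_translate mK rho_gt0 Hexc H0 onto.
have [K1 _ mgt0 _ _] := mK.
have K0 : 0 <= K by exact: le_trans K1.
have fibE (k : G) n : (nu_o (fiber M k) / (rho ^+ n)%:E = (rho ^- n * H k)%:E)%E.
  by rewrite nuE inver gt_eqF ?exprn_gt0// -EFinM mulrC.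
have cylE w g : sorted M w ->
    (nu_o (ext_cylinder M w g) / mu (cylinder M w) <=
     (2 * K ^+ 3 * (rho ^- size w * H (g * psi_word psi w)%g))%:E)%E.
  move=> ws; have mw := mgt0 _ ws; rewrite mu_cylinderE inver gt_eqF//.
  have iw : (0 <= ((weight_of mu w)^-1)%:E)%E by rewrite lee_fin invr_ge0 ltW.
  apply: le_trans (lee_wpmul2r iw (nu_cyl w g)) _.
  rewrite -EFinM lee_fin le_eqVlt; apply/orP; left; apply/eqP.
  by rewrite -/(H _); field; rewrite !gt_eqF ?exprn_gt0.
have cyl0 w g : (0 <= nu_o (ext_cylinder M w g) / mu (cylinder M w))%E.
  by rewrite mule_ge0// inve_ge0.
have rho0 n : 0 <= rho ^- n by rewrite invr_ge0 exprn_ge0// ltW.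
split.
  apply: negligibleS (past_scaled_cvg0 rho_gt0 H0 small G_countable muhatP).
  move=> y; apply: contra_not => yc.
  have [c c0 cP] := translate (coords y 0).2.
  have sizeE n : size (past y n) = n by exact: size_past.
  have le n : rho ^- n * H ((coords y 0).2 * psi_word psi (past y n))%g <=
      c * scaled psi rho H (past y n).
    by rewrite /scaled sizeE mulrCA ler_wpM2l.
  split.
    apply: (cvge0_le (c := c) _ _ yc) => n; rewrite fibE lee_fin//.
    exact: mulr_ge0.
  apply: (cvge0_le (c := 2 * K ^+ 3 * c) _ _ yc) => n; first exact: cyl0.
  apply: le_trans (cylE _ _ (past_sorted y n)) _.
  by rewrite sizeE lee_fin -[leRHS]mulrA ler_wpM2l// mulr_ge0// exprn_ge0.
move=> [dag [dagK dagM psi_dag [B BP]]].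
have drev (w : seq W) : sorted M w -> sorted M (rev (map dag w)).
  by move=> ws; rewrite -map_rev (sorted_dag dagM) revK.
(* By the Gibbs property, symmetry of the potential is one of the weights. *)
have m_dag w : sorted M w ->
    weight_of mu w <= K ^+ 2 * (`|B| + 1) * weight_of mu (rev (map dag w)).
  case: w => [_|a w ws].
    rewrite /= weight_of_nil mulr1 mulr_ege1 ?exprn_ege1//.
    by rewrite lerDr.
  have [x wx] := cylinder_neq0 ws; have [y wy] := cylinder_neq0 (drev _ ws).
  have [_ h1] := gibbs _ _ wx; have [h2 _] := gibbs _ _ wy.
  have adm : admissible M (a :: w) by rewrite /admissible ws.
  have := BP _ adm _ _ wx wy.
  rewrite size_rev size_map in h2.
  rewrite ler_pdivrMr ?birkhoff_prod_gt0// => h3.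
  have py := birkhoff_prod_gt0 (size (a :: w)) y phi_gt0.
  apply: le_trans h1 _; rewrite expr2 -!mulrA ler_wpM2l//.
  apply: le_trans h3 _; apply: (@le_trans _ _ ((`|B| + 1) *
    birkhoff_prod phi (size (a :: w)) y)).
    by rewrite ler_wpM2r ?(ltW py)//; apply: le_trans (ler_norm _) _; rewrite lerDl.
  by rewrite mulrCA ler_wpM2l// addr_ge0.
have [C' C'0 H_inv'] : exists2 C', 0 <= C' & forall k k' : G,
  (forall q, psi_word psi q = k^-1 -> psi_word psi (rev (map dag q)) = k'^-1)%g ->
  H k <= C' * H k'.
  apply: (fiber_mass_map phi_gt0 mK gibbs connect1 onto lambda_div rho_gt0 s_rho
    nu0P (B := K ^+ 2 * (`|B| + 1))).
  - by rewrite mulr_ge0 ?exprn_ge0// addr_ge0.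
  - by move=> u v /(can_inj revK) /(inj_map (can_inj dagK)).
  - by move=> q; rewrite size_rev size_map.
  - by move=> q qs; split; [exact: drev|exact: m_dag].
(* Reversing words inverts their values. *)
have H_inv (k : G) : H k <= (C' + 1) * H k^-1%g.
  apply: le_trans (H_inv' k k^-1%g _) _.
    by move=> q qk; rewrite -map_rev (psi_word_dag psi_dag) revK qk.
  by rewrite ler_wpM2r// lerDl.
have B0 : 0 < K ^+ 2 * (`|B| + 1).
  by rewrite mulr_gt0 ?exprn_gt0 ?(lt_le_trans _ K1)// ltr_wpDl.
have C0 : 0 < C' + 1 by rewrite ltr_wpDl.
apply: negligibleS (path_scaled_cvg0 rho_gt0 H0 small dagK dagM psi_dag B0 C0 m_dag H_inv).
move=> x; apply: contra_not => xc.
have sizeE n : size (mkseq (letters x) n) = n by exact: size_mkseq.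
have scE n : scaled psi rho H (mkseq (letters x) n) = rho ^- n * H (psi_n psi n x).
  by rewrite /scaled sizeE.
split.
  apply: (cvge0_le (c := 1) _ _ xc) => n; rewrite fibE lee_fin.
    exact: mulr_ge0.
  by rewrite mul1r scE.
move=> g; have [c c0 cP] := translate g^-1%g.
apply: (cvge0_le (c := 2 * K ^+ 3 * ((C' + 1) * (c * (C' + 1)))) _ _ xc) => n.
  exact: cyl0.
apply: le_trans (cylE _ _ (sorted_mkseq x n)) _.
rewrite sizeE lee_fin scE -/(psi_n psi n x) mulgVK.
rewrite -[leRHS]mulrA ler_wpM2l//; first by rewrite mulr_ge0// exprn_ge0.
rewrite [leRHS]mulrCA ler_wpM2l//.
apply: le_trans (H_inv _) _; rewrite -mulrA ler_wpM2l ?(ltW C0)//.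
rewrite invgM; apply: le_trans (cP _) _; rewrite -mulrA ler_wpM2l//.
by have := H_inv (psi_n psi n x)^-1%g; rewrite invgK.
Qed.
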